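(* Let $d\ge 1$, $H\in(0,1)$, and let $X=(X_t)_{t\in[0,T]}$ be an $\mathbb{R}^d$-valued process satisfying Assumption 1 (items (i) and (ii)) with this $H$ and some constants $c_0>0$, $\theta\ge 0$, $c_1\ge 0$, $\iota\ge 0$. Suppose that $$0\leq \alpha<d\ \text{ if } Hd<1,\qquad\text{respectively}\qquad \max\Big(0,d-\frac{1}{H}\Big)<\alpha<d\ \text{ if } Hd\geq 1.$$ Then: (i) For any $t\in(0,T)$ there is a constant $c_2(t)>0$ such that $$\limsup_{r\to 0}\ \sup_{x\in\mathbb{R}^d}\ \frac{L^{\alpha,X}(x,[t-r,t+r])}{r^{1-H(d-\alpha)}(\log\log r^{-1})^{H(\theta+d-\alpha)}}\leq c_2(t)\qquad \mathbb{P}\text{-a.s.}$$ (ii) There is a constant $c_3>0$ such that $$\limsup_{r\to 0}\ \sup_{t\in(0,T)}\ \sup_{x\in\mathbb{R}^d}\ \frac{L^{\alpha,X}(x,[t-r,t+r])}{r^{1-H(d-\alpha)}(\log r^{-1})^{H(\theta+d-\alpha)}}\leq c_3\qquad \mathbb{P}\text{-a.s.}$$ The constants $c_2(t)$ and $c_3$ are deterministic.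
   Context: $T>0$ is fixed. $X=(X_t)_{t\in[0,T]}$ is a jointly measurable $\mathbb{R}^d$-valued process on a probability space $(\Omega,\mathcal{F},\mathbb{P})$. $\|\cdot\|$ is the Euclidean norm, $\mathcal{L}^d$ Lebesgue measure on $\mathbb{R}^d$, $\omega_d$ the volume of the unit ball of $\mathbb{R}^d$. ''$\mathbb{P}$-a.s.'' means on a set containing an event of probability one. Assumption 1. (i) There exist $c_0>0$ and $\theta\geq 0$ such that for any $n\in\mathbb{N}$, any $\xi_j=(\xi_j^1,\ldots,\xi_j^d)\in(\mathbb{R}\setminus\{0\})^d$, $j=1,\ldots,n$, any partition $0=t_0<t_1<\ldots<t_n<T$, and any $k_{j,\ell}\in\{0,4\}$, $$\Big|\mathbb{E}\Big[\exp\Big(i\sum_{j=1}^n\langle\xi_j,X_{t_j}-X_{t_{j-1}}\rangle\Big)\Big]\Big|\leq c_0^n n^{H\theta n}\prod_{j=1}^n\prod_{\ell=1}^d\frac{1}{|\xi_j^\ell|^{k_{j,\ell}}(t_j-t_{j-1})^{Hk_{j,\ell}}}.$$ (ii) There exist $c_1\geq 0$ and $\iota\geq 0$ such that for any $p\geq 1$ and all $0\leq s<t\leq T$, $\mathbb{E}\|X_t-X_s\|^p\leq c_1^p p^{\iota p}|t-s|^{Hp}$. Occupation measures: for $0\le s<t\le T$, $\mu^X_{s,t}(A):=\mathcal{L}^1(\{u\in[s,t]: X_u\in A\})$, $A\subset\mathbb{R}^d$ Borel. For $0<\alpha<d$, $$U^\alpha\mu^X_{s,t}(x):=\int_{\mathbb{R}^d}\|x-y\|^{\alpha-d}\mu^X_{s,t}(dy)=\int_s^t\|x-X_u\|^{\alpha-d}du\in[0,+\infty].$$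 $X$ has continuous local times if there is a random field $\{L^X_t(x):t\in[0,T],x\in\mathbb{R}^d\}$ such that $(t,x)\mapsto L^X_t(x)$ is $\mathbb{P}$-a.s. continuous and for any $t\in[0,T]$, $\mu^X_{0,t}(dx)=L^X_t(x)\mathcal{L}^d(dx)$ $\mathbb{P}$-a.s. For $0\le s<t\le T$ and $x\in\mathbb{R}^d$, $$L^{\alpha,X}(x,[s,t]):=\begin{cases}\frac{\alpha}{d\omega_d}U^\alpha\mu^X_{s,t}(x)&\text{for }0<\alpha<d,\\ L^X_t(x)-L^X_s(x)&\text{for }\alpha=0.\end{cases}$$ The case $\alpha=0$ occurs only if $Hd<1$; in that case it is known that $X$ has continuous local times. Time intervals $[t-r,t+r]$ are understood to be intersected with $[0,T]$. *)

(* Defs.v *)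
From HB Require Import structures.
From mathcomp Require Import all_boot all_order all_algebra.
From mathcomp Require Import all_classical all_reals all_analysis.
From mathcomp Require Import measurable_realfun.
From mathcomp.real_closed Require Import complex.

Set Implicit Arguments.
Unset Strict Implicit.
Unset Printing Implicit Defensive.

Import Order.TTheory GRing.Theory Num.Theory.
Import numFieldNormedType.Exports.

Local Open Scope classical_set_scope.
Local Open Scope ring_scope.

Section borel_rV.
Context {R : realType} {n : nat}.

Definition borel_rV : set (set 'rV[R]_n) := <<s [set A | open A] >>.

Let borel_rV0 : borel_rV set0.
Proof. exact: sigma_algebra0. Qed.

Let borel_rVC A : borel_rV A -> borel_rV (~` A).
Proof. exact: sigma_algebraC. Qed.

Let borel_rV_bigcup (F : (set 'rV[R]_n)^nat) :
  (forall i, borel_rV (F i)) -> borel_rV (\bigcup_i F i).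
Proof. exact: sigma_algebra_bigcup. Qed.

HB.instance Definition _ := @isMeasurable.Build default_measure_display
  'rV[R]_n borel_rV
  borel_rV0 borel_rVC borel_rV_bigcup.

Lemma open_rV_measurable (A : set 'rV[R]_n) : open A -> measurable A.
Proof. by move=> oA; apply: sub_sigma_algebra. Qed.

Lemma measurable_coord (i : 'I_n) :
  measurable_fun [set: 'rV[R]_n] (fun x : 'rV[R]_n => x ord0 i).
Proof.
apply: (measurability _ (RGenOpens.measurableE R)).
move=> _ [_ [a [b ->] <-]]; rewrite setTI; apply: open_rV_measurable.
have oU : open `]a, b[%classic by exact: interval_open.
by apply: open_comp => // x _; exact: coord_continuous.
Qed.

Lemma open_rV_bigcup (A : set 'rV[R]_n) : open A ->
  A = \bigcup_(p in [set p : 'rV[rat]_n * nat |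
        ball (map_mx ratr p.1 : 'rV[R]_n) p.2.+1%:R^-1 `<=` A])
        ball (map_mx ratr p.1 : 'rV[R]_n) p.2.+1%:R^-1.
Proof.
move=> oA; apply/seteqP; split=> [x Ax|x [p /= pA xp]]; last exact: pA.
have /nbhs_ballP[e/= e0 eA] : nbhs x A by exact: open_nbhs_nbhs.
have [k ke] := ltr_add_invr (divr_gt0 e0 (ltr0n R 2)).
rewrite add0r in ke.
have k0 : (0 : R) < k.+1%:R^-1 by rewrite invr_gt0 ltr0n.
have /choice[q qP] i : exists q : rat, `|ratr q - x ord0 i| < k.+1%:R^-1.
  have [|q] := @rat_in_itvoo R (x ord0 i - k.+1%:R^-1) (x ord0 i + k.+1%:R^-1).
    by rewrite ltrD2l gt0_cp.
  by rewrite in_itv/= => ?; exists q; rewrite ltr_distlC -ltr_distlC ltr_distl.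
have qx : ball (map_mx ratr (\row_i q i) : 'rV[R]_n) k.+1%:R^-1 x.
  by split=> // i j; rewrite !mxE (ord1 i) /ball/=; exact: qP.
exists (\row_i q i, k) => //= y qy; apply: eA.
apply: (@le_ball _ _ x (k.+1%:R^-1 + k.+1%:R^-1)).
  by move: ke; rewrite ltr_pdivlMr// mulr_natr mulr2n => /ltW.
by apply: ball_triangle qy; apply: ball_sym.
Qed.

Lemma measurable_fun_rV d (T : measurableType d) (f : T -> 'rV[R]_n) :
  (forall i, measurable_fun [set: T] (fun t => f t ord0 i)) ->
  measurable_fun [set: T] f.
Proof.
move=> mf; apply: (measurability [set A : set 'rV[R]_n | open A]) => //.
move=> _ [U oU <-]; rewrite setTI (open_rV_bigcup oU) preimage_bigcup.
rewrite bigcup_mkcond; apply: countable_bigcupT_measurable => // -[q k] /=.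
case: ifPn => // _.
rewrite [X in measurable X](_ : _ = \bigcap_(i : 'I_n)
    (fun t => f t ord0 i) @^-1` ball (ratr (q ord0 i) : R) k.+1%:R^-1).
  apply: fin_bigcap_measurable => // i _.
  rewrite -[X in measurable X]setTI; apply: mf => //.
  exact: measurable_ball.
apply/seteqP; split=> [t [_ h] i _|t h] /=.
  by have := h ord0 i; rewrite mxE.
by split=> [|i j]; [rewrite invr_gt0 ltr0n|rewrite mxE (ord1 i); exact: h].
Qed.

End borel_rV.

Section lebesgue_rV.
Context {R : realType}.

Definition cons_rV n (p : R * 'rV[R]_n) : 'rV[R]_n.+1 :=
  row_mx (p.1%:M : 'rV_1) p.2.

Lemma cons_rV0 n (p : R * 'rV[R]_n) : cons_rV p ord0 ord0 = p.1.
Proof.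
have -> : cons_rV p ord0 ord0 = cons_rV p ord0 (lshift n (ord0 : 'I_1)).
  by congr (cons_rV p _ _); exact/val_inj.
by rewrite [LHS]row_mxEl mxE eqxx.
Qed.

Lemma cons_rVS n (p : R * 'rV[R]_n) (i : 'I_n) :
  cons_rV p ord0 (lift ord0 i) = p.2 ord0 i.
Proof.
have -> : cons_rV p ord0 (lift ord0 i) = cons_rV p ord0 (rshift 1 i).
  by congr (cons_rV p _ _); exact/val_inj.
exact: row_mxEr.
Qed.

Lemma measurable_cons_rV n : measurable_fun [set: R * 'rV[R]_n] (@cons_rV n).
Proof.
apply: measurable_fun_rV => i; have [j ->|->] := unliftP ord0 i.
  rewrite (_ : (fun _ => _) = (fun x : 'rV_n => x ord0 j) \o snd).
    exact: measurableT_comp (measurable_coord j) _.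
  by apply/funext => p/=; rewrite cons_rVS.
rewrite (_ : (fun _ => _) = fst); first exact: measurable_fst.
by apply/funext => p/=; rewrite cons_rV0.
Qed.

(* [cons_rV] transports the product of the one-dimensional Lebesgue measure
   with the measure on ['rV_m]; [lebesgue_rV_box] below gives the value on
   boxes, which characterizes the result. *)
Fixpoint lebesgue_rV_rec n : set 'rV[R]_n -> \bar R :=
  match n with
  | 0 => \d_(0 : 'rV[R]_0)
  | m.+1 =>
    pushforward (@lebesgue_measure R \x @lebesgue_rV_rec m)%E (@cons_rV m)
  end.

Definition lebesgue_rV n : set 'rV[R]_n -> \bar R := @lebesgue_rV_rec n.

Definition box_rV n (a b : 'rV[R]_n) : set 'rV[R]_n :=
  [set x | forall i, a ord0 i <= x ord0 i <= b ord0 i].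

Lemma measurable_box_rV n (a b : 'rV[R]_n) : measurable (box_rV a b).
Proof.
rewrite (_ : box_rV a b = \bigcap_(i : 'I_n)
    (fun x : 'rV_n => x ord0 i) @^-1` `[a ord0 i, b ord0 i]).
  apply: fin_bigcap_measurable => // i _.
  by rewrite -[X in measurable X]setTI; exact: measurable_coord.
apply/seteqP; split=> [x h i _|x h i] /=.
  by rewrite in_itv/=; exact: h.
by have := h i I; rewrite /= in_itv.
Qed.

Let is_lebesgue n := [/\ @lebesgue_rV n set0 = 0%E,
  (forall A, 0 <= @lebesgue_rV n A)%E, semi_sigma_additive (@lebesgue_rV n) &
  forall a b : 'rV[R]_n, (forall i, a ord0 i <= b ord0 i) ->
     lebesgue_rV (box_rV a b) = (\prod_i (b ord0 i - a ord0 i))%:E].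

Let is_lebesgue_sigma_finite n : is_lebesgue n ->
  sigma_finite setT (@lebesgue_rV n).
Proof.
move=> [_ _ _ boxE]; exists (fun k => box_rV (const_mx (- k%:R)) (const_mx k%:R)).
  apply/seteqP; split=> // x _.
  have [k xk] : exists k : nat, forall i, `|x ord0 i| <= k%:R.
    exists (\max_i Num.bound `|x ord0 i|)%N => i.
    rewrite (le_trans (ltW (archi_boundP _)))// ler_nat.
    exact: leq_bigmax.
  by exists k => // i; rewrite !mxE -ler_norml.
move=> k; split; first exact: measurable_box_rV.
rewrite boxE ?ltry// => i; rewrite !mxE.
by rewrite (@le_trans _ _ 0)// oppr_le0.
Qed.

Let is_lebesgueP n : is_lebesgue n.
Proof.
elim: n => [|n IH].
  split; [exact: measure0|exact: measure_ge0| |].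
    exact: measure_semi_sigma_additive.
  move=> a b _; rewrite big_ord0 /lebesgue_rV /= diracE mem_set//.
  by move=> [].
have [mu0 mu_ge0 mu_sigma boxE] := IH.
pose mu1 := isMeasure.Build _ _ _ _ mu0 mu_ge0 mu_sigma.
pose mu2 : {measure set _ -> \bar R} := HB.pack (@lebesgue_rV n) mu1.
pose mu3 := Measure_isSigmaFinite.Build _ _ _ mu2 (is_lebesgue_sigma_finite IH).
pose mu : {sigma_finite_measure set _ -> \bar R} := HB.pack (@lebesgue_rV n) mu1 mu3.
have mf := @measurable_cons_rV n.
have E : @lebesgue_rV n.+1 = pushforward (@lebesgue_measure R \x mu)%E (@cons_rV n).
  by [].
pose nu : {measure set (measurableTypeR R * 'rV[R]_n) -> \bar R} := (@lebesgue_measure R \x mu)%E.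
split; rewrite ?E.
- exact: measure0.
- by move=> A; apply: integral_ge0 => x _; exact: mu_ge0.
- exact: (@measure_semi_sigma_additive _ _ _ (pushforward nu (@cons_rV n))).
move=> a b ab; pose a' : 'rV[R]_n := \row_i a ord0 (lift ord0 i).
pose b' : 'rV[R]_n := \row_i b ord0 (lift ord0 i).
rewrite /pushforward [X in (_ \x _)%E X](_ : _ =
    `[a ord0 ord0, b ord0 ord0] `*` box_rV a' b').
  rewrite product_measure1E//; last exact: measurable_box_rV.
  rewrite /= lebesgue_measure_itv/= lte_fin.
  rewrite boxE => [|i]; last by rewrite !mxE.
  rewrite big_ord_recl EFinM; under eq_bigr do rewrite !mxE.
  case: ltP => // ba; rewrite (_ : b ord0 ord0 = a ord0 ord0) ?subrr//.
  by apply/eqP; rewrite eq_le ba ab.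
apply/seteqP; split=> [[x y]/= h|[x y]/= [+ h] i].
  split; first by have := h ord0; rewrite cons_rV0 in_itv.
  by move=> i; have := h (lift ord0 i); rewrite cons_rVS !mxE.
rewrite in_itv/= => xab; have [j ->|->] := unliftP ord0 i.
  by rewrite cons_rVS; have := h j; rewrite !mxE.
by rewrite cons_rV0.
Qed.

Let lebesgue_rV0 n : @lebesgue_rV n set0 = 0%E.
Proof. by have [] := is_lebesgueP n. Qed.

Let lebesgue_rV_ge0 n (A : set 'rV[R]_n) : (0 <= lebesgue_rV A)%E.
Proof. by have [] := is_lebesgueP n. Qed.

Let lebesgue_rV_sigma_additive n : semi_sigma_additive (@lebesgue_rV n).
Proof. by have [] := is_lebesgueP n. Qed.

HB.instance Definition _ n := isMeasure.Build _ _ _ (@lebesgue_rV n)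
  (@lebesgue_rV0 n) (@lebesgue_rV_ge0 n) (@lebesgue_rV_sigma_additive n).

HB.instance Definition _ n := Measure_isSigmaFinite.Build _ _ _
  (@lebesgue_rV n) (is_lebesgue_sigma_finite (is_lebesgueP n)).

Lemma lebesgue_rV_box n (a b : 'rV[R]_n) :
  (forall i, a ord0 i <= b ord0 i) ->
  lebesgue_rV (box_rV a b) = (\prod_i (b ord0 i - a ord0 i))%:E.
Proof. by have [_ _ _] := is_lebesgueP n; apply. Qed.

End lebesgue_rV.
Arguments lebesgue_rV {R n}.

Section euclidean.
Context {R : realType} {d : nat}.
Implicit Types x y : 'rV[R]_d.

Definition dotrv x y : R := \sum_(l < d) x ord0 l * y ord0 l.

(* The library norm on ['rV[R]_d] is the sup norm. *)
Definition enorm x : R := Num.sqrt (dotrv x x).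

Definition unit_ball_volume : R :=
  fine (lebesgue_rV [set x : 'rV[R]_d | enorm x <= 1]).

(* The value at the origin is explicit because [powR 0 a = 0] for every
   [a != 0], also when [a < 0]. *)
Definition riesz_kernel (alpha : R) x : \bar R :=
  if x == 0 then +oo%E else (enorm x `^ (alpha - d%:R))%:E.

Definition riesz_potential (alpha : R) (mu : set 'rV[R]_d -> \bar R) x :
    \bar R :=
  (\int[mu]_y riesz_kernel alpha (x - y))%E.

Definition occupation_measure (Y : R -> 'rV[R]_d) (s t : R) :
    set 'rV[R]_d -> \bar R :=
  fun A => lebesgue_measure (`[s, t] `&` Y @^-1` A).

End euclidean.
Arguments unit_ball_volume R d : clear implicits.

Section process.
Context {R : realType} {dO : measure_display} {Omega : measurableType dO}.
Variable P : probability Omega R.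

Definition expi (x : R) : R[i] := Complex (cos x) (sin x).

Definition cexpectation (Z : Omega -> R[i]) : R[i] :=
  Complex (fine 'E_P[fun w => complex.Re (Z w)])
          (fine 'E_P[fun w => complex.Im (Z w)]).

Context {d : nat}.
Variables (T : R) (X : R -> Omega -> 'rV[R]_d).

(* The time set [0, T] is rendered by a total family indexed by [R]; every
   condition below only involves times in [0, T]. *)
Definition jointly_measurable : Prop :=
  measurable_fun (`[0, T] `*` [set: Omega]) (fun p : R * Omega => X p.1 p.2).

(* The partition is t 0, ..., t n; since indices of ['I_n] start at 0, [j]
   stands for the interval from [t j] to [t j.+1]. *)
Definition charfun_increments_bound (H c0 theta : R) : Prop :=
  forall (n : nat) (xi : 'I_n -> 'rV[R]_d) (t : nat -> R)
    (k : 'I_n -> 'I_d -> nat),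
  (0 < n)%N ->
  (forall j l, xi j ord0 l != 0) ->
  t 0%N = 0 -> (forall j, (j < n)%N -> t j < t j.+1) -> t n < T ->
  (forall j l, k j l = 0%N \/ k j l = 4%N) ->
  Normc.normc (cexpectation (fun w =>
      expi (\sum_(j < n) dotrv (xi j) (X (t j.+1) w - X (t j) w))))
  <= c0 ^+ n * n%:R `^ (H * theta * n%:R) *
     \prod_(j < n) \prod_(l < d)
       (`|xi j ord0 l| ^+ k j l * (t j.+1 - t j) `^ (H * (k j l)%:R))^-1.

Definition moment_increments_bound (H c1 iota : R) : Prop :=
  forall p s t : R, 1 <= p -> 0 <= s -> s < t -> t <= T ->
  ('E_P[fun w => (enorm (X t w - X s w) `^ p)%R]
   <= (c1 `^ p * p `^ (iota * p) * `|t - s| `^ (H * p))%:E)%E.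

Definition continuous_local_times (L : R -> 'rV[R]_d -> Omega -> R) : Prop :=
  [/\ forall t x, 0 <= t <= T -> measurable_fun [set: Omega] (L t x),
      {ae P, forall w, {within `[0, T] `*` [set: 'rV[R]_d],
        continuous (fun p : R * 'rV[R]_d => L p.1 p.2 w)}} &
      forall t, 0 <= t <= T -> {ae P, forall w, forall A, measurable A ->
        occupation_measure (X ^~ w) 0 t A =
        (\int[lebesgue_rV]_(x in A) (L t x w)%:E)%E}].

(* [L] is only used for alpha = 0, where it stands for the continuous local
   times of X. *)
Definition fractional_local_time (alpha : R) (L : R -> 'rV[R]_d -> Omega -> R)
    (w : Omega) (x : 'rV[R]_d) (s t : R) : \bar R :=
  if alpha == 0 then (L t x w - L s x w)%:E
  else ((alpha / (d%:R * unit_ball_volume R d))%:E *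
        riesz_potential alpha (occupation_measure (X ^~ w) s t) x)%E.

(* On the time interval [t - r, t + r] intersected with [0, T]. *)
Definition fractional_local_time_around (alpha : R)
    (L : R -> 'rV[R]_d -> Omega -> R) (w : Omega) (x : 'rV[R]_d) (t r : R) :
    \bar R :=
  fractional_local_time alpha L w x (Num.max 0 (t - r)) (Num.min (t + r) T).

End process.

(* Main.v *)
(** For an interval [[s, t]] of length at most [h] and an even integer [n], put
[rho = (h / n)^H] and regard [(X_u - X_0) / rho] as a path on the torus. If [g]
is a trigonometric polynomial on the torus, expanding the [n]-fold product of
[g] along ordered times and applying the bound on the characteristic function
of the increments controls the [n]-th moment of the integral of [g] over
[[s, t]]. For Fejer kernels at frequency [2^q] (case [alpha > 0]) or differences
of two consecutive ones (case [alpha = 0]) that moment gains a factor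
[2^(- q eta n)], so Markov's inequality and a union bound over [q] and over a
grid of mesh [2^(-q)] bound all these integrals by a multiple of
[2^(- q eta') n^(H theta) h], for any [eta' < eta], outside an event of
probability at most [exp (- 2 n)]. Outside that event, summing over [q] bounds
the Riesz potential through the masses of the balls of radius [2^(-q) rho], and
the local time through telescoping Fejer averages; either way the supremum over [x] is at most
[C * n^(H (theta + d - alpha)) * h^(1 - H (d - alpha))]. Borel-Cantelli along
[h ~ 2^(-k)] concludes, with [n ~ log k] for a fixed time and [n ~ 2 k] for all
of the [~ T 2^k] intervals covering [[0, T]]. *)
Require Import Defs.
From mathcomp Require Import all_boot all_order all_algebra.
From mathcomp Require Import all_classical all_reals all_analysis.
From mathcomp Require Import measurable_realfun.
From mathcomp Require Import ring lra zify.
From mathcomp.real_closed Require Import complex.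

Set Implicit Arguments.
Unset Strict Implicit.
Unset Printing Implicit Defensive.

Import Order.TTheory GRing.Theory Num.Theory.
Import numFieldNormedType.Exports.

Local Open Scope classical_set_scope.
Local Open Scope ring_scope.

(** * Bounded measurable functions *)

(** On the torus a kernel is a finite sum of exponentials, and finitely many grid points serve every
    centre [x] in R^d, however far the path travels; reducing a nonnegative kernel modulo 2 pi can
    only overcount a ball. The obstacle is that, in terms of increments, the frequencies of an
    [n]-fold product are tail sums, so the bound on the characteristic function does not split into
    one factor per kernel. Frequencies are therefore summed out one at a time, uniformly in the
    shift left by the others; for kernel differences, whose coefficients grow with the unshifted
    frequency, a weight on frequencies carries the excess to the next factor. Each increment [tau]
    then costs a power (n tau / h)^(- a). An inserted exponential of - n tau / h loses only e^n in
    all and brings each time integral down to order h / n, which absorbs the n! of the ordering: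
    this fixes [rho]. Integrability in time asks for a < 1, that is eta < 1 / H when a = H eta,
    while summing the masses of balls over [q] asks for eta > d - alpha; the two are compatible
    exactly when H (d - alpha) < 1. *)

Definition bounded_measurable d (T : measurableType d) (R : realType) (f : T -> R) :=
  measurable_fun setT f /\ exists M, forall x, `|f x| <= M.

Section bounded_measurable_theory.
Context {d : measure_display} {T : measurableType d} {R : realType}.
Implicit Types f g : T -> R.

Lemma bmf_cst (c : R) : bounded_measurable (fun _ : T => c).
Proof. by split; [exact: measurable_cst|exists `|c|]. Qed.

Lemma bmfD f g : bounded_measurable f -> bounded_measurable g ->
  bounded_measurable (fun x => f x + g x).
Proof.
move=> [mf [M fM]] [mg [N gN]]; split; first exact: measurable_funD.
by exists (M + N) => x; rewrite (le_trans (ler_normD _ _))// lerD.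
Qed.

Lemma bmfM f g : bounded_measurable f -> bounded_measurable g ->
  bounded_measurable (fun x => f x * g x).
Proof.
move=> [mf [M fM]] [mg [N gN]]; split; first exact: measurable_funM.
by exists (M * N) => x; rewrite normrM ler_pM.
Qed.

Lemma bmfN f : bounded_measurable f -> bounded_measurable (fun x => - f x).
Proof.
move=> hf; have := bmfM (bmf_cst (-1)) hf.
by under eq_fun do rewrite mulN1r.
Qed.

Lemma bmfB f g : bounded_measurable f -> bounded_measurable g ->
  bounded_measurable (fun x => f x - g x).
Proof. by move=> hf hg; apply: bmfD => //; exact: bmfN. Qed.

Lemma bmf_prod (I : Type) (s : seq I) (F : I -> T -> R) :
  (forall i, bounded_measurable (F i)) ->
  bounded_measurable (fun x => \prod_(i <- s) F i x).
Proof.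
move=> hF; elim: s => [|a s IH].
  by under eq_fun do rewrite big_nil; exact: bmf_cst.
by under eq_fun do rewrite big_cons; exact: bmfM.
Qed.

Lemma bmfX n f : bounded_measurable f -> bounded_measurable (fun x => f x ^+ n).
Proof.
move=> hf; elim: n => [|n IH]; first exact: bmf_cst.
by under eq_fun do rewrite exprS; exact: bmfM.
Qed.

Lemma bmf_norm f : bounded_measurable f -> bounded_measurable (fun x => `|f x|).
Proof.
move=> [mf [M fM]]; split; first exact: measurableT_comp.
by exists M => x; rewrite normr_id.
Qed.

Lemma bmf_comp d' (U : measurableType d') (f : U -> R) (h : T -> U) :
  measurable_fun setT h -> bounded_measurable f -> bounded_measurable (f \o h).
Proof.
by move=> mh [mf [M fM]]; split; [exact: measurableT_comp|exists M => x /=].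
Qed.

Lemma bmf_bool (p : T -> bool) : measurable_fun setT p ->
  bounded_measurable (fun x => (p x)%:R : R).
Proof.
move=> mp; split; last by exists 1 => x; case: (p x); rewrite ?normr1 ?normr0.
rewrite (_ : (fun _ => _) = (fun x => if p x then 1 else 0)); last first.
  by apply/funext => x; case: (p x).
exact: measurable_fun_ifT.
Qed.

Lemma bmf_lt f g : measurable_fun setT f -> measurable_fun setT g ->
  bounded_measurable (fun x => (f x < g x)%R%:R : R).
Proof. by move=> mf mg; apply: bmf_bool; exact: measurable_fun_ltr. Qed.

Lemma bmf_integrable (mu : {finite_measure set T -> \bar R}) D f : measurable D ->
  bounded_measurable f -> mu.-integrable D (EFin \o f).
Proof.
move=> mD [mf [M fM]]; apply: (@integrableS _ _ _ _ setT) => //.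
apply: measurable_bounded_integrable => //.
  by rewrite (fin_num_fun_lty (@fin_num_measure _ _ _ mu))//.
exists M; split; first exact: num_real.
by move=> x Mx y _ /=; rewrite (le_trans (fM y))// ltW.
Qed.

Lemma Rintegral_bound (mu : {finite_measure set T -> \bar R}) f M :
  bounded_measurable f -> (forall x, `|f x| <= M) ->
  `|\int[mu]_x f x| <= M * fine (mu setT).
Proof.
move=> bf fM; rewrite (le_trans (le_normr_Rintegral _ _))//.
  exact: bmf_integrable.
rewrite -Rintegral_cst// le_Rintegral//.
- by apply: bmf_integrable => //; exact: bmf_norm.
- by apply: bmf_integrable => //; exact: bmf_cst.
Qed.

End bounded_measurable_theory.

Section bounded_fubini.
Context {d1 d2 : measure_display} {T1 : measurableType d1}
  {T2 : measurableType d2} {R : realType}.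
Variables (m1 : {finite_measure set T1 -> \bar R})
  (m2 : {finite_measure set T2 -> \bar R}).
Variable f : T1 * T2 -> R.
Hypothesis bf : bounded_measurable f.

Lemma bmf_pair1 x : bounded_measurable (fun y => f (x, y)).
Proof. by apply: (bmf_comp (h := fun y => (x, y))) => //; exact: pair1_measurable. Qed.

Lemma bmf_pair2 y : bounded_measurable (fun x => f (x, y)).
Proof. by apply: (bmf_comp (h := fun x => (x, y))) => //; exact: pair2_measurable. Qed.

Let intf : (m1 \x m2)%E.-integrable setT (EFin \o f).
Proof.
have [mf [M fM]] := bf; apply/integrable12ltyP; first exact/measurable_EFinP.
have M0 x : (0 <= `|f x|) by [].
apply: (@le_lt_trans _ _ (\int[m1]_x \int[m2]_y (cst `|M|%:E y))%E).
  apply: ge0_le_integral => //.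
  - by move=> x _; exact: integral_ge0.
  - apply: (measurable_fun_fubini_tonelli_F (abse \o EFin \o f)) => //=.
    by apply/measurable_EFinP; exact: measurableT_comp.
  move=> x _; apply: ge0_le_integral => //.
    apply/measurable_EFinP; apply: measurableT_comp => //.
    by have [] := bmf_pair1 x.
  by move=> y _; rewrite lee_fin/= (le_trans (fM _))// ler_norm.
under eq_integral do rewrite integral_cst//.
rewrite integral_cst// lte_mul_pinfty ?mule_ge0//.
  by rewrite fin_numM// fin_num_measure.
by rewrite (fin_num_fun_lty (@fin_num_measure _ _ _ m1)).
Qed.

Let R12 x : (\int[m2]_y (f (x, y))%:E)%E = (\int[m2]_y f (x, y))%R%:E.
Proof.
rewrite /Rintegral fineK//; apply: integrable_fin_num => //.
by apply: bmf_integrable => //; exact: bmf_pair1.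
Qed.

Let R21 y : (\int[m1]_x (f (x, y))%:E)%E = (\int[m1]_x f (x, y))%R%:E.
Proof.
rewrite /Rintegral fineK//; apply: integrable_fin_num => //.
by apply: bmf_integrable => //; exact: bmf_pair2.
Qed.

Lemma bmf_Rintegral2_ : bounded_measurable (fun x => \int[m2]_y f (x, y)).
Proof.
have [_ [M fM]] := bf; split.
  apply/measurable_EFinP; have := measurable_fubini_F intf.
  by apply: eq_measurable_fun => x _; rewrite /fubini_F R12.
exists (M * fine (m2 setT)) => x.
by apply: Rintegral_bound => //; exact: bmf_pair1.
Qed.

Lemma bmf_Rintegral1_ : bounded_measurable (fun y => \int[m1]_x f (x, y)).
Proof.
have [_ [M fM]] := bf; split.
  apply/measurable_EFinP; have := measurable_fubini_G intf.
  by apply: eq_measurable_fun => x _; rewrite /fubini_G R21.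
exists (M * fine (m1 setT)) => x.
by apply: Rintegral_bound => //; exact: bmf_pair2.
Qed.

Lemma Rintegral_fubini :
  \int[m1]_x (\int[m2]_y f (x, y)) = \int[m2]_y (\int[m1]_x f (x, y)).
Proof.
rewrite /Rintegral; congr fine.
under eq_integral do rewrite -R12; under [RHS]eq_integral do rewrite -R21.
exact: (Fubini intf).
Qed.

End bounded_fubini.

Section bounded_fubini_sections.
Context {d1 d2 : measure_display} {T1 : measurableType d1}
  {T2 : measurableType d2} {R : realType}.
Variable f : T1 * T2 -> R.
Hypothesis bf : bounded_measurable f.

(** Only one measure is involved here; [mzero] fills the slot of the other one in the Fubini
    section. *)
Lemma bmf_Rintegral2 (m2 : {finite_measure set T2 -> \bar R}) :
  bounded_measurable (fun x => \int[m2]_y f (x, y)).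
Proof. exact: (bmf_Rintegral2_ mzero m2 bf). Qed.

Lemma bmf_Rintegral1 (m1 : {finite_measure set T1 -> \bar R}) :
  bounded_measurable (fun y => \int[m1]_x f (x, y)).
Proof. exact: (bmf_Rintegral1_ m1 mzero bf). Qed.

End bounded_fubini_sections.

(** * Moments of integrals over ordered times *)

Section ordered_moment.
Context {R : realType}.
Variable lam : {finite_measure set (measurableTypeR R) -> \bar R}.
Hypothesis lam1 : forall x : R, lam [set x] = 0%E.

Section pathwise.
Variable g : R -> R.
Hypothesis bg : @bounded_measurable _ (measurableTypeR R) R g.

(** Its powers unfold into integrals over increasing times, which is how an [n]-th moment becomes n!
    times an iterated integral. *)
Definition tail_integral (u : R) : R := \int[lam]_v ((u < v)%R%:R * g v).
Local Notation F := tail_integral.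

Let bmfR (f : R -> R) := @bounded_measurable _ (measurableTypeR R) R f.

Let blt1 (u : R) : bmfR (fun v => (u < v)%R%:R).
Proof. exact: (@bmf_lt _ (measurableTypeR R) R (fun=> u) id (measurable_cst u) (@measurable_id _ _ _)). Qed.

Let blt2 (u : R) : bmfR (fun v => (v < u)%R%:R).
Proof. exact: (@bmf_lt _ (measurableTypeR R) R id (fun=> u) (@measurable_id _ _ _) (measurable_cst u)). Qed.

Lemma bmf_tail_integral : bmfR F.
Proof.
pose f (p : measurableTypeR R * measurableTypeR R) : R := (p.1 < p.2)%R%:R * g p.2.
have bf : bounded_measurable f.
  apply: bmfM; first exact: bmf_lt measurable_fst measurable_snd.
  exact: (bmf_comp (h := snd)).
exact: (bmf_Rintegral2 bf lam).
Qed.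

(** The two integrands differ only at [v = z], a null set because [lam] has no atoms. *)
Let tail_split (u z : R) : u < z ->
  \int[lam]_v ((u < v)%R%:R * (v < z)%R%:R * g v) = F u - F z.
Proof.
move=> uz; have b1 : bmfR (fun v => (u < v)%R%:R * g v) by exact: (bmfM (blt1 _) bg).
have b2 : bmfR (fun v => (z < v)%R%:R * g v) by exact: (bmfM (blt1 _) bg).
have b3 : bmfR (fun v => (u < v)%R%:R * (v < z)%R%:R * g v).
  by apply: bmfM => //; apply: bmfM; [exact: (blt1 u)|exact: (blt2 z)].
apply/eqP; rewrite -subr_eq0 /F; apply/eqP.
rewrite -!RintegralB//; try by apply: bmf_integrable => //; try exact: bmfB.
pose h v := (u < v)%R%:R * (v < z)%R%:R * g v - ((u < v)%R%:R * g v - (z < v)%R%:R * g v).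
have bh : bmfR h by apply: bmfB => //; exact: bmfB.
rewrite /Rintegral (@negligible_integral _ _ _ lam setT [set z] (EFin \o h))//; [|exact: bmf_integrable|exact: lam1].
rewrite integral0_eq// => v [_ /eqP vz] /=; congr EFin; rewrite /h.
have [zv|vz'] := ltP z v.
  by rewrite (lt_trans uz zv) ltNge (ltW zv) /=; ring.
have -> : v < z by rewrite lt_neqAle vz.
by rewrite /=; ring.
Qed.


(* [F = tail_integral g] has formal derivative [- g]: this is
   [d (F ^ k.+1) = - k.+1 F ^ k g]. *)
Lemma tail_integralX k (u : R) :
  F u ^+ k.+1 = k.+1%:R * \int[lam]_v ((u < v)%R%:R * g v * F v ^+ k).
Proof.
elim: k u => [|k IH] u.
  by rewrite expr1 mul1r; under [RHS]eq_Rintegral do rewrite expr0 mulr1.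
set I := (X in _ = _ * X).
(* The induction hypothesis inside [I], Fubini and [tail_split] bring back [I] with coefficient
   [- k.+1], so a linear equation determines it. *)
suff IE : I = F u ^+ k.+2 - k.+1%:R * I.
  by rewrite -(natr1 k.+1) mulrDl mul1r {2}IE addrC subrK.
pose f (p : measurableTypeR R * measurableTypeR R) : R :=
  (u < p.1)%R%:R * g p.1 * ((p.1 < p.2)%R%:R * g p.2 * F p.2 ^+ k).
have bf : bounded_measurable f.
  apply: bmfM.
    apply: bmfM; last exact: (bmf_comp (h := fst)).
    exact: (@bmf_lt _ _ _ (fun=> u) fst (measurable_cst u) measurable_fst).
  apply: bmfM.
    apply: bmfM; last exact: (bmf_comp (h := snd)).
    exact: bmf_lt measurable_fst measurable_snd.
  apply: bmfX; apply: (bmf_comp (h := snd)) => //; exact: bmf_tail_integral.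
have I2 : I = k.+1%:R * \int[lam]_v (\int[lam]_z f (v, z)).
  rewrite -RintegralZl//; last first.
    by apply: bmf_integrable => //; exact: (bmf_Rintegral2 bf lam).
  apply: eq_Rintegral => v _; rewrite IH /f /=.
  rewrite RintegralZl//; first by rewrite mulrCA.
  apply: bmf_integrable => //; apply: bmfM; first exact: (bmfM (blt1 _) bg).
  by apply: bmfX; exact: bmf_tail_integral.
rewrite [LHS]I2 (Rintegral_fubini lam lam bf).
have -> : \int[lam]_z (\int[lam]_v f (v, z)) =
    \int[lam]_z (F u * ((u < z)%R%:R * g z * F z ^+ k) - (u < z)%R%:R * g z * F z ^+ k.+1).
  apply: eq_Rintegral => z _.
  have [uz|zu] := ltP u z; last first.
    rewrite !mul0r mulr0 subr0 /f /=.
    under eq_Rintegral => v _.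
      rewrite (_ : _ * _ = 0); first over.
      have [uv|] := ltP u v; last by rewrite !mul0r.
      by rewrite (ltNge v z) (le_trans zu (ltW uv)) /= !mul0r mulr0.
    by rewrite Rintegral_cst// mul0r.
  rewrite /f /= !mul1r.
  under eq_Rintegral => v _.
    rewrite (_ : _ * _ = (u < v)%R%:R * (v < z)%R%:R * g v * (g z * F z ^+ k)); last by ring.
    over.
  rewrite RintegralZr//; last first.
    by apply: bmf_integrable => //; apply: bmfM => //; apply: bmfM; [exact: (blt1 u)|exact: (blt2 z)].
  by rewrite tail_split// exprS; ring.
have bF n : bmfR (fun z => (u < z)%R%:R * g z * F z ^+ n).
  apply: bmfM; first exact: (bmfM (blt1 _) bg).
  by apply: bmfX; exact: bmf_tail_integral.
rewrite RintegralB//; last 2 first.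
- by apply: bmf_integrable => //; apply: bmfM; [exact: bmf_cst|exact: bF].
- exact: (bmf_integrable _ _ (bF _)).
rewrite RintegralZl//; last exact: (bmf_integrable _ _ (bF _)).
by rewrite mulrBr mulrCA -IH -exprS.
Qed.

End pathwise.

Section moment.
Context {dO : measure_display} {Omega : measurableType dO}.
Variable P : probability Omega R.
Variable g : measurableTypeR R * Omega -> R.
Hypothesis bg : bounded_measurable g.

Let F u w := tail_integral (fun v => g (v, w)) u.

Lemma bmf_tail_integral2 :
  @bounded_measurable _ (measurableTypeR R * Omega)%type R (fun p => F p.1 p.2).
Proof.
pose f (p : (measurableTypeR R * Omega) * measurableTypeR R) : R :=
  (p.1.1 < p.2)%R%:R * g (p.2, p.1.2).
have bf : bounded_measurable f.
  apply: bmfM.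
    by apply: (bmf_lt (f := fun p => p.1.1) (g := snd)) => //; exact: measurableT_comp.
  apply: (bmf_comp (h := fun p => (p.2, p.1.2)) _ bg).
  by apply/measurable_fun_pair => //; exact: measurableT_comp.
exact: (bmf_Rintegral2 bf lam).
Qed.

Variables (f : R -> R) (s B D : R) (n : nat).
Hypothesis f_ge0 : forall tau, 0 <= f tau.
Hypothesis mf : @measurable_fun _ _ (measurableTypeR R) (measurableTypeR R) setT f.
Hypothesis B_ge0 : 0 <= B.
Hypothesis D_ge0 : 0 <= D.
Hypothesis fB : forall u, s <= u ->
  (\int[lam]_v ((u < v)%R%:R * f (v - u))%:E <= B%:E)%E.
Hypothesis gD : forall u : nat -> R, u 0%N = s ->
  (forall i, (i < n)%N -> u i < u i.+1) ->
  `|\int[P]_w (\prod_(i < n) g (u i.+1, w))| <= D * \prod_(i < n) f (u i.+1 - u i).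

(** An intermediate state of the expansion: [j] times are fixed in increasing order, the other [k]
    are still inside a power of the tail integral. [tail_integralX] releases the smallest of them
    with the current exponent as factor, and integrating [f] over it costs [B]. The bound [gD]
    enters once all [n] times are fixed. *)
Let Q k j u : (j + k = n)%N -> u 0%N = s -> (forall i, (i < j)%N -> u i < u i.+1) ->
  `|\int[P]_w (\prod_(i < j) g (u i.+1, w) * F (u j) w ^+ k)| <=
  k`!%:R * B ^+ k * (D * \prod_(i < j) f (u i.+1 - u i)).
Proof.
elim: k j u => [|k IH] j u.
  rewrite addn0 => -> u0 uS; rewrite mul1r expr0 mul1r.
  under eq_Rintegral do rewrite expr0 mulr1.
  exact: gD.
move=> jkn u0 uS.
have bprod : bounded_measurable (fun w => \prod_(i < j) g (u i.+1, w)).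
  by apply: bmf_prod => i; exact: bmf_pair1.
pose G (p : Omega * measurableTypeR R) : R := \prod_(i < j) g (u i.+1, p.1) *
  ((u j < p.2)%R%:R * g (p.2, p.1) * F p.2 p.1 ^+ k).
have mswap : measurable_fun setT (fun p : Omega * measurableTypeR R => (p.2, p.1)).
  by apply/measurable_fun_pair.
have bG : bounded_measurable G.
  apply: bmfM; first exact: (bmf_comp measurable_fst bprod).
  apply: bmfM; last by apply: bmfX; exact: (bmf_comp mswap bmf_tail_integral2).
  apply: bmfM; last exact: (bmf_comp mswap bg).
  exact: (@bmf_lt _ _ _ (fun=> u j) snd (measurable_cst (u j)) measurable_snd).
have -> : \int[P]_w (\prod_(i < j) g (u i.+1, w) * F (u j) w ^+ k.+1) =
    k.+1%:R * \int[P]_w (\int[lam]_v G (w, v)).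
  rewrite -RintegralZl//; last first.
    by apply: bmf_integrable => //; exact: (bmf_Rintegral2 bG lam).
  apply: eq_Rintegral => w _.
  have bgw : bounded_measurable (fun v => g (v, w)) by exact: bmf_pair2.
  rewrite /F tail_integralX// /G /= RintegralZl//; first by rewrite mulrCA.
  apply: bmf_integrable => //; apply: bmfM.
    apply: bmfM => //.
    exact: (@bmf_lt _ (measurableTypeR R) _ (fun=> u j) id (measurable_cst (u j)) (@measurable_id _ _ _)).
  by apply: bmfX; exact: bmf_tail_integral.
rewrite (Rintegral_fubini P lam bG) normrM normr_nat factS natrM exprS.
rewrite -!mulrA ler_wpM2l//.
set C := (X in _ <= X).
pose c := k`!%:R * B ^+ k * (D * \prod_(i < j) f (u i.+1 - u i)).
have bound v : `|\int[P]_w G (w, v)| <= c * ((u j < v)%R%:R * f (v - u j)).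
  have [ujv|vuj] := ltP (u j) v; last first.
    rewrite mul0r mulr0 /G /=.
    under eq_Rintegral do rewrite (ltNge _ v) vuj /= !mul0r mulr0.
    by rewrite Rintegral_cst// mul0r normr0.
  pose u' i := if (i <= j)%N then u i else v.
  have u'E i : (i <= j)%N -> u' i = u i by rewrite /u' => ->.
  have u'S : u' j.+1 = v by rewrite /u' ltnn.
  have := IH j.+1 u' _ _ _; rewrite addSnnS => /(_ jkn); rewrite u'E// => /(_ u0).
  rewrite u'S; rewrite !big_ord_recr/= u'S u'E// => h.
  rewrite mul1r.
  have -> : \int[P]_w G (w, v) =
     \int[P]_w (\prod_(i < j.+1) g (u' i.+1, w) * F v w ^+ k).
    apply: eq_Rintegral => w _; rewrite /G /= big_ord_recr /= u'S ujv mul1r -!mulrA.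
    by congr (_ * _); apply: eq_bigr => i _; rewrite u'E// ltnW// ltnS.
  apply: (le_trans (h _)).
    move=> i; rewrite ltnS leq_eqVlt => /predU1P[->|ij]; first by rewrite u'E// u'S.
    by rewrite !u'E ?(ltnW ij)//; exact: uS.
  rewrite /c -!mulrA le_eqVlt; apply/orP; left; apply/eqP.
  congr (_ * (_ * (_ * (_ * _)))); apply: eq_bigr => i _.
  by rewrite !u'E// ltnW.
have suj : s <= u j.
  rewrite -u0; elim: (j) uS => [//|m IHm] uS.
  by rewrite (le_trans (IHm _)) ?ltW ?uS// => i im; apply: uS; rewrite ltnS ltnW.
have fin : lam.-integrable setT (fun v => ((u j < v)%R%:R * f (v - u j))%:E).
  apply/integrableP; split.
    apply/measurable_EFinP; apply: measurable_funM.
      by have [] := (@bmf_lt _ (measurableTypeR R) R (fun=> u j) id (measurable_cst (u j)) (@measurable_id _ _ _)).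
    by apply: (measurableT_comp mf); exact: measurable_funB.
  apply: (@le_lt_trans _ _ B%:E); last exact: ltry.
  apply: le_trans (fB suj).
  by rewrite le_eqVlt; apply/orP; left; apply/eqP; apply: eq_integral => v _;
     rewrite gee0_abs// lee_fin mulr_ge0.
have bG1 := bmf_Rintegral1 bG P.
rewrite (le_trans (le_normr_Rintegral _ (bmf_integrable _ _ bG1)))//.
apply: (@le_trans _ _ (c * (\int[lam]_v ((u j < v)%R%:R * f (v - u j))))).
  rewrite -RintegralZl//; apply: le_Rintegral => //.
  - by apply: bmf_integrable => //; exact: bmf_norm.
  - by apply: (eq_integrable measurableT _ _ _ (integrableZl measurableT c fin)) => // v _; rewrite EFinM.
rewrite /C [leRHS](_ : _ = c * B); last by rewrite /c; ring.
apply: ler_wpM2l.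
  by rewrite /c !mulr_ge0 ?exprn_ge0// prodr_ge0.
by rewrite -lee_fin /Rintegral fineK ?fB//; exact: integrable_fin_num.
Qed.

Lemma moment_tail_integral :
  `|\int[P]_w (F s w ^+ n)| <= n`!%:R * B ^+ n * D.
Proof.
have := @Q n 0%N (fun=> s) (add0n n) erefl.
rewrite big_ord0 mulr1; under eq_Rintegral do rewrite big_ord0 mul1r.
exact.
Qed.

End moment.
End ordered_moment.

(** * Dyadic sums and the power kernel *)

Section dyadic.
Context {R : realType}.
Implicit Types a x y : R.

Lemma half_gt0 : (0 : R) < 2^-1. Proof. by rewrite invr_gt0. Qed.

Lemma exprn_half_lt y : 0 < y -> exists q : nat, 2^-1 ^+ q < y.
Proof.
move=> y0; have : geometric 1 (2^-1 : R) @ \oo --> (0 : R).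
  by apply: cvg_geometric; rewrite ger0_norm ?invr_ge0// invf_lt1 ?ltr1n.
move=> /cvgrPdist_lt/(_ _ y0)[N _ /(_ N (leqnn N))] /=.
rewrite mul1r sub0r normrN ger0_norm ?exprn_ge0 ?invr_ge0// => h.
by exists N.
Qed.

Lemma dyadic_bracket x : 0 < x -> x <= 1 ->
  exists q : nat, 2^-1 ^+ q.+1 < x <= 2^-1 ^+ q.
Proof.
move=> x0 x1; have [q0 hq0] := exprn_half_lt x0.
have [q hq qmin] := ex_minnP (ex_intro (fun q => 2^-1 ^+ q < x) q0 hq0).
case: q hq qmin => [|q hq qmin]; first by rewrite expr0 ltNge x1.
by exists q; rewrite hq /= leNgt; apply/negP => /qmin; rewrite ltnn.
Qed.

Lemma powR_exprn_half a (q : nat) : 0 < a -> (2^-1 ^+ q) `^ (- a) = (2 `^ a) ^+ q :> R.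
Proof.
move=> a0; have -> : 2^-1 ^+ q = (2 : R) `^ (- q%:R).
  by rewrite powRN powR_mulrn// exprVn.
by rewrite -powRrM mulrNN mulrC powRrM powR_mulrn// powR_ge0.
Qed.

Lemma term_le_nneseries (u : nat -> \bar R) q : (forall k, 0 <= u k)%E ->
  (u q <= \sum_(k <oo) u k)%E.
Proof.
move=> u0; rewrite (@nneseriesD1 _ u q)//.
by rewrite leeDl//; apply: nneseries_ge0.
Qed.

(** For x in ]2^(-q-1), 2^(-q)] the term of index [q] alone dominates x^(- a); the 1 takes care of x
    > 1. *)
Lemma dyadic_powRN a x : 0 < a -> 0 < x ->
  ((x `^ (- a))%:E <= 1 + \sum_(q <oo) ((2 `^ a) ^+ q.+1 * (x <= 2^-1 ^+ q)%R%:R)%:E)%E.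
Proof.
move=> a0 x0.
have t0 (q : nat) : (0 <= ((2 `^ a) ^+ q.+1 * (x <= 2^-1 ^+ q)%R%:R)%:E)%E.
  by rewrite lee_fin mulr_ge0// exprn_ge0// powR_ge0.
have [x1|x1] := leP x 1; last first.
  apply: (@le_trans _ _ 1%E); last by rewrite leeDl// nneseries_ge0.
  rewrite lee_fin powRN invf_le1 ?(powR_gt0 _ x0)//.
  by rewrite -(powRr0 x) ler_powR ?ltW.
have [q /andP[qx xq]] := dyadic_bracket x0 x1.
apply: (@le_trans _ _ (\sum_(q <oo) ((2 `^ a) ^+ q.+1 * (x <= 2^-1 ^+ q)%R%:R)%:E)%E); last by rewrite leeDr.
apply: (@le_trans _ _ ((2 `^ a) ^+ q.+1)%:E); last first.
  by have := term_le_nneseries q t0; rewrite xq mulr1.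
rewrite lee_fin -powR_exprn_half// !powRN lef_pV2 ?posrE ?powR_gt0// ?exprn_gt0 ?half_gt0//.
by rewrite ge0_ler_powR// ?nnegrE ?ltW// exprn_gt0 ?half_gt0.
Qed.

Lemma nneseries_geometric (c z : R) : 0 <= c -> 0 <= z -> z < 1 ->
  (\sum_(q <oo) (c * z ^+ q)%:E = (c / (1 - z))%:E)%E.
Proof.
move=> c0 z0 z1; have zn1 : `|z| < 1 by rewrite ger0_norm.
have := cvg_geometric_series (a := c) zn1 => /cvg_lim <-//.
rewrite -EFin_lim; last by apply/cvg_ex; eexists; exact: cvg_geometric_series.
apply: congr_lim; apply/funext => n /=.
by rewrite /series /= -sumEFin.
Qed.

End dyadic.

Section power_kernel.
Context {R : realType}.
Implicit Types a lambda tau u : R.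

(** The exponential does not come from the characteristic function: it is inserted so that times may
    range over a half-line, at a price that telescopes over the increments. *)
Definition power_kernel a lambda tau :=
  (1 + (lambda * tau) `^ (- a)) * expR (- (lambda * tau)).

(** The two geometric series obtained by integrating [step]: ratio 1 / e for the unit cells, ratio
    2^(a - 1) for the dyadic ones. *)
Definition power_kernel_cst a : R :=
  2 / (1 - expR (- 1)) + 2 `^ a / (1 - 2 `^ a / 2).

Lemma power_kernel_ge0 a lambda tau : 0 <= power_kernel a lambda tau.
Proof. by rewrite mulr_ge0 ?expR_ge0// addr_ge0// powR_ge0. Qed.

Lemma measurable_power_kernel a lambda :
  @measurable_fun _ _ (measurableTypeR R) (measurableTypeR R) setT (power_kernel a lambda).
Proof.
have ml : @measurable_fun _ _ (measurableTypeR R) (measurableTypeR R) setT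
    (fun tau => lambda * tau) by exact: measurable_funM.
apply: measurable_funM.
  apply: measurable_funD => //.
  exact: (measurableT_comp (measurable_powR (- a)) ml).
by apply: measurableT_comp => //; exact: measurableT_comp.
Qed.

Lemma powR2_lt2 a : 0 < a < 1 -> (2 : R) `^ a < 2.
Proof.
move=> /andP[a0 a1]; rewrite -[ltRHS]powRr1// /powR pnatr_eq0/=.
by rewrite ltr_expR ltr_pM2r// ln_gt0// ltr1n.
Qed.

Lemma expRN1_lt1 : expR (- 1) < 1 :> R.
Proof. by rewrite expR_lt1 oppr_lt0. Qed.

Lemma power_kernel_cst_gt0 a : 0 < a < 1 -> 0 < power_kernel_cst a.
Proof.
move=> a01; have := powR2_lt2 a01 => h2; have h1 := expRN1_lt1.
by rewrite addr_gt0// divr_gt0 ?powR_gt0// subr_gt0// ltr_pdivrMr// mul1r.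
Qed.

Let step a lambda u (q : nat) (v : R) : R :=
  2 * expR (- 1) ^+ q * \1_(`[u + q%:R / lambda, u + q.+1%:R / lambda[%classic) v
  + (2 `^ a) ^+ q.+1 * \1_(`]u, u + 2^-1 ^+ q / lambda]%classic) v.

(** With x = lambda (v - u), the kernel is 2 e^(-x) + (x^(-a) - 1) e^(-x). The first part is at most
    2 e^(-q) when q <= x < q + 1. The second is nonpositive for x > 1 and otherwise at most x^(-a) -
    1, where the -1 cancels the constant of [dyadic_powRN]. *)
Let power_kernel_le_step a lambda u v : 0 < a < 1 -> 0 < lambda -> u < v ->
  ((power_kernel a lambda (v - u))%:E <= \sum_(q <oo) (step a lambda u q v)%:E)%E.
Proof.
move=> /andP[a0 a1] l0 uv; set x := lambda * (v - u).
have x0 : 0 < x by rewrite mulr_gt0// subr_gt0.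
have e0 : 0 <= expR (- x) by exact: expR_ge0.
under eq_eseriesr => q _ do rewrite EFinD.
rewrite nneseriesD//.
have -> : power_kernel a lambda (v - u) = expR (- x) + x `^ (- a) * expR (- x).
  by rewrite /power_kernel -/x mulrDl mul1r.
have E : expR (- x) <= 2 * expR (- x) - expR (- x) by lra.
apply: (@le_trans _ _ ((2 * expR (- x))%:E +
   (x `^ (- a) * expR (- x) - expR (- x))%:E)%E).
  by rewrite -EFinD lee_fin; lra.
apply: leeD.
  pose q := Num.truncn x.
  have /andP[qx xq] : q%:R <= x < q.+1%:R by apply: truncn_itv; rewrite ltW.
  pose t k : \bar R := (2 * expR (- 1) ^+ k * \1_(`[u + k%:R / lambda, u + k.+1%:R / lambda[%classic) v)%:E.
  have t0 k : (0 <= t k)%E by rewrite lee_fin !mulr_ge0// exprn_ge0// expR_ge0.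
  apply: (le_trans _ (term_le_nneseries q t0)); rewrite /t.
  rewrite lee_fin indicE mem_set ?mulr1; last first.
    rewrite /= in_itv/= -lerBrDl -ltrBlDl ler_pdivrMr// ltr_pdivlMr//.
    by rewrite !(mulrC (v - u)) -/x qx.
  by rewrite ler_pM2l// -expRM_natl ler_expR mulrN1 lerN2.
have [x1|x1] := leP x 1; last first.
  apply: (@le_trans _ _ 0%E).
    rewrite lee_fin subr_le0 ler_piMl//.
    by rewrite powRN invf_le1 ?(powR_gt0 _ x0)// -(powRr0 x) ler_powR// ltW.
  by apply: nneseries_ge0 => q _ _; rewrite lee_fin mulr_ge0// exprn_ge0// powR_ge0.
have xa1 : 1 <= x `^ (- a).
  by rewrite powRN invf_ge1 ?(powR_gt0 _ x0)// -[leRHS](powRr0 x) ger_powR ?x0// ltW.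
apply: (@le_trans _ _ (x `^ (- a) - 1)%:E).
  rewrite lee_fin -[X in _ - X]mul1r -mulrBl ler_piMr ?subr_ge0//.
  by rewrite -[leRHS]expR0 ler_expR oppr_le0 ltW.
rewrite EFinB leeBlDl//; apply: (le_trans (dyadic_powRN a0 x0)).
apply: leeD2l; apply: lee_nneseries => [q _|q _].
  by rewrite lee_fin mulr_ge0// exprn_ge0// powR_ge0.
rewrite lee_fin ler_wpM2l ?exprn_ge0 ?powR_ge0// indicE.
have [xq|_] := leP x (2^-1 ^+ q) => //; rewrite mem_set//= in_itv/= uv/=.
by rewrite -lerBlDl ler_pdivlMr// mulrC.
Qed.

(** The dyadic cell of index [q] contributes 2^(a (q + 1)) 2^(-q) / lambda, summable because a <
    1. *)
Lemma power_kernel_integral (lam : {measure set (measurableTypeR R) -> \bar R}) a lambda u :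
  (forall A, measurable A -> (lam A <= lebesgue_measure A)%E) ->
  0 < a < 1 -> 0 < lambda ->
  (\int[lam]_v ((u < v)%R%:R * power_kernel a lambda (v - u))%:E
    <= (power_kernel_cst a / lambda)%:E)%E.
Proof.
move=> lamle a01 l0; have /andP[a0 a1] := a01.
have step0 q v : (0 <= (step a lambda u q v)%:E)%E.
  by rewrite lee_fin addr_ge0// mulr_ge0// ?mulr_ge0 ?exprn_ge0 ?powR_ge0 ?expR_ge0.
have mstep q : @measurable_fun _ _ (measurableTypeR R) _ setT (EFin \o step a lambda u q).
  apply/measurable_EFinP; apply: measurable_funD.
    by apply: measurable_funM => //; exact: measurable_indic.
  by apply: measurable_funM => //; exact: measurable_indic.
apply: (@le_trans _ _ (\int[lam]_v (\sum_(q <oo) (step a lambda u q v)%:E))%E).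
  apply: ge0_le_integral => //.
  - by move=> v _; rewrite lee_fin mulr_ge0// power_kernel_ge0.
  - apply/measurable_EFinP; apply: measurable_funM.
      by have [] := (@bmf_lt _ (measurableTypeR R) R (fun=> u) id (measurable_cst u) (@measurable_id _ _ _)).
    apply: (measurableT_comp (measurable_power_kernel a lambda)).
    exact: measurable_funB.
  - by apply: ge0_emeasurable_sum => // q _; exact: (mstep q).
  move=> v _; have [uv|vu] := ltP u v; last first.
    by rewrite mul0r; apply: nneseries_ge0.
  by rewrite mul1r; exact: power_kernel_le_step.
rewrite integral_nneseries//.
apply: (@le_trans _ _ (\sum_(q <oo) ((2 / lambda * expR (- 1) ^+ q)%:E +
   (2 `^ a / lambda * (2 `^ a / 2) ^+ q)%:E))%E); last first.
  rewrite nneseriesD//; last 2 first.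
  - by move=> q _ _; rewrite lee_fin mulr_ge0 ?exprn_ge0 ?expR_ge0// divr_ge0 ?ltW.
  - by move=> q _ _; rewrite lee_fin mulr_ge0 ?exprn_ge0 ?divr_ge0 ?powR_ge0// ltW.
  have l0' : 0 <= lambda by exact: ltW.
  have z1 : 2 `^ a / 2 < 1 :> R by rewrite ltr_pdivrMr// mul1r powR2_lt2.
  rewrite !nneseries_geometric ?divr_ge0 ?expR_ge0 ?powR_ge0 ?expRN1_lt1//.
  by rewrite -EFinD lee_fin /power_kernel_cst [leRHS]mulrDl lerD// mulrAC.
apply: lee_nneseries => [q _ _|q _].
  by apply: integral_ge0 => v _; exact: step0.
under eq_integral do rewrite EFinD.
rewrite ge0_integralD//; last 2 first.
- by apply/measurable_EFinP; apply: measurable_funM => //; exact: measurable_indic.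
- by apply/measurable_EFinP; apply: measurable_funM => //; exact: measurable_indic.
have Iindic c (I : interval R) w : 0 <= c -> (lebesgue_measure [set` I] <= w%:E)%E ->
   (\int[lam]_v (c * \1_[set` I] v)%:E <= (c * w)%:E)%E.
  move=> c0 Iw; under eq_integral do rewrite EFinM.
  rewrite ge0_integralZl_EFin//; last first.
    by apply/measurable_EFinP; exact: measurable_indic.
  rewrite integral_indic// setIT EFinM lee_wpmul2l ?lee_fin//.
  by apply: le_trans Iw; exact: lamle.
apply: leeD.
  apply: le_trans (Iindic _ _ lambda^-1 _ _) _.
  - by rewrite mulr_ge0// exprn_ge0// expR_ge0.
  - rewrite lebesgue_measure_itv/=; case: ifP => _; last by rewrite lee_fin invr_ge0 ltW.
    rewrite -EFinB lee_fin -natr1; lra.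
  - by rewrite lee_fin mulrAC.
apply: le_trans (Iindic _ _ (2^-1 ^+ q / lambda) _ _) _.
- by rewrite exprn_ge0// powR_ge0.
- rewrite lebesgue_measure_itv/=; case: ifP => _; last first.
    by rewrite lee_fin divr_ge0 ?exprn_ge0// ltW.
  by rewrite -EFinB lee_fin; lra.
- by rewrite lee_fin exprS exprMn; lra.
Qed.

End power_kernel.

(** * The n-th moment over one time interval *)

Section interval_measure.
Context {R : realType}.

Let interval_finite (s t : R) : (@lebesgue_measure R `[s, t]%classic < +oo)%E.
Proof. by rewrite lebesgue_measure_itv/=; case: ifP => _; rewrite ?ltry// -EFinB ltry. Qed.

Definition interval_measure (s t : R) : {finite_measure set (measurableTypeR R) -> \bar R} :=
  @mfrestr _ (measurableTypeR R) R `[s, t]%classic lebesgue_measure (measurable_itv `[s, t]) (interval_finite s t).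

Lemma interval_measureE (s t : R) A :
  interval_measure s t A = lebesgue_measure (A `&` `[s, t]%classic).
Proof. by []. Qed.

Lemma interval_measure_le (s t : R) A : measurable A ->
  (interval_measure s t A <= lebesgue_measure A)%E.
Proof. by move=> mA; rewrite interval_measureE le_measure ?inE//; exact: measurableI. Qed.

Lemma interval_measure_set1 (s t x : R) : interval_measure s t [set x] = 0%E.
Proof.
apply/eqP; rewrite eq_le measure_ge0 andbT -(lebesgue_measure_set1 x).
exact: interval_measure_le.
Qed.

Lemma interval_measureT (s t : R) : s <= t -> fine (interval_measure s t setT) = t - s.
Proof.
move=> st; rewrite interval_measureE setTI lebesgue_measure_itv/= lte_fin.
by case: ltP => //= ts; apply/eqP; rewrite eq_sym subr_eq0 eq_le ts st.
Qed.

Lemma interval_measure_setC (s t : R) : interval_measure s t (~` `[s, t]) = 0%E.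
Proof. by rewrite interval_measureE setICl measure0. Qed.

Lemma eq_interval_Rintegral (s t : R) (f g : R -> R) :
  @bounded_measurable _ (measurableTypeR R) R f -> @bounded_measurable _ (measurableTypeR R) R g ->
  (forall v, s < v < t -> f v = g v) ->
  \int[interval_measure s t]_v f v = \int[interval_measure s t]_v g v.
Proof.
move=> bf bg fg; rewrite /Rintegral; congr fine.
pose N : set (measurableTypeR R) := ~` `[s, t] `|` ([set s] `|` [set t]).
have mN : measurable N.
  by apply: measurableU; [apply: measurableC; exact: measurable_itv|exact: measurableU].
have N0 : interval_measure s t N = 0%E.
  apply/eqP; rewrite eq_le measure_ge0 andbT.
  apply: le_trans (measureU2 _ _ _) _ => //.
  - by apply: measurableC; exact: measurable_itv.
  - exact: measurableU.
  rewrite [X in (X + _)%E]interval_measure_setC add0e.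
  apply: le_trans (measureU2 _ _ _) _ => //.
  by rewrite [X in (X + _)%E](interval_measure_set1 s t s) [X in (_ + X)%E](interval_measure_set1 s t t) add0e.
rewrite (@negligible_integral _ _ _ _ setT N (EFin \o f))//; last exact: bmf_integrable.
rewrite (@negligible_integral _ _ _ _ setT N (EFin \o g))//; last exact: bmf_integrable.
apply: eq_integral => v; rewrite inE => -[_ Nv] /=; congr EFin; apply: fg.
move: Nv => /not_orP[/contrapT/= + /not_orP[/eqP vs /eqP vt]].
by rewrite in_itv/= !lt_neqAle vt (eq_sym s) vs.
Qed.

Context {dO : measure_display} {Omega : measurableType dO}.
Variable P : probability Omega R.

Lemma interval_moment_bound (a s t h K D : R) (n : nat)
    (g : measurableTypeR R * Omega -> R) :
  0 < a < 1 -> t - s <= h -> 0 < h -> (0 < n)%N -> 0 <= K -> 0 <= D ->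
  bounded_measurable g ->
  (forall u : nat -> R, u 0%N = s -> (forall i, (i < n)%N -> u i < u i.+1) -> u n < t ->
     `|\int[P]_w (\prod_(i < n) g (u i.+1, w))| <=
     D * \prod_(i < n) (K * (1 + (n%:R / h * (u i.+1 - u i)) `^ (- a)))) ->
  `|\int[P]_w ((\int[interval_measure s t]_v g (v, w)) ^+ n)| <=
  D * (expR 1 * power_kernel_cst a * K * h) ^+ n.
Proof.
move=> a01 tsh h0 n0 K0 D0 bg gD.
pose lambda := n%:R / h; have l0 : 0 < lambda by rewrite divr_gt0// ltr0n.
pose lam := interval_measure s t.
(* With this cut the product vanishes as soon as the last time reaches [t], so [gD] is called only
   for ordered times below [t]. *)
pose g' (p : measurableTypeR R * Omega) := (p.1 < t)%R%:R * g p.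
have bg' : bounded_measurable g'.
  apply: bmfM => //.
  exact: (@bmf_lt _ _ _ fst (fun=> t) measurable_fst (measurable_cst t)).
have bind (u : R) : @bounded_measurable _ (measurableTypeR R) R (fun v => (u < v)%R%:R).
  exact: (@bmf_lt _ (measurableTypeR R) R (fun=> u) id (measurable_cst u) (@measurable_id _ _ _)).
have -> : \int[P]_w ((\int[lam]_v g (v, w)) ^+ n) =
    \int[P]_w ((tail_integral lam (fun v => g' (v, w)) s) ^+ n).
  apply: eq_Rintegral => w _; congr (_ ^+ n); apply: eq_interval_Rintegral.
  - exact: bmf_pair2.
  - by apply: bmfM; [exact: bind|exact: (bmf_pair2 bg')].
  by move=> v /andP[sv vt]; rewrite /g' /= sv vt !mul1r.
pose f tau := K * power_kernel a lambda tau.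
have cst0 := ltW (power_kernel_cst_gt0 a01).
(* [expR 1 ^+ n] pays for the exponentials of [power_kernel]. The powers of [lambda = n / h] leave
   the ratio of n! to n^n, bounded by 1 at the very end. *)
have := @moment_tail_integral _ lam (@interval_measure_set1 s t) _ _ P g' bg'
  f s (K * power_kernel_cst a / lambda) (D * expR 1 ^+ n) n.
have -> : n`!%:R * (K * power_kernel_cst a / lambda) ^+ n * (D * expR 1 ^+ n) =
    n`!%:R / n%:R ^+ n * (D * (expR 1 * power_kernel_cst a * K * h) ^+ n).
  rewrite /lambda !exprMn !exprVn !exprMn exprVn invfM invrK; ring.
move=> main; apply: le_trans (main _ _ _ _ _ _) _.
- by move=> tau; rewrite mulr_ge0// power_kernel_ge0.
- by apply: measurable_funM => //; exact: measurable_power_kernel.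
- by apply: divr_ge0; [exact: mulr_ge0|exact: ltW].
- by rewrite mulr_ge0// exprn_ge0// expR_ge0.
- move=> u su; rewrite /f.
  under eq_integral do rewrite mulrCA EFinM.
  rewrite ge0_integralZl_EFin//; last 2 first.
  + by move=> v _; rewrite lee_fin mulr_ge0// power_kernel_ge0.
  + apply/measurable_EFinP; apply: measurable_funM; first by have [] := bind u.
    apply: (measurableT_comp (measurable_power_kernel a lambda)).
    exact: measurable_funB.
  rewrite -mulrA EFinM lee_wpmul2l ?lee_fin// power_kernel_integral//.
  exact: interval_measure_le.
- move=> u u0 uS.
  have us i : (i <= n)%N -> s <= u i.
    elim: i => [|i IH] ilen; first by rewrite u0.
    by rewrite (le_trans (IH (ltnW ilen)))// ltW// uS.
  have [unt|tun] := ltP (u n) t; last first.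
    have -> : \int[P]_w (\prod_(i < n) g' (u i.+1, w)) = 0.
      under eq_Rintegral => w _.
        rewrite (_ : \prod_(i < n) _ = 0); first over.
        case: n n0 tun {uS us gD main lambda l0 f} => // m _ tun.
        by rewrite big_ord_recr/= /g' /= ltNge tun /= mul0r mulr0.
      by rewrite Rintegral_cst// mul0r.
    rewrite normr0 !mulr_ge0 ?exprn_ge0 ?expR_ge0// prodr_ge0// => i _.
    by rewrite mulr_ge0// power_kernel_ge0.
  have uit i : (i <= n)%N -> u i < t.
    move=> ilen; apply: le_lt_trans unt; rewrite -(subnKC ilen).
    have : (n - i + i <= n)%N by rewrite subnK.
    elim: (n - i)%N => [|k IH] h1; first by rewrite addn0.
    rewrite (le_trans (IH _)) ?addnS ?ltW ?uS//.
      by rewrite (leq_trans _ h1)// addSn.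
    by rewrite addnC (leq_trans _ h1)// addSn.
  have -> : \int[P]_w (\prod_(i < n) g' (u i.+1, w)) =
            \int[P]_w (\prod_(i < n) g (u i.+1, w)).
    by apply: eq_Rintegral => w _; apply: eq_bigr => i _; rewrite /g' /= uit ?mul1r.
  apply: (le_trans (gD u u0 uS unt)); rewrite -mulrA ler_wpM2l//.
  rewrite /f /power_kernel.
  (* The exponentials telescope to a single one, which is at least e^(- n) because
     [u n - s <= h]. *)
  have -> : \prod_(i < n) (K * ((1 + (lambda * (u i.+1 - u i)) `^ (- a)) * expR (- (lambda * (u i.+1 - u i))))) =
      \prod_(i < n) (K * (1 + (lambda * (u i.+1 - u i)) `^ (- a))) * expR (- (lambda * (u n - s))).
    rewrite -u0; elim: (n) => [|m IH]; first by rewrite !big_ord0 subrr mulr0 oppr0 expR0 mul1r.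
    rewrite !big_ord_recr/= IH -!mulrA; congr (_ * _).
    rewrite mulrC -!mulrA; congr (_ * (_ * _)).
    by rewrite -expRD; congr expR; ring.
  rewrite mulrCA; apply: ler_peMr.
    by apply: prodr_ge0 => i _; rewrite mulr_ge0// addr_ge0// powR_ge0.
  rewrite -expRM_natr mul1r -expRD -[leLHS]expR0 ler_expR subr_ge0.
  rewrite /lambda mulrAC ler_pdivrMr// ler_wpM2l//.
  by rewrite (le_trans _ tsh)// lerB// ltW.
rewrite ler_piMl//.
  by rewrite mulr_ge0// exprn_ge0// !mulr_ge0 ?expR_ge0// ltW.
rewrite ler_pdivrMr ?exprn_gt0 ?ltr0n// mul1r -natrX ler_nat.
by elim: (n) => // m IH; rewrite factS expnS leq_mul// (leq_trans IH)//; case: (m) => // k; rewrite leq_exp2r.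
Qed.

End interval_measure.

(** * Complex expectations and characteristic functions *)

Section complex_expectation.
Context {R : realType} {dO : measure_display} {Omega : measurableType dO}.
Variable P : probability Omega R.
Local Notation normc := Normc.normc.
Implicit Types Z : Omega -> R[i].

Definition cbounded_measurable Z :=
  bounded_measurable (fun w => complex.Re (Z w)) /\
  bounded_measurable (fun w => complex.Im (Z w)).

Lemma cexpectationE Z : cexpectation P Z =
  Complex (\int[P]_w complex.Re (Z w)) (\int[P]_w complex.Im (Z w)).
Proof. by rewrite /cexpectation !unlock. Qed.

Lemma cexpectation0 : cexpectation P (fun _ => 0) = 0.
Proof. by rewrite cexpectationE /= !Rintegral_cst// !mul0r. Qed.

Lemma cbmfD Z1 Z2 : cbounded_measurable Z1 -> cbounded_measurable Z2 ->
  cbounded_measurable (fun w => Z1 w + Z2 w).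
Proof.
move=> [r1 i1] [r2 i2]; split.
  rewrite (_ : (fun _ => _) = (fun w => complex.Re (Z1 w) + complex.Re (Z2 w))).
    exact: bmfD.
  by apply/funext => w; case: (Z1 w) (Z2 w) => ? ? [].
rewrite (_ : (fun _ => _) = (fun w => complex.Im (Z1 w) + complex.Im (Z2 w))).
  exact: bmfD.
by apply/funext => w; case: (Z1 w) (Z2 w) => ? ? [].
Qed.

Lemma cbmfM Z1 Z2 : cbounded_measurable Z1 -> cbounded_measurable Z2 ->
  cbounded_measurable (fun w => Z1 w * Z2 w).
Proof.
move=> [r1 i1] [r2 i2]; split.
  rewrite (_ : (fun _ => _) = (fun w => complex.Re (Z1 w) * complex.Re (Z2 w) -
     complex.Im (Z1 w) * complex.Im (Z2 w))).
    by apply: bmfB; exact: bmfM.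
  by apply/funext => w; case: (Z1 w) (Z2 w) => ? ? [].
rewrite (_ : (fun _ => _) = (fun w => complex.Re (Z1 w) * complex.Im (Z2 w) +
     complex.Im (Z1 w) * complex.Re (Z2 w))).
  by apply: bmfD; exact: bmfM.
by apply/funext => w; case: (Z1 w) (Z2 w) => ? ? [].
Qed.

Lemma cbmf_real (f : Omega -> R) : bounded_measurable f ->
  cbounded_measurable (fun w => (f w)%:C%C).
Proof. by move=> bf; split=> //=; exact: bmf_cst. Qed.

Lemma cbmf_cst (c : R[i]) : cbounded_measurable (fun _ => c).
Proof. by split; exact: bmf_cst. Qed.

Lemma cbmf_expi (f : Omega -> R) : measurable_fun setT f ->
  cbounded_measurable (fun w => expi (f w)).
Proof.
move=> mf; split => /=; split.
- by apply: measurableT_comp mf => //; apply: continuous_measurable_fun; exact: continuous_cos.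
- exists 1 => w; exact: cos_max.
- by apply: measurableT_comp mf => //; apply: continuous_measurable_fun; exact: continuous_sin.
- exists 1 => w; exact: sin_max.
Qed.

Lemma cbmf_sum (I : Type) (s : seq I) (Z : I -> Omega -> R[i]) :
  (forall i, cbounded_measurable (Z i)) ->
  cbounded_measurable (fun w => \sum_(i <- s) Z i w).
Proof.
move=> hZ; elim: s => [|a s IH].
  by under eq_fun do rewrite big_nil; exact: cbmf_cst.
by under eq_fun do rewrite big_cons; exact: cbmfD.
Qed.

Lemma cexpectationD Z1 Z2 : cbounded_measurable Z1 -> cbounded_measurable Z2 ->
  cexpectation P (fun w => Z1 w + Z2 w) = cexpectation P Z1 + cexpectation P Z2.
Proof.
move=> [r1 i1] [r2 i2]; rewrite !cexpectationE; apply/eqP; rewrite eq_complex /=.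
rewrite -!RintegralD; try by [|exact: bmf_integrable].
by apply/andP; split; apply/eqP; apply: eq_Rintegral => w _; case: (Z1 w) (Z2 w) => ? ? [].
Qed.

Lemma cexpectationZ (b : R[i]) Z : cbounded_measurable Z ->
  cexpectation P (fun w => b * Z w) = b * cexpectation P Z.
Proof.
move=> [r1 i1]; rewrite !cexpectationE; case: b => br bi; apply/eqP; rewrite eq_complex /=.
have bz c (f : Omega -> R) : bounded_measurable f -> P.-integrable setT (EFin \o (fun w => c * f w)).
  by move=> bf; apply: bmf_integrable => //; apply: bmfM => //; exact: bmf_cst.
rewrite -!RintegralZl; try by [|exact: bmf_integrable].
rewrite -RintegralD -?RintegralB; try by [|exact: bz].
by apply/andP; split; apply/eqP; apply: eq_Rintegral => w _; case: (Z w).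
Qed.

Lemma cexpectation_sum (I : Type) (s : seq I) (b : I -> R[i]) (Z : I -> Omega -> R[i]) :
  (forall i, cbounded_measurable (Z i)) ->
  cexpectation P (fun w => \sum_(i <- s) b i * Z i w) =
  \sum_(i <- s) b i * cexpectation P (Z i).
Proof.
move=> hZ; elim: s => [|a s IH].
  by under eq_fun do rewrite big_nil; rewrite big_nil cexpectation0.
under eq_fun do rewrite big_cons.
rewrite big_cons -IH cexpectationD ?cexpectationZ//.
  by apply: cbmfM => //; exact: cbmf_cst.
by apply: cbmf_sum => i; apply: cbmfM => //; exact: cbmf_cst.
Qed.

Lemma normc_sum (I : Type) (s : seq I) (z : I -> R[i]) :
  normc (\sum_(i <- s) z i) <= \sum_(i <- s) normc (z i).
Proof.
elim: s => [|a s IH]; first by rewrite !big_nil Normc.normc0.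
by rewrite !big_cons (le_trans (le_normcD _ _))// lerD2l.
Qed.

Lemma normc_real (x : R) : normc (x%:C)%C = `|x|.
Proof. by rewrite /= expr0n/= addr0 sqrtr_sqr. Qed.

Lemma normc_ge0 (z : R[i]) : 0 <= normc z.
Proof. by case: z => x y /=; rewrite sqrtr_ge0. Qed.

Lemma expiD (x y : R) : expi (x + y) = expi x * expi y.
Proof. by rewrite /expi cosD sinD; apply/eqP; rewrite eq_complex /= eqxx /= addrC. Qed.

Lemma expi0 : expi 0 = 1 :> R[i].
Proof. by rewrite /expi cos0 sin0. Qed.

Lemma normc_expi (x : R) : normc (expi x) = 1.
Proof. by rewrite /= cos2Dsin2 sqrtr1. Qed.

Lemma expi_sum (I : Type) (s : seq I) (x : I -> R) :
  expi (\sum_(i <- s) x i) = \prod_(i <- s) expi (x i).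
Proof.
elim: s => [|a s IH]; first by rewrite !big_nil expi0.
by rewrite !big_cons expiD IH.
Qed.

Lemma cvg_Rintegral_bounded (f_ : nat -> Omega -> R) (f : Omega -> R) (M : R) :
  (forall m, measurable_fun setT (f_ m)) -> measurable_fun setT f ->
  (forall m w, `|f_ m w| <= M) -> (forall w, f_ m w @[m --> \oo] --> f w) ->
  \int[P]_w f_ m w @[m --> \oo] --> \int[P]_w f w.
Proof.
move=> mf_ mf fM ff.
have b_ m : bounded_measurable (f_ m) by split => //; exists M.
have := @dominated_convergence _ _ _ P setT measurableT (fun m => EFin \o f_ m)
  (EFin \o f) (cst M%:E).
case.
- by move=> m; exact/measurable_EFinP.
- exact/measurable_EFinP.
- by apply: aeW => w _; apply: cvg_EFin; [exact: nearW|exact: ff].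
- by apply: (bmf_integrable P measurableT (bmf_cst M)).
- by apply: aeW => w m _; rewrite lee_fin.
move=> intf _ cf.
apply: fine_cvg; rewrite /Rintegral fineK//; exact: integrable_fin_num.
Qed.

End complex_expectation.

Lemma cvg_fin_sum (R : realType) (I : Type) (s : seq I) (f : I -> nat -> R) (l : I -> R) :
  (forall i, f i m @[m --> \oo] --> l i) ->
  (\sum_(i <- s) f i m) @[m --> \oo] --> \sum_(i <- s) l i.
Proof.
move=> fl; elim: s => [|a s IH].
  by under eq_fun do rewrite big_nil; rewrite big_nil; exact: cvg_cst.
by under eq_fun do rewrite big_cons; rewrite big_cons; exact: cvgD.
Qed.

Section characteristic_function.
Context {R : realType} {dO : measure_display} {Omega : measurableType dO}.
Variable P : probability Omega R.
Context {d : nat}.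
Variables (T H c0 theta : R) (X : R -> Omega -> 'rV[R]_d).
Hypothesis X_meas : jointly_measurable T X.
Hypothesis X_char : charfun_increments_bound P T X H c0 theta.
Local Notation normc := Normc.normc.

(* Times outside [[0, T]] are irrelevant; freezing the process at [0] there
   makes it measurable on the whole of [R * Omega]. *)
Definition coord_process (l : 'I_d) (p : measurableTypeR R * Omega) : R :=
  if (0 <= p.1 <= T) then X p.1 p.2 ord0 l else 0.

Lemma measurable_coord_process l : measurable_fun setT (coord_process l).
Proof.
rewrite (_ : coord_process l =
  (fun p : measurableTypeR R * Omega => X p.1 p.2 ord0 l) \_ (`[0, T] `*` setT)); last first.
  apply/funext => -[u w]; rewrite patchE /coord_process /=.
  case: ifPn => h; first by rewrite mem_set//= in_itv.
  by rewrite memNset//= in_itv/= => -[] /(negP h).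
apply: (measurable_restrictT _ _).1.
  by apply: measurableX; [exact: measurable_itv|exact: measurableT].
exact: (measurableT_comp (measurable_coord l) X_meas).
Qed.

Lemma coord_processE l u w : 0 <= u <= T -> coord_process l (u, w) = X u w ord0 l.
Proof. by rewrite /coord_process /= => ->. Qed.

Lemma measurable_coord_process1 l u :
  measurable_fun setT (fun w => coord_process l (u, w)).
Proof.
by apply: (measurableT_comp (measurable_coord_process l)); exact: pair1_measurable.
Qed.

Definition increments_phase (n : nat) (xi : nat -> 'I_d -> R) (t : nat -> R) w : R :=
  \sum_(j < n) \sum_(l < d) xi j l * (coord_process l (t j.+1, w) - coord_process l (t j, w)).

Lemma measurable_increments_phase n xi t :
  measurable_fun setT (increments_phase n xi t).
Proof.
apply: measurable_sum => j; apply: measurable_sum => l.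
by apply: measurable_funM => //; apply: measurable_funB; exact: measurable_coord_process1.
Qed.

Lemma normc_le (z : R[i]) B : 0 <= B ->
  (normc z <= B) = (complex.Re z ^+ 2 + complex.Im z ^+ 2 <= B ^+ 2).
Proof.
case: z => x y B0 /=.
by rewrite -{1}(ger0_norm B0) -sqrtr_sqr ler_sqrt// sqr_ge0.
Qed.

Lemma increments_times (n : nat) (t : nat -> R) : t 0%N = 0 ->
  (forall j, (j < n)%N -> t j < t j.+1) -> t n < T ->
  forall j, (j <= n)%N -> 0 <= t j <= T.
Proof.
move=> t0 tS tT j jn; apply/andP; split.
  elim: j jn => [|j IH] jn; first by rewrite t0.
  by rewrite (le_trans (IH (ltnW jn)))// ltW// tS.
apply: ltW; apply: le_lt_trans tT; rewrite -(subnKC jn).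
have : (n - j + j <= n)%N by rewrite subnK.
elim: (n - j)%N => [|k IH] h1; first by rewrite addn0.
rewrite (le_trans (IH _))//; first by rewrite (leq_trans _ h1)// addSn.
by rewrite addnS ltW// tS// addnC (leq_trans _ h1)// addSn.
Qed.

(* Vanishing frequencies are reached by letting nonzero ones tend to 0. *)
Lemma charfun_bound0 (n : nat) (xi : nat -> 'I_d -> R) (t : nat -> R)
    (k : nat -> 'I_d -> nat) :
  (0 < n)%N -> t 0%N = 0 -> (forall j, (j < n)%N -> t j < t j.+1) -> t n < T ->
  (forall j l, k j l = 0%N \/ k j l = 4%N) ->
  (forall j l, xi j l = 0 -> k j l = 0%N) ->
  normc (cexpectation P (fun w => expi (increments_phase n xi t w)))
  <= c0 ^+ n * n%:R `^ (H * theta * n%:R) *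
     \prod_(j < n) \prod_(l < d)
       (`|xi j l| ^+ k j l * (t j.+1 - t j) `^ (H * (k j l)%:R))^-1.
Proof.
move=> n0 t0 tS tT k04 xik; set B := (X in _ <= X).
(* Only zero frequencies are perturbed, and their exponent [k] is 0 by hypothesis, so the right-hand
   side does not depend on [m]. *)
pose xim m j l := if xi j l == 0 then m.+1%:R^-1 else xi j l.
have xim0 m j l : xim m j l != 0.
  by rewrite /xim; case: ifPn => // _; rewrite invr_eq0 pnatr_eq0.
have bound m : normc (cexpectation P (fun w => expi (increments_phase n (xim m) t w))) <= B.
  have := @X_char n (fun j => \row_l xim m j l) t (fun j => k j) n0 _ t0 tS tT _.
  have -> : \prod_(j < n) \prod_(l < d)
      (`|(\row_l0 xim m j l0) ord0 l| ^+ k j l * (t j.+1 - t j) `^ (H * (k j l)%:R))^-1 =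
      \prod_(j < n) \prod_(l < d)
       (`|xi j l| ^+ k j l * (t j.+1 - t j) `^ (H * (k j l)%:R))^-1.
    apply: eq_bigr => j _; apply: eq_bigr => l _; rewrite mxE /xim.
    by case: ifPn => // /eqP /xik ->; rewrite !expr0.
  rewrite -/B => h; apply: le_trans (h _ _).
  - rewrite le_eqVlt; apply/orP; left; apply/eqP; congr (normc (cexpectation P _)).
    apply/funext => w; congr expi; apply: eq_bigr => j _; apply: eq_bigr => l _.
    by rewrite !mxE !coord_processE// (increments_times t0 tS tT)// ltnW.
  - by move=> j l; rewrite mxE.
  - by [].
have B0 : 0 <= B by apply: le_trans (bound 0%N); exact: normc_ge0.
have cphase w : increments_phase n (xim m) t w @[m --> \oo] --> increments_phase n xi t w.
  apply: cvg_fin_sum => j; apply: cvg_fin_sum => l; apply: cvgMr_tmp.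
  rewrite /xim; have [->|_] := eqVneq (xi j l) 0; last exact: cvg_cst.
  exact: cvg_harmonic.
have mphase z := measurable_increments_phase n z t.
have cRe : \int[P]_w (cos (increments_phase n (xim m) t w)) @[m --> \oo] -->
    \int[P]_w (cos (increments_phase n xi t w)).
  apply: (cvg_Rintegral_bounded (M := 1)).
  - by move=> m; case: (cbmf_expi (mphase (xim m))) => -[].
  - by case: (cbmf_expi (mphase xi)) => -[].
  - by move=> m w; exact: cos_max.
  - move=> w; exact: (cvg_comp _ _ (cphase w) (@continuous_cos R _)).
have cIm : \int[P]_w (sin (increments_phase n (xim m) t w)) @[m --> \oo] -->
    \int[P]_w (sin (increments_phase n xi t w)).
  apply: (cvg_Rintegral_bounded (M := 1)).
  - by move=> m; case: (cbmf_expi (mphase (xim m))) => _ [].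
  - by case: (cbmf_expi (mphase xi)) => _ [].
  - by move=> m w; exact: sin_max.
  - move=> w; exact: (cvg_comp _ _ (cphase w) (@continuous_sin R _)).
rewrite normc_le// cexpectationE /= !expr2.
pose I m := \int[P]_w cos (increments_phase n (xim m) t w).
pose J m := \int[P]_w sin (increments_phase n (xim m) t w).
have cc : (I m * I m + J m * J m) @[m --> \oo] -->
    (\int[P]_w cos (increments_phase n xi t w)) * (\int[P]_w cos (increments_phase n xi t w)) +
    (\int[P]_w sin (increments_phase n xi t w)) * (\int[P]_w sin (increments_phase n xi t w)).
  by apply: cvgD; exact: cvgM.
rewrite -(cvg_lim _ cc)//; apply: limr_le; first exact: (cvgP _ cc).
apply: nearW => m; have := bound m.
by rewrite normc_le// cexpectationE /= !expr2.
Qed.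

End characteristic_function.

(** Turns a phase read at the times into one read on the increments: the frequency of an increment
    is the sum of the frequencies of all the times at or after its right end. *)
Lemma abel_summation (R : pzRingType) (n : nat) (f y : nat -> R) : y 0%N = 0 ->
  \sum_(j < n) (\sum_(j <= k < n) f k) * (y j.+1 - y j) = \sum_(i < n) f i * y i.+1.
Proof.
move=> y0; elim: n => [|n IH]; first by rewrite !big_ord0.
have -> : \sum_(j < n.+1) (\sum_(j <= k < n.+1) f k) * (y j.+1 - y j) =
    \sum_(j < n.+1) ((\sum_(j <= k < n) f k) * (y j.+1 - y j) + f n * (y j.+1 - y j)).
  by apply: eq_bigr => j _; rewrite big_nat_recr ?leq_ord//= mulrDl.
rewrite big_split/= [X in X + _]big_ord_recr/= IH [RHS]big_ord_recr/=.
rewrite [\sum_(n <= k < n) _]big_geq// mul0r addr0; congr (_ + _).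
rewrite -mulr_sumr; congr (_ * _).
by rewrite -(big_mkord xpredT (fun i => y i.+1 - y i)) telescope_sumr// y0 subr0.
Qed.

(** * Products of trigonometric polynomials along ordered times *)

Section trigonometric_products.
Context {R : realType} {dO : measure_display} {Omega : measurableType dO}.
Variable P : probability Omega R.
Context {d : nat}.
Variables (T H c0 theta : R) (X : R -> Omega -> 'rV[R]_d).
Hypothesis X_meas : jointly_measurable T X.
Hypothesis X_char : charfun_increments_bound P T X H c0 theta.
Hypothesis c0_ge0 : 0 <= c0.
Local Notation normc := Normc.normc.

(** The better of the two exponents 0 and 4 allowed in each coordinate, that is the minimum of 1 and
    x^(-4). *)
Definition freq_decay (x : R) : R := if `|x| <= 1 then 1 else (x ^+ 4)^-1.

Lemma freq_decay_ge0 x : 0 <= freq_decay x.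
Proof. by rewrite /freq_decay; case: ifP => // _; rewrite invr_ge0 exprn_even_ge0. Qed.

Definition decay_weight (rho tau : R) (k : 'I_d -> int) : R :=
  \prod_(l < d) freq_decay ((k l)%:~R * (tau `^ H / rho)).

Lemma decay_weight_ge0 rho tau k : 0 <= decay_weight rho tau k.
Proof. by apply: prodr_ge0 => l _; exact: freq_decay_ge0. Qed.

(** Subtracting the initial value makes the path start at 0, as [abel_summation] requires. No
    reduction modulo 2 pi is made: the functions applied to it are periodic. *)
Definition torus_process (rho : R) (p : measurableTypeR R * Omega) (l : 'I_d) : R :=
  (coord_process T X l p - coord_process T X l (0, p.2)) / rho.

Lemma measurable_torus_process rho l :
  measurable_fun setT (fun p => torus_process rho p l).
Proof.
apply: measurable_funM => //; apply: measurable_funB.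
  exact: measurable_coord_process.
apply: (measurableT_comp (measurable_coord_process X_meas l)).
by apply/measurable_fun_pair.
Qed.

Lemma measurable_torus_process1 rho u l :
  measurable_fun setT (fun w => torus_process rho (u, w) l).
Proof.
by apply: (measurableT_comp (measurable_torus_process rho l)); exact: pair1_measurable.
Qed.

Definition torus_phase (k : 'I_d -> int) (y : 'I_d -> R) : R :=
  \sum_(l < d) (k l)%:~R * y l.

Lemma measurable_torus_phase rho u k :
  measurable_fun setT (fun w => torus_phase k (torus_process rho (u, w))).
Proof.
apply: measurable_sum => l; apply: measurable_funM => //.
exact: measurable_torus_process1.
Qed.

Let C n := c0 ^+ n * n%:R `^ (H * theta * n%:R).

Let tail_freq n (f : nat -> 'I_d -> int) i l : int := \sum_(i <= k < n) f k l.

Lemma torus_charfun_bound (rho : R) (n : nat) (f : nat -> 'I_d -> int) (u : nat -> R) :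
  0 < rho -> (0 < n)%N -> u 0%N = 0 -> (forall j, (j < n)%N -> u j < u j.+1) -> u n < T ->
  normc (cexpectation P (fun w =>
    expi (\sum_(i < n) torus_phase (f i) (torus_process rho (u i.+1, w)))))
  <= C n * \prod_(i < n) decay_weight rho (u i.+1 - u i) (tail_freq n f i).
Proof.
move=> rho0 n0 u0 uS uT.
pose xi j l : R := (tail_freq n f j l)%:~R / rho.
(* Chosen so that each factor becomes a value of [freq_decay]; a zero frequency receives the
   exponent 0, as [charfun_bound0] demands. *)
pose k j l := if `|xi j l * (u j.+1 - u j) `^ H| <= 1 then 0%N else 4%N.
have := charfun_bound0 X_meas X_char (xi := xi) (k := k) n0 u0 uS uT _ _.
move=> h; apply: le_trans (le_trans (h _ _) _).
- rewrite le_eqVlt; apply/orP; left; apply/eqP; congr (normc (cexpectation P _)).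
  apply/funext => w; congr expi; rewrite /increments_phase exchange_big/=.
  rewrite [RHS]exchange_big/=; apply: eq_bigr => l _.
  pose y j := torus_process rho (u j, w) l.
  have y0 : y 0%N = 0 by rewrite /y /torus_process u0 subrr mul0r.
  rewrite -(@abel_summation _ n (fun i => (f i l)%:~R) y y0).
  apply: eq_bigr => j _; rewrite /xi /y /torus_process /tail_freq /=.
  by rewrite rmorph_sum/= -mulrBl opprB addrA subrK mulrA mulrAC.
- by move=> j l; rewrite /k; case: ifP => _; [left|right].
- by move=> j l h0; rewrite /k h0 mul0r normr0 ler01.
rewrite ler_wpM2l ?mulr_ge0 ?exprn_ge0 ?powR_ge0//.
rewrite le_eqVlt; apply/orP; left; apply/eqP; apply: eq_bigr => j _.
apply: eq_bigr => l _; rewrite /freq_decay /k /xi.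
rewrite mulrA mulrAC; case: ifP => _; first by rewrite mulr0 powRr0 expr0 mulr1 invr1.
congr (_^-1); rewrite exprMn powRrM powR_mulrn ?powR_ge0//.
by rewrite -normrX ger0_norm ?exprn_even_ge0// !exprMn mulrAC.
Qed.

Variables (I : finType) (fr : I -> 'I_d -> int) (b : I -> R[i]) (g : ('I_d -> R) -> R).
Hypothesis g_trig : forall y, (g y)%:C%C = \sum_m b m * expi (torus_phase (fr m) y).

Lemma bmf_trig_torus d' (U : measurableType d') (f : U -> measurableTypeR R * Omega) rho :
  measurable_fun setT f -> bounded_measurable (fun p => g (torus_process rho (f p))).
Proof.
move=> mf; have mphase m : measurable_fun setT
    (fun p => torus_phase (fr m) (torus_process rho (f p))).
  apply: measurable_sum => l; apply: measurable_funM => //.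
  exact: (measurableT_comp (measurable_torus_process rho l) mf).
have [] : cbounded_measurable (fun p => (g (torus_process rho (f p)))%:C%C).
  under eq_fun do rewrite g_trig.
  apply: cbmf_sum => m; apply: cbmfM; first exact: cbmf_cst.
  exact: cbmf_expi.
by [].
Qed.

Variables (rho : R) (A : R -> R) (W : ('I_d -> int) -> R).
Hypothesis rho_gt0 : 0 < rho.
Hypothesis W_ge1 : forall k, 1 <= W k.
Hypothesis A_ge0 : forall tau, 0 <= A tau.
Hypothesis bW : forall tau xi, 0 < tau ->
  \sum_m normc (b m) * decay_weight rho tau (fun l => fr m l + xi l) *
    W (fun l => fr m l + xi l) <= A tau * W xi.

(* Induction on the number of factors: the last factor carries the frequency
   [fr m + xi], and the profile inequality moves the weight [W] from it to [xi]. *)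
Lemma trig_product_bound n (u : nat -> R) :
  (0 < n)%N -> u 0%N = 0 -> (forall j, (j < n)%N -> u j < u j.+1) -> u n < T ->
  `|\int[P]_w (\prod_(i < n) g (torus_process rho (u i.+1, w)))| <=
  C n * W (fun=> 0) * \prod_(i < n) A (u i.+1 - u i).
Proof.
move=> n0 u0 uS uT.
pose G j w := \prod_(i < j) g (torus_process rho (u i.+1, w)).
pose ph j (f : nat -> 'I_d -> int) w :=
  \sum_(j <= i < n) torus_phase (f i) (torus_process rho (u i.+1, w)).
have bG j : bounded_measurable (G j).
  by apply: bmf_prod => i; apply: bmf_trig_torus; exact: pair1_measurable.
have mph j f : measurable_fun setT (ph j f).
  by apply: measurable_sum => i; exact: measurable_torus_phase.
have C0 : 0 <= C n by rewrite mulr_ge0 ?exprn_ge0 ?powR_ge0.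
(* [f] fixes the frequencies of the factors from index [j] on, while [G j] keeps the earlier ones
   unexpanded. Expanding one more factor leaves the later tail frequencies unchanged and creates the
   new one [fr m + xi], where [xi] is the tail frequency that carried [W]; [bW] then sums over
   [m]. *)
have key j f : (j <= n)%N ->
  normc (cexpectation P (fun w => (G j w)%:C%C * expi (ph j f w))) <=
  C n * (\prod_(i < j) A (u i.+1 - u i) * W (tail_freq n f j) *
    \prod_(j <= i < n) decay_weight rho (u i.+1 - u i) (tail_freq n f i)).
  elim: j f => [|j IH] f jn.
    rewrite big_ord0 mul1r big_mkord.
    apply: (@le_trans _ _ (C n * \prod_(i < n) decay_weight rho (u i.+1 - u i) (tail_freq n f i))).
      apply: le_trans (torus_charfun_bound f rho_gt0 n0 u0 uS uT).
      rewrite le_eqVlt; apply/orP; left; apply/eqP; congr (normc (cexpectation P _)).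
      by apply/funext => w; rewrite /G big_ord0 mul1r /ph big_mkord.
    rewrite ler_wpM2l// ler_peMl// prodr_ge0// => i _; exact: decay_weight_ge0.
  pose fm m i := if i == j then fr m else f i.
  have -> : cexpectation P (fun w => (G j.+1 w)%:C%C * expi (ph j.+1 f w)) =
      \sum_m b m * cexpectation P (fun w => (G j w)%:C%C * expi (ph j (fm m) w)).
    rewrite -cexpectation_sum; last first.
      by move=> m; exact: (cbmfM (cbmf_real (bG j)) (cbmf_expi (mph _ _))).
    congr cexpectation; apply/funext => w.
    rewrite /G big_ord_recr/= rmorphM/= g_trig mulr_sumr mulr_suml.
    apply: eq_bigr => m _; rewrite [ph j _ _]big_ltn// /fm eqxx expiD.
    rewrite (_ : \sum_(j.+1 <= i < n) _ = ph j.+1 f w); last first.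
      by apply: eq_big_nat => i /andP[ji _]; rewrite gtn_eqF.
    by rewrite -!mulrA mulrCA.
  have tfm m i : (j < i)%N -> tail_freq n (fm m) i = tail_freq n f i.
    move=> ji; apply/funext => l; apply: eq_big_nat => k /andP[ik _].
    by rewrite /fm gtn_eqF// (leq_trans ji).
  have tfmj m : tail_freq n (fm m) j = (fun l => fr m l + tail_freq n f j.+1 l).
    apply/funext => l; rewrite /tail_freq big_ltn// {1}/fm eqxx; congr (_ + _).
    by apply: eq_big_nat => k /andP[jk _]; rewrite /fm gtn_eqF.
  set D := \prod_(j.+1 <= i < n) _.
  have D0 : 0 <= D by apply: prodr_ge0 => i _; exact: decay_weight_ge0.
  have PA0 : 0 <= \prod_(i < j) A (u i.+1 - u i) by exact: prodr_ge0.
  apply: le_trans (normc_sum _ _) _.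
  apply: (@le_trans _ _ (\sum_m (C n * \prod_(i < j) A (u i.+1 - u i) * D) *
     (normc (b m) * decay_weight rho (u j.+1 - u j) (fun l => fr m l + tail_freq n f j.+1 l) *
      W (fun l => fr m l + tail_freq n f j.+1 l)))).
    apply: ler_sum => m _; rewrite Normc.normcM.
    apply: (le_trans (ler_wpM2l (normc_ge0 _) (IH (fm m) (ltnW jn)))).
    rewrite big_ltn// tfmj.
    rewrite (_ : \prod_(j.+1 <= i < n) _ = D); last first.
      by apply: eq_big_nat => i /andP[ji _]; rewrite tfm.
    by rewrite le_eqVlt; apply/orP; left; apply/eqP; ring.
  rewrite -mulr_sumr big_ord_recr/=.
  apply: (le_trans (ler_wpM2l _ (bW _ _))).
  - by apply: mulr_ge0 => //; exact: mulr_ge0.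
  - by rewrite subr_gt0 uS.
  - by rewrite le_eqVlt; apply/orP; left; apply/eqP; ring.
have := key n (fun _ _ => 0) (leqnn n).
rewrite [\prod_(n <= i < n) _]big_geq// mulr1.
have -> : cexpectation P (fun w => (G n w)%:C%C * expi (ph n (fun _ _ => 0) w)) =
   (\int[P]_w G n w)%:C%C.
  rewrite cexpectationE; apply/eqP; rewrite eq_complex /=; apply/andP; split; apply/eqP.
    by apply: eq_Rintegral => w _; rewrite /ph big_geq// cos0 mulr1 mul0r subr0.
  under eq_Rintegral do rewrite /ph big_geq// sin0 mulr0 mul0r add0r.
  by rewrite Rintegral_cst// mul0r.
rewrite normc_real => h; apply: (le_trans h).
rewrite (_ : tail_freq n _ n = fun=> 0); last by apply/funext => l; rewrite /tail_freq big_geq.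
by rewrite le_eqVlt; apply/orP; left; apply/eqP; ring.
Qed.

End trigonometric_products.

(** * Fejer kernels and their frequency decay *)

Section lattice_sums.
Context {R : realType}.
Implicit Types s sigma gamma : R.

(** A natural number is the absolute value of at most two integers of the window c, ..., c + m -
    1. *)
Lemma sum_abs_shift_le (phi : nat -> R) (B : R) (m : nat) (c : int) :
  (forall k, 0 <= phi k) -> (forall L, \sum_(k < L) phi k <= B) ->
  \sum_(i < m) phi (absz (i%:Z + c)) <= 2 * B.
Proof.
move=> phi0 phiB; have B0 : 0 <= B by have := phiB 0%N; rewrite big_ord0.
case: c => c.
  under eq_bigr => i _ do rewrite -PoszD absz_nat addnC.
  apply: (@le_trans _ _ (\sum_(k < c + m) phi k)); last by have := phiB (c + m)%N; lra.
  by rewrite big_split_ord/= lerDr sumr_ge0.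
rewrite NegzE; set e := c.+1.
apply: (@le_trans _ _ (\sum_(i < e + m) phi (absz (i%:Z - e%:Z)))).
  by rewrite addnC big_split_ord/= lerDl sumr_ge0.
rewrite big_split_ord/= mulr_natl mulr2n lerD//.
  rewrite (reindex_inj rev_ord_inj)/=.
  apply: (@le_trans _ _ (\sum_(k < e.+1) phi k)); last exact: phiB.
  rewrite [leRHS]big_ord_recl/= ler_wpDl// ler_sum// => i _.
  rewrite le_eqVlt; apply/orP; left; apply/eqP; congr phi.
  by have := ltn_ord i; rewrite /bump /=; lia.
apply: le_trans (phiB m); rewrite le_eqVlt; apply/orP; left; apply/eqP.
by apply: eq_bigr => i _; congr phi; lia.
Qed.

(** Telescoping: 1 / (x + 1)^2 <= 1 / x - 1 / (x + 1) with x = m + s. *)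
Lemma inv_sqr_sum_le s L : 1 <= s -> \sum_(k < L) s ^+ 2 / (k%:R + s) ^+ 2 <= 2 * s.
Proof.
move=> s1; have s0 : 0 < s by lra.
suff : forall L, \sum_(k < L.+1) s ^+ 2 / (k%:R + s) ^+ 2 <= 1 + s - s ^+ 2 / (L%:R + s).
  case: L => [|L h]; first by rewrite big_ord0; lra.
  apply: le_trans (h L) _; have : 0 <= s ^+ 2 / (L%:R + s).
    by rewrite divr_ge0 ?sqr_ge0// addr_ge0// ltW.
  lra.
elim=> [|m IH].
  by rewrite big_ord_recr big_ord0/= !add0r divff ?expf_neq0 ?gt_eqF// expr2 mulfK ?gt_eqF//; lra.
rewrite big_ord_recr/=; apply: (le_trans (lerD IH (lexx _))).
set x : R := m%:R + s; have x0 : 0 < x by rewrite /x ltr_wpDl.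
have -> : m.+1%:R + s = x + 1 :> R by rewrite /x -natr1; lra.
rewrite -addrA lerD2l addrC -lerBrDr opprK -mulrN -mulrDr ler_pM2l ?exprn_gt0//.
rewrite -[X in _ <= X]addrC -subr_ge0.
have -> : x^-1 - (x + 1)^-1 - ((x + 1) ^+ 2)^-1 = (x * (x + 1) ^+ 2)^-1.
  by field; rewrite !gt_eqF//; lra.
by rewrite invr_ge0 mulr_ge0 ?exprn_ge0//; lra.
Qed.

(** [s] is the frequency at which the decay sets in. Below it, the decay is bounded by 1. Above it,
    (s / k)^4 meets a weight of order s^(2 gamma) k / s, as 2 gamma <= 1, so more than two powers of
    s / k survive. The profile s^2 / (k + s)^2 is comparable to 1 in the first range and to (s /
    k)^2 in the second. *)
Lemma decay_profile_le s sigma gamma (k : nat) : 0 < sigma -> 0 <= gamma <= 2^-1 ->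
  s = Num.max 1 sigma^-1 ->
  (1 + k%:R) `^ (2 * gamma) * freq_decay (k%:R * sigma) <=
  8 * s `^ (2 * gamma) * (s ^+ 2 / (k%:R + s) ^+ 2).
Proof.
move=> sig0 /andP[g0 g1] sE.
have s1 : 1 <= s by rewrite sE le_max lexx.
have ssig : sigma^-1 <= s by rewrite sE le_max lexx orbT.
have s0 : 0 < s by lra.
have s0' : 0 <= s by exact: ltW.
have k0 : 0 <= k%:R :> R by [].
have ks0 : 0 < k%:R + s by lra.
have powle x : 1 <= x -> x `^ (2 * gamma) <= x.
  by move=> x1; rewrite -[leRHS]powRr1 ?ler_powR//; lra.
have pow2 : (2 : R) `^ (2 * gamma) <= 2 by apply: powle; lra.
have ps0 : 0 < s `^ (2 * gamma) by exact: powR_gt0.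
have [ks|sk] := leP k%:R s.
  have fd1 : freq_decay (k%:R * sigma) <= 1.
    rewrite /freq_decay; case: ifPn => //; rewrite -ltNge => /ltW h.
    have -> : (k%:R * sigma) ^+ 4 = `|k%:R * sigma| ^+ 4.
      by rewrite -normrX ger0_norm// exprn_even_ge0.
    by rewrite invf_le1 ?exprn_ege1// exprn_gt0// (lt_le_trans _ h).
  have h1 : (1 + k%:R) `^ (2 * gamma) <= 2 * s `^ (2 * gamma).
    apply: (@le_trans _ _ ((2 * s) `^ (2 * gamma))).
      by rewrite ge0_ler_powR ?nnegrE//; lra.
    by rewrite powRM// ler_pM2r.
  have h2 : 1 <= 4 * (s ^+ 2 / (k%:R + s) ^+ 2).
    rewrite mulrA ler_pdivlMr ?exprn_gt0// mul1r; nra.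
  apply: (@le_trans _ _ (2 * s `^ (2 * gamma) * 1)).
    by rewrite ler_pM// ?powR_ge0 ?freq_decay_ge0.
  apply: (@le_trans _ _ (2 * s `^ (2 * gamma) * (4 * (s ^+ 2 / (k%:R + s) ^+ 2)))).
    by rewrite ler_pM2l// mulr_gt0.
  by rewrite le_eqVlt; apply/orP; left; apply/eqP; ring.
have kpos : 0 < k%:R :> R by lra.
have sig0' : 0 <= sigma by exact: ltW.
have fd : freq_decay (k%:R * sigma) <= (s / k%:R) ^+ 4.
  have ks1 : k%:R^-1 <= sigma / sigma / k%:R.
    by rewrite divff ?gt_eqF// mul1r.
  rewrite /freq_decay ger0_norm; last by rewrite mulr_ge0.
  case: ifPn => h.
    rewrite -[leLHS](expr1n _ 4) ler_pXn2r ?nnegrE ?divr_ge0//.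
    rewrite ler_pdivlMr// mul1r; apply: le_trans ssig.
    by rewrite -[leRHS]mul1r ler_pdivlMr.
  rewrite -exprVn ler_pXn2r ?nnegrE ?divr_ge0 ?invr_ge0 ?mulr_ge0//.
  by rewrite invfM mulrC ler_pM2r ?invr_gt0.
have h1 : (1 + k%:R) `^ (2 * gamma) <= 2 * s `^ (2 * gamma) * (k%:R / s).
  have -> : 1 + k%:R = (1 + k%:R) / k%:R * s * (k%:R / s) :> R.
    by field; rewrite !gt_eqF.
  have q1 : 1 <= (1 + k%:R) / k%:R :> R by rewrite ler_pdivlMr//; lra.
  have q2 : (1 + k%:R) / k%:R <= 2 :> R by rewrite ler_pdivrMr//; lra.
  have q3 : 1 <= k%:R / s by rewrite ler_pdivlMr//; lra.
  have q0 : 0 <= (1 + k%:R) / k%:R :> R by lra.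
  have r0 : 0 <= k%:R / s by lra.
  rewrite powRM ?(mulr_ge0 q0)// powRM//.
  apply: ler_pM; rewrite ?mulr_ge0 ?powR_ge0 ?powle//.
  rewrite ler_pM2r//; apply: le_trans q2; exact: powle.
apply: (@le_trans _ _ (2 * s `^ (2 * gamma) * (k%:R / s) * (s / k%:R) ^+ 4)).
  by rewrite ler_pM ?powR_ge0 ?freq_decay_ge0.
have -> : 2 * s `^ (2 * gamma) * (k%:R / s) * (s / k%:R) ^+ 4 =
  2 * s `^ (2 * gamma) * (s / k%:R) ^+ 3 by field; rewrite !gt_eqF.
have q3 : s / k%:R <= 1 by rewrite ler_pdivrMr// mul1r ltW.
apply: (@le_trans _ _ (2 * s `^ (2 * gamma) * (s / k%:R) ^+ 2)).
  rewrite ler_pM2l ?mulr_gt0// exprS ler_piMl ?exprn_ge0 ?divr_ge0//.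
have h2 : (s / k%:R) ^+ 2 <= 4 * (s ^+ 2 / (k%:R + s) ^+ 2).
  have -> : 4 * (s ^+ 2 / (k%:R + s) ^+ 2) = (2 * s / (k%:R + s)) ^+ 2.
    by field; rewrite gt_eqF.
  rewrite ler_pXn2r ?nnegrE ?divr_ge0 ?mulr_ge0 ?addr_ge0//.
  rewrite ler_pdivrMr// mulrAC ler_pdivlMr//.
  by rewrite -mulrA mulrCA ler_pM2l//; lra.
apply: (@le_trans _ _ (2 * s `^ (2 * gamma) * (4 * (s ^+ 2 / (k%:R + s) ^+ 2)))).
  by rewrite ler_pM2l// mulr_gt0.
by rewrite le_eqVlt; apply/orP; left; apply/eqP; ring.
Qed.

End lattice_sums.

Section lattice_decay.
Context {R : realType}.

Lemma freq_decayN (x : R) : freq_decay (- x) = freq_decay x.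
Proof. by rewrite /freq_decay normrN -mulN1r exprMn -signr_odd mul1r. Qed.

Lemma freq_decay_absz (k : int) (sigma : R) :
  freq_decay (k%:~R * sigma) = freq_decay ((absz k)%:R * sigma).
Proof.
case: k => k; first by rewrite absz_nat.
by rewrite NegzE rmorphN mulNr freq_decayN abszN absz_nat.
Qed.

(** Uniformity in the shift [c] is what allows one frequency to be summed out whatever the others
    are. The exponent 1 counts the frequencies below the cutoff and 2 gamma comes from the weight;
    32 is 8 from the profile, 2 from its sum and 2 from the two signs. *)
Lemma lattice_decay_sum (sigma gamma : R) (m : nat) (c : int) :
  0 < sigma -> 0 <= gamma <= 2^-1 ->
  \sum_(i < m) (1 + `|(i%:Z + c)%:~R|) `^ (2 * gamma) *
     freq_decay ((i%:Z + c)%:~R * sigma)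
  <= 32 * (Num.max 1 sigma^-1) `^ (1 + 2 * gamma).
Proof.
move=> sig0 g01; set s := Num.max 1 sigma^-1.
have s1 : 1 <= s by rewrite le_max lexx.
have s0 : 0 < s by lra.
pose phi (k : nat) : R := (1 + k%:R) `^ (2 * gamma) * freq_decay (k%:R * sigma).
rewrite (eq_bigr (fun i : 'I_m => phi (absz (i%:Z + c)))); last first.
  move=> i _; rewrite /phi freq_decay_absz; congr (_ `^ _ * _).
  by rewrite -intr_norm -abszE pmulrn.
apply: le_trans (sum_abs_shift_le (B := 16 * s `^ (1 + 2 * gamma)) _ _ _ _) _.
- by move=> k; rewrite mulr_ge0 ?powR_ge0 ?freq_decay_ge0.
- move=> L; apply: (@le_trans _ _ (\sum_(k < L) 8 * s `^ (2 * gamma) * (s ^+ 2 / (k%:R + s) ^+ 2))).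
    by apply: ler_sum => k _; exact: decay_profile_le.
  rewrite -mulr_sumr powRD; last by rewrite (gt_eqF s0) implybT.
  rewrite powRr1 ?(ltW s0)//.
  apply: (@le_trans _ _ (8 * s `^ (2 * gamma) * (2 * s))).
    by rewrite ler_wpM2l ?inv_sqr_sum_le// mulr_ge0// powR_ge0.
  by rewrite le_eqVlt; apply/orP; left; apply/eqP; ring.
- lra.
Qed.

End lattice_decay.

Section fejer_kernel.
Context {R : realType}.
Implicit Types (N M : nat) (x : R).

Definition fejer_coef N (k : int) : R := Num.max 0 (1 - `|k%:~R| / N%:R).

(** The zeroth Fourier coefficient is 1. The index [k] stands for the frequency k + 1, and the last
    one, N, has coefficient 0. *)
Definition fejer N x : R :=
  1 + 2 * \sum_(k < N) fejer_coef N k.+1%:Z * cos (k.+1%:R * x).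

Lemma fejer_coef_itv N k : 0 <= fejer_coef N k <= 1.
Proof.
rewrite /fejer_coef le_max lexx/= ge_max ler01/= gerBl divr_ge0//.
Qed.

Lemma fejer_coefN N k : fejer_coef N (- k) = fejer_coef N k.
Proof. by rewrite /fejer_coef rmorphN/= normrN. Qed.

Lemma fejer_coef_nat N (k : nat) : (0 < N)%N -> (k <= N)%N ->
  fejer_coef N k%:Z = (N%:R - k%:R) / N%:R.
Proof.
move=> N0 kN; rewrite /fejer_coef -pmulrn normr_nat mulrBl divff ?pnatr_eq0 -?lt0n//.
by apply/max_idPr; rewrite subr_ge0 ler_pdivrMr ?ltr0n// mul1r ler_nat.
Qed.

Lemma fejer_coef_eq0 N (k : nat) : (0 < N)%N -> (N <= k)%N -> fejer_coef N k%:Z = 0.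
Proof.
move=> N0 Nk; rewrite /fejer_coef -pmulrn normr_nat; apply/max_idPl.
by rewrite subr_le0 ler_pdivlMr ?ltr0n// mul1r ler_nat.
Qed.

(** The right-hand side is the squared modulus of the sum of e^(i m x) over m < N. When [N] grows by
    one, the cross terms of the new exponential with the old ones are exactly the growth of the
    triangular weights. *)
Lemma fejer_sqr N x : (0 < N)%N ->
  N%:R * fejer N x = (\sum_(m < N) cos (m%:R * x)) ^+ 2 + (\sum_(m < N) sin (m%:R * x)) ^+ 2.
Proof.
move=> N0.
have -> : N%:R * fejer N x =
    N%:R + 2 * \sum_(k < N) (N%:R - k.+1%:R) * cos (k.+1%:R * x).
  rewrite /fejer mulrDr mulr1; congr (_ + _); rewrite mulrCA mulr_sumr; congr (_ * _).
  apply: eq_bigr => k _; rewrite fejer_coef_nat// mulrA; congr (_ * _).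
  by rewrite mulrC mulfVK ?pnatr_eq0 -?lt0n.
elim: N {N0} => [|N IH]; first by rewrite !big_ord0 expr0n/= mulr0 !addr0.
rewrite [\sum_(m < N.+1) cos _]big_ord_recr [\sum_(m < N.+1) sin _]big_ord_recr/=.
set C := \sum_(m < N) cos _; set S := \sum_(m < N) sin _.
have CS : C * cos (N%:R * x) + S * sin (N%:R * x) = \sum_(k < N) cos (k.+1%:R * x).
  rewrite !mulr_suml -big_split/= (reindex_inj rev_ord_inj)/=.
  apply: eq_bigr => m _; rewrite addrC -addrC (mulrC (cos _)) (mulrC (sin _)) -cosB.
  by rewrite -mulrBl natrB ?ltn_ord// opprB addrC subrK.
have -> : (C + cos (N%:R * x)) ^+ 2 + (S + sin (N%:R * x)) ^+ 2 =
   C ^+ 2 + S ^+ 2 + (cos (N%:R * x) ^+ 2 + sin (N%:R * x) ^+ 2) +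
   2 * (C * cos (N%:R * x) + S * sin (N%:R * x)) by ring.
rewrite CS -IH cos2Dsin2 big_ord_recr/= subrr mul0r addr0.
have -> : \sum_(k < N) (N.+1%:R - k.+1%:R) * cos (k.+1%:R * x) =
  \sum_(k < N) (N%:R - k.+1%:R) * cos (k.+1%:R * x) + \sum_(k < N) cos (k.+1%:R * x).
  by rewrite -big_split/=; apply: eq_bigr => k _; rewrite -[N.+1%:R]natr1; ring.
by rewrite -[N.+1%:R]natr1; ring.
Qed.

Lemma fejer_ge0 N x : (0 < N)%N -> 0 <= fejer N x.
Proof.
move=> N0; rewrite -(@pmulr_rge0 _ N%:R) ?ltr0n// fejer_sqr//.
by rewrite addr_ge0 ?sqr_ge0.
Qed.

Lemma cos_ge_cos1 x : `|x| <= 1 -> cos 1 <= cos x.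
Proof.
move=> x1; rewrite -(cos_norm x) le_eqVlt; apply/orP.
have := pi_ge2 R => pi2.
have [->|x1'] := eqVneq `|x| 1; [by left|right].
rewrite ltr_cos ?in_itv/= ?normr_ge0/=.
- by rewrite lt_neqAle x1'.
- by lra.
- lra.
Qed.

(** All [N] phases m x stay in [-1, 1], so the cosine sum alone is at least N cos 1. *)
Lemma fejer_ge N x : (0 < N)%N -> `|x| <= N%:R^-1 -> N%:R * cos 1 ^+ 2 <= fejer N x.
Proof.
move=> N0 xN; have N0' : (0 : R) < N%:R by rewrite ltr0n.
rewrite -(ler_pM2l N0') fejer_sqr// mulrA -expr2 -exprMn.
apply: (@le_trans _ _ ((\sum_(m < N) cos (m%:R * x)) ^+ 2)); last by rewrite lerDl sqr_ge0.
have c1 := @cos1_gt0 R.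
rewrite ler_pXn2r ?nnegrE//; last 2 first.
- by rewrite mulr_ge0// ltW.
- apply: sumr_ge0 => m _; apply: le_trans (cos_ge_cos1 _); first exact: ltW.
  rewrite normrM normr_nat (le_trans (ler_wpM2l _ xN))// ler_pdivrMr// mul1r ler_nat.
  by rewrite ltnW.
rewrite mulr_natl -[X in _ *+ X](card_ord N) -sumr_const ler_sum// => m _.
apply: cos_ge_cos1; rewrite normrM normr_nat (le_trans (ler_wpM2l _ xN))//.
by rewrite ler_pdivrMr// mul1r ler_nat ltnW.
Qed.

Lemma cosD_int2pi x (m : int) : cos (x + m%:~R * (pi *+ 2)) = cos x.
Proof.
have h (y : R) (k : nat) : cos (y + k%:R * (pi *+ 2)) = cos y.
  rewrite mulr_natl; elim: k => [|k IH]; first by rewrite addr0.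
  by rewrite mulrSr addrA cosD2pi.
case: m => k; first exact: h.
by rewrite NegzE rmorphN mulNr -(h _ k.+1) subrK.
Qed.

Lemma fejerD_int2pi N x (m : int) : fejer N (x + m%:~R * (pi *+ 2)) = fejer N x.
Proof.
rewrite /fejer; congr (_ + _ * _); apply: eq_bigr => k _; congr (_ * _).
rewrite mulrDr mulrA (_ : k.+1%:R * m%:~R = (k.+1%:Z * m)%:~R) ?cosD_int2pi//.
by rewrite intrM.
Qed.

Lemma sum_symmetric M (F : int -> R[i]) :
  \sum_(i < M.*2.+1) F (i%:Z - M%:Z) =
  F 0 + \sum_(k < M) (F k.+1%:Z + F (- k.+1%:Z)).
Proof.
have -> : M.*2.+1 = (M + M.+1)%N by rewrite -addnn addnS.
rewrite big_split_ord/= [\sum_(i < M.+1) _]big_ord_recl/= big_split/=.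
rewrite addn0 subrr addrCA; congr (_ + _); rewrite addrC; congr (_ + _).
  by apply: eq_bigr => i _; congr F; rewrite /bump/=; lia.
rewrite (reindex_inj rev_ord_inj)/=; apply: eq_bigr => i _; congr F.
by have := ltn_ord i; lia.
Qed.

(** The cutoff [M] may exceed [N], the extra coefficients being 0, so that kernels of different
    orders share one set of frequencies. *)
Lemma fejer_trig N M x : (0 < N)%N -> (N <= M)%N ->
  (fejer N x)%:C%C = \sum_(i < M.*2.+1) (fejer_coef N (i%:Z - M%:Z))%:C%C *
     expi ((i%:Z - M%:Z)%:~R * x).
Proof.
move=> N0 NM; rewrite (sum_symmetric M (fun k => (fejer_coef N k)%:C%C * expi (k%:~R * x))).
rewrite mul0r expi0 mulr1 /fejer_coef normr0 mul0r subr0 max_r ?ler01// -/(fejer_coef).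
rewrite /fejer rmorphD/=; congr (_ + _).
rewrite rmorphM rmorph_sum/=.
have -> : \sum_(k < N) (fejer_coef N k.+1%:Z * cos (k.+1%:R * x))%:C%C =
  \sum_(k < M) (fejer_coef N k.+1%:Z * cos (k.+1%:R * x))%:C%C.
  rewrite -(subnKC NM) [RHS]big_split_ord/= [X in _ + X]big1 ?addr0// => i _.
  by rewrite fejer_coef_eq0 ?mul0r// -addnS leq_addr.
rewrite mulr_sumr; apply: eq_bigr => k _.
rewrite -/(fejer_coef N k.+1%:Z) -/(fejer_coef N (- k.+1%:Z)) fejer_coefN -mulrDr.
rewrite rmorphM mulrCA; congr (_ * _).
rewrite rmorphN mulNr /expi cosN sinN; apply/eqP; rewrite eq_complex /=.
by rewrite subrr !mul0r subr0 addr0 mulr0 eqxx andbT; apply/eqP; ring.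
Qed.

End fejer_kernel.

(** * Tensor products of Fejer kernels on the torus *)

Section torus_kernels.
Context {R : realType} {d : nat}.
Local Notation normc := Normc.normc.
Implicit Types (N M : nat) (y z : 'I_d -> R).

Lemma freq_decay_le1 (x : R) : freq_decay x <= 1.
Proof.
rewrite /freq_decay; case: ifPn => //; rewrite -ltNge => /ltW h.
have -> : x ^+ 4 = `|x| ^+ 4 by rewrite -normrX ger0_norm// exprn_even_ge0.
by rewrite invf_le1 ?exprn_ege1// exprn_gt0// (lt_le_trans _ h).
Qed.

Definition freq_box M (m : {ffun 'I_d -> 'I_(M.*2.+1)}) (l : 'I_d) : int :=
  (m l)%:Z - M%:Z.

Definition torus_fejer N z y : R := \prod_(l < d) fejer N (y l - z l).

Definition torus_fejer_coef N M z (m : {ffun 'I_d -> 'I_(M.*2.+1)}) : R[i] :=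
  \prod_(l < d) ((fejer_coef N (freq_box m l))%:C%C * expi (- (freq_box m l)%:~R * z l)).

Lemma torus_fejer_trig N M z y : (0 < N)%N -> (N <= M)%N ->
  (torus_fejer N z y)%:C%C =
  \sum_m torus_fejer_coef N z m * expi (torus_phase (@freq_box M m) y).
Proof.
move=> N0 NM; rewrite rmorph_prod/=.
under eq_bigr do rewrite (fejer_trig _ N0 NM).
rewrite bigA_distr_bigA/=; apply: eq_bigr => m _.
rewrite /torus_phase expi_sum -big_split/=; apply: eq_bigr => l _.
rewrite /freq_box -mulrA -expiD; congr (_ * expi _); ring.
Qed.

Lemma normc_prod (I : Type) (s : seq I) (x : I -> R[i]) :
  normc (\prod_(i <- s) x i) = \prod_(i <- s) normc (x i).
Proof.
elim: s => [|a s IH]; first by rewrite !big_nil Normc.normc1.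
by rewrite !big_cons Normc.normcM IH.
Qed.

Lemma prod_itv01_le1 (I : Type) (s : seq I) (x : I -> R) :
  (forall i, 0 <= x i <= 1) -> 0 <= \prod_(i <- s) x i <= 1.
Proof.
move=> x01; elim: s => [|a s /andP[IH0 IH1]]; first by rewrite big_nil ler01 lexx.
by rewrite big_cons; have /andP[a0 a1] := x01 a; rewrite mulr_ge0//= mulr_ile1.
Qed.

Lemma normc_torus_fejer_factor N (k : int) (x : R) :
  normc ((fejer_coef N k)%:C%C * expi x) <= 1.
Proof.
rewrite Normc.normcM normc_expi mulr1 normc_real.
by have /andP[c0 c1] := @fejer_coef_itv R N k; rewrite ger0_norm.
Qed.

Lemma normc_torus_fejer_coef N M z m : normc (@torus_fejer_coef N M z m) <= 1.
Proof.
have h01 l : 0 <= normc ((fejer_coef N (freq_box m l))%:C%C * expi (- (freq_box m l)%:~R * z l)) <= 1.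
  by rewrite normc_ge0 normc_torus_fejer_factor.
by rewrite normc_prod; have /andP[] := prod_itv01_le1 (index_enum 'I_d) h01.
Qed.

Lemma normc_prodB (I : Type) (s : seq I) (x y : I -> R[i]) :
  (forall i, normc (x i) <= 1) -> (forall i, normc (y i) <= 1) ->
  normc (\prod_(i <- s) x i - \prod_(i <- s) y i) <= \sum_(i <- s) normc (x i - y i).
Proof.
move=> x1 y1; elim: s => [|a s IH]; first by rewrite !big_nil subrr Normc.normc0.
rewrite !big_cons.
set p := \prod_(i <- s) x i; set q := \prod_(i <- s) y i.
have -> : x a * p - y a * q = (x a - y a) * p + y a * (p - q) by ring.
apply: le_trans (le_normcD _ _) _; rewrite !Normc.normcM lerD//.
  rewrite ler_piMr ?normc_ge0// normc_prod.
  have h01 i : 0 <= normc (x i) <= 1 by rewrite normc_ge0 x1.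
  by have /andP[] := prod_itv01_le1 s h01.
by apply: le_trans IH; rewrite ler_piMl ?normc_ge0.
Qed.

Lemma norm_derive_lip (f df : R -> R) (x y : R) :
  (forall t : R, is_derive t (1 : R) f (df t)) -> (forall t : R, `|df t| <= 1) ->
  `|f x - f y| <= `|x - y|.
Proof.
move=> fdf df1; wlog xy : x y / x <= y.
  by move=> h; have [/h //|/ltW/h] := leP x y; rewrite distrC (distrC y).
have cf : {within `[x, y], continuous f}.
  by apply: derivable_within_continuous => t _; have [] := fdf t.
have [c _] := @MVT_segment _ f df x y xy (fun t _ => fdf t) cf.
by rewrite (distrC x) (distrC (f x)) => ->; rewrite normrM ler_piMl.
Qed.

Lemma norm_sinB_le (x y : R) : `|sin x - sin y| <= `|x - y|.
Proof. by apply: (@norm_derive_lip sin cos) => t; exact: cos_max. Qed.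

Lemma norm_cosB_le (x y : R) : `|cos x - cos y| <= `|x - y|.
Proof.
by apply: (@norm_derive_lip cos (fun x => - sin x)) => t; rewrite normrN sin_max.
Qed.

Lemma normc_expiB (x y : R) : normc (expi x - expi y) <= 2 * `|x - y|.
Proof.
rewrite normc_le ?mulr_ge0//= exprMn -[X in X + _]real_normK ?num_real//.
rewrite -[X in _ + X]real_normK ?num_real//.
have := @norm_cosB_le x y; have := @norm_sinB_le x y; have := normr_ge0 (x - y).
have := normr_ge0 (cos x - cos y); have := normr_ge0 (sin x - sin y).
by set a := `|cos x - cos y|; set b := `|sin x - sin y|; set c := `|x - y|; nra.
Qed.

End torus_kernels.

Section torus_profiles.
Context {R : realType} {d : nat}.
Local Notation normc := Normc.normc.
Implicit Types (N M : nat) (y z : 'I_d -> R).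

(* The bound [K * (1 + (lambda * tau) `^ (- a))] is the factor that each time
   increment [tau] contributes to moments of integrals of [g]. *)
Definition torus_poly (H rho lambda a K : R) (g : ('I_d -> R) -> R) : Prop :=
  exists (I : finType) (fr : I -> 'I_d -> int) (b : I -> R[i]) (W : ('I_d -> int) -> R),
  [/\ forall y, (g y)%:C%C = \sum_m b m * expi (torus_phase (fr m) y),
      forall k, 1 <= W k, W (fun=> 0) = 1 &
      forall tau xi, 0 < tau ->
        \sum_m normc (b m) * decay_weight H rho tau (fun l => fr m l + xi l) *
          W (fun l => fr m l + xi l) <=
        K * (1 + (lambda * tau) `^ (- a)) * W xi].

(** The choice rho = lambda^(- H) makes the cutoff of the lattice sums the maximum of 1 and (lambda
    tau)^(- H), so that [tau] enters only through lambda tau. *)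
Lemma scale_powR_le (H rho lambda tau p : R) : 0 < lambda -> rho = lambda `^ (- H) ->
  0 < tau -> 0 <= p ->
  (Num.max 1 (tau `^ H / rho)^-1) `^ p <= 1 + (lambda * tau) `^ (- (H * p)).
Proof.
move=> l0 -> t0 p0.
have -> : (tau `^ H / lambda `^ (- H))^-1 = (lambda * tau) `^ (- H).
  by rewrite invfM invrK -powRN mulrC powRM// ltW.
rewrite -mulNr powRrM; set x := (lambda * tau) `^ _.
rewrite /Num.max; case: ifP => _; first by rewrite lerDr.
by rewrite powR1 lerDl powR_ge0.
Qed.

(** Interpolates between two bounds: 3, since every term is at most 1 / N, and 32 s / N from the
    lattice sum. A larger [e] buys decay in [N] at the price of a stronger singularity in time,
    hidden in s^e. *)
Lemma fejer_decay_avg N (sigma e : R) (c : int) : (0 < N)%N -> 0 < sigma -> 0 <= e <= 1 ->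
  \sum_(i < N.*2.+1) N%:R^-1 * freq_decay ((i%:Z - N%:Z + c)%:~R * sigma)
  <= 32 * ((Num.max 1 sigma^-1) `^ e * N%:R `^ (- e)).
Proof.
move=> N0 sig0 /andP[e0 e1]; set s := Num.max 1 sigma^-1.
have s1 : 1 <= s by rewrite le_max lexx.
have s0 : 0 < s by lra.
have N0' : (0 : R) < N%:R by rewrite ltr0n.
have -> : s `^ e * N%:R `^ (- e) = (s / N%:R) `^ e.
  by rewrite powRM ?invr_ge0 ?(ltW s0)// -powR_inv1 ?(ltW N0')// -powRrM mulN1r.
have [Ns|sN] := leP N%:R s.
  apply: (@le_trans _ _ 3).
    apply: (@le_trans _ _ (\sum_(i < N.*2.+1) N%:R^-1)).
      by apply: ler_sum => i _; rewrite ler_piMr ?invr_ge0 ?(ltW N0')// freq_decay_le1.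
    rewrite sumr_const card_ord -[_ *+ _]mulr_natl ler_pdivrMr// -natrM ler_nat.
    by move: N0; clear; lia.
  have : 1 <= (s / N%:R) `^ e.
    by rewrite -[leLHS](powRr0 (s / N%:R)) ler_powR// ler_pdivlMr// mul1r.
  by move=> h; lra.
rewrite -mulr_sumr.
have := @lattice_decay_sum R sigma 0 N.*2.+1 (- N%:Z + c) sig0 _.
rewrite mulr0 addr0 powRr1 ?(ltW (lt_le_trans _ s1))// lexx invr_ge0 ler0n => /(_ isT) h.
apply: (@le_trans _ _ (N%:R^-1 * (32 * s))).
  rewrite ler_pM2l ?invr_gt0//; apply: le_trans h.
  by apply: ler_sum => i _; rewrite powRr0 mul1r addrA.
rewrite mulrC -mulrA ler_pM2l// ger1_powR// divr_gt0//=.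
by rewrite ler_pdivrMr// mul1r ltW.
Qed.

(** The coefficients are bounded uniformly, so the constant weight works and the sum over the box is
    a product of averages, one for each coordinate. *)
Lemma torus_fejer_poly N (H rho lambda e : R) z : (0 < N)%N -> 0 < lambda ->
  rho = lambda `^ (- H) -> 0 <= e <= 1 ->
  torus_poly H rho lambda (H * (d%:R * e)) (32 ^+ d * N%:R `^ (- (d%:R * e)))
    (fun y => torus_fejer N z y / N%:R ^+ d).
Proof.
move=> N0 l0 rhoE e01; have /andP[e0 e1] := e01.
have N0' : (0 : R) < N%:R by rewrite ltr0n.
have rho0 : 0 < rho by rewrite rhoE powR_gt0.
exists {ffun 'I_d -> 'I_(N.*2.+1)}, (@freq_box d N),
  (fun m => (N%:R ^+ d)^-1%:C%C * torus_fejer_coef N z m), (fun=> 1); split=> //.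
  move=> y; rewrite rmorphM/= (torus_fejer_trig _ _ N0 (leqnn N)) mulrC mulr_sumr.
  by apply: eq_bigr => m _; rewrite mulrA.
move=> tau xi t0; set sigma := tau `^ H / rho.
have sig0 : 0 < sigma by rewrite divr_gt0// powR_gt0.
apply: (@le_trans _ _ (\sum_(m : {ffun 'I_d -> 'I_(N.*2.+1)}) \prod_(l < d)
    (N%:R^-1 * freq_decay (((m l)%:Z - N%:Z + xi l)%:~R * sigma)))).
  apply: ler_sum => m _; rewrite mulr1 big_split/= prodr_const card_ord exprVn.
  rewrite ler_wpM2r ?decay_weight_ge0//.
  rewrite Normc.normcM normc_real ger0_norm ?invr_ge0 ?exprn_ge0 ?(ltW N0')//.
  by rewrite ler_piMr ?invr_ge0 ?exprn_ge0 ?(ltW N0')// normc_torus_fejer_coef.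
rewrite -(bigA_distr_bigA (fun l (i : 'I_(N.*2.+1)) =>
  N%:R^-1 * freq_decay ((i%:Z - N%:Z + xi l)%:~R * sigma))).
set s := Num.max 1 sigma^-1.
apply: (@le_trans _ _ (\prod_(l < d) (32 * (s `^ e * N%:R `^ (- e))))).
  apply: ler_prod => l _; rewrite fejer_decay_avg// andbT sumr_ge0// => i _.
  by rewrite mulr_ge0 ?invr_ge0 ?(ltW N0')// freq_decay_ge0.
rewrite prodr_const card_ord !exprMn mulr1.
rewrite -[_ `^ e ^+ d]powR_mulrn ?powR_ge0// -[_ `^ (- e) ^+ d]powR_mulrn ?powR_ge0//.
rewrite -!powRrM mulNr (mulrC e) -[leRHS]mulrA ler_pM2l ?exprn_gt0//.
rewrite [leLHS]mulrC ler_pM2l ?powR_gt0//.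
by apply: scale_powR_le => //; rewrite mulr_ge0.
Qed.

End torus_profiles.

(** * Differences of consecutive Fejer kernels *)

Section torus_difference.
Context {R : realType} {d : nat}.
Local Notation normc := Normc.normc.
Implicit Types (N M : nat) (y z : 'I_d -> R).

Lemma fejer_coefB_le N (k : int) : (0 < N)%N ->
  `|fejer_coef N.*2 k - fejer_coef N k| <= `|k%:~R| / N%:R :> R.
Proof.
move=> N0; have N0' : (0 : R) < N%:R by rewrite ltr0n.
rewrite /fejer_coef -muln2 natrM invfM mulrA.
set x := `|k%:~R| / N%:R; have x0 : 0 <= x by rewrite divr_ge0.
by rewrite /Num.max; case: ifPn => ?; case: ifPn => ?; rewrite ler_norml; lra.
Qed.

Lemma normc_fejer_factorB N (k : int) (x x' : R) : (0 < N)%N -> `|x' - x| <= N%:R^-1 ->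
  normc ((fejer_coef N.*2 k)%:C%C * expi (- k%:~R * x') -
         (fejer_coef N k)%:C%C * expi (- k%:~R * x)) <= 3 * (`|k%:~R| / N%:R).
Proof.
move=> N0 xx; have N0' : (0 : R) < N%:R by rewrite ltr0n.
set c' := fejer_coef _ _; set c := fejer_coef _ _; set e' := expi _; set e := expi _.
have -> : c'%:C%C * e' - c%:C%C * e = (c' - c)%:C%C * e' + c%:C%C * (e' - e).
  by rewrite rmorphB/=; ring.
apply: le_trans (le_normcD _ _) _; rewrite !Normc.normcM normc_expi mulr1 !normc_real.
have h1 := fejer_coefB_le k N0.
have h2 : normc (e' - e) <= 2 * (`|k%:~R| / N%:R).
  apply: le_trans (normc_expiB _ _) _; rewrite ler_pM2l//.
  by rewrite -mulrBr normrM normrN ler_wpM2l.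
have /andP[c0 c1] := @fejer_coef_itv R N k.
have h3 : `|c| * normc (e' - e) <= normc (e' - e).
  by rewrite ler_piMl ?normc_ge0// ger0_norm.
rewrite -/c' -/c in h1; lra.
Qed.

Lemma prod_powR (I : Type) (s : seq I) (x : I -> R) (a : R) : (forall i, 0 <= x i) ->
  \prod_(i <- s) x i `^ a = (\prod_(i <- s) x i) `^ a.
Proof.
move=> x0; elim: s => [|i s IH]; first by rewrite !big_nil powR1.
by rewrite !big_cons IH powRM// prodr_ge0.
Qed.

Definition freq_weight (gamma : R) (k : 'I_d -> int) : R :=
  \prod_(l < d) (1 + `|(k l)%:~R|) `^ gamma.

Lemma freq_weight_ge1 gamma k : 0 <= gamma -> 1 <= freq_weight gamma k.
Proof.
move=> g0; rewrite /freq_weight; elim/big_ind: _ => //.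
  by move=> x y x1 y1; rewrite -[leLHS]mulr1 ler_pM.
move=> l _; rewrite -[leLHS](powRr0 (1 + `|(k l)%:~R|)) ler_powR//.
by rewrite lerDl.
Qed.

(** Doubling the order and moving the centre by at most 1 / N changes a coordinate factor by at most
    3 |k| / N, hence the product by at most 3 d p / N with [p] the product of the 1 + |k|. The
    change is also at most 2, and both bounds interpolate to 3 d (p / N)^gamma. *)
Lemma normc_torus_fejer_coefB N z z' gamma (m : {ffun 'I_d -> 'I_(N.*2.*2.+1)}) :
  (0 < d)%N -> (0 < N)%N -> 0 <= gamma <= 1 -> (forall l, `|z' l - z l| <= N%:R^-1) ->
  normc (torus_fejer_coef N.*2 z' m - torus_fejer_coef N z m) <=
  3 * d%:R * N%:R `^ (- gamma) * freq_weight gamma (@freq_box d N.*2 m).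
Proof.
move=> d0 N0 /andP[g0 g1] zz; have N0' : (0 : R) < N%:R by rewrite ltr0n.
have d1 : (1 : R) <= d%:R by rewrite (ler_nat R 1).
pose p : R := \prod_(l < d) (1 + `|(freq_box m l)%:~R|).
have p1 : 1 <= p.
  rewrite /p; elim/big_ind: _ => // [x y x1 y1|l _]; last by rewrite lerDl.
  by rewrite -[leLHS]mulr1 ler_pM.
have lp l : `|(freq_box m l)%:~R| <= p.
  rewrite /p (bigD1 l)//=; set q := \prod_(i | _) _.
  have q1 : 1 <= q.
    rewrite /q; elim/big_ind: _ => // [x y x1 y1|j _]; last by rewrite lerDl.
    by rewrite -[leLHS]mulr1 ler_pM.
  have : 0 <= `|(freq_box m l)%:~R| :> R by []. 
  by set a := `|_|; move=> a0; nra.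
set b := normc _; have b2 : b <= 2.
  apply: le_trans (le_normcD _ _) _; rewrite normcN.
  have h1 := @normc_torus_fejer_coef R d N.*2 N.*2 z' m.
  have h2 := @normc_torus_fejer_coef R d N N.*2 z m.
  by apply: le_trans (lerD h1 h2) _; lra.
have bx : b <= 3 * d%:R * (p / N%:R).
  apply: le_trans (normc_prodB _ _ _) _.
  - by move=> l; exact: normc_torus_fejer_factor.
  - by move=> l; exact: normc_torus_fejer_factor.
  apply: (@le_trans _ _ (\sum_(l < d) 3 * (p / N%:R))).
    apply: ler_sum => l _; apply: le_trans (normc_fejer_factorB _ N0 (zz l)) _.
    by rewrite ler_pM2l// ler_pM2r ?invr_gt0.
  by rewrite sumr_const card_ord -[_ *+ d]mulr_natr mulrAC.
have -> : 3 * d%:R * N%:R `^ (- gamma) * freq_weight gamma (freq_box m) =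
    3 * d%:R * (p / N%:R) `^ gamma.
  rewrite -mulrA; congr (_ * _); rewrite powRM ?invr_ge0//; last by lra.
  rewrite -[N%:R^-1]powR_inv1// -powRrM mulN1r mulrC; congr (_ * _).
  by rewrite /p /freq_weight prod_powR// => l; rewrite addr_ge0.
set x := p / N%:R in bx *; have x0 : 0 < x by rewrite divr_gt0//; lra.
have [x1|x1] := leP x 1.
  apply: (le_trans bx); rewrite ler_pM2l; last by lra.
  by rewrite ger1_powR// x0.
apply: (le_trans b2); have : 1 <= x `^ gamma.
  by rewrite -[leLHS](powRr0 x) ler_powR// ltW.
by set y := x `^ gamma; move=> y1; nra.
Qed.

(** The coefficient grows like the weight of the unshifted frequency [fr m]. Since 1 + |fr m| <= (1
    + |fr m + xi|) (1 + |xi|) in each coordinate, it is controlled by the weight at [fr m + xi]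
    times the weight at [xi]. Together with the weight already present, this puts 2 gamma in the
    lattice sum and returns exactly one [freq_weight gamma xi]. The lattice sum is not averaged
    here, whence the time exponent H d (1 + 2 gamma). *)
Lemma torus_fejerB_poly N (H rho lambda gamma : R) z z' :
  (0 < d)%N -> (0 < N)%N -> 0 < lambda -> rho = lambda `^ (- H) ->
  0 <= gamma <= 2^-1 -> (forall l, `|z' l - z l| <= N%:R^-1) ->
  torus_poly H rho lambda (H * (d%:R * (1 + 2 * gamma)))
    (3 * d%:R * 32 ^+ d * N%:R `^ (- gamma))
    (fun y => torus_fejer N.*2 z' y - torus_fejer N z y).
Proof.
move=> d0 N0 l0 rhoE /andP[g0 g1] zz.
have N0' : (0 : R) < N%:R by rewrite ltr0n.
have rho0 : 0 < rho by rewrite rhoE powR_gt0.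
pose M := N.*2.
exists {ffun 'I_d -> 'I_(M.*2.+1)}, (@freq_box d M),
  (fun m => torus_fejer_coef N.*2 z' m - torus_fejer_coef N z m),
  (freq_weight gamma); split.
- move=> y; rewrite rmorphB/= (@torus_fejer_trig _ _ N.*2 M) ?double_gt0//.
  rewrite (@torus_fejer_trig _ _ N M)//; last by rewrite /M -addnn leq_addr.
  by rewrite -sumrB; apply: eq_bigr => m _; rewrite mulrBl.
- by move=> k; exact: freq_weight_ge1.
- by rewrite /freq_weight big1// => l _; rewrite normr0 addr0 powR1.
move=> tau xi t0; set sigma := tau `^ H / rho.
have sig0 : 0 < sigma by rewrite divr_gt0// powR_gt0.
pose B := 3 * d%:R * N%:R `^ (- gamma) * freq_weight gamma xi.
have fw0 k : 0 <= freq_weight gamma k by rewrite (le_trans _ (freq_weight_ge1 k g0)).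
have B0 : 0 <= B by rewrite !mulr_ge0 ?powR_ge0.
apply: (@le_trans _ _ (\sum_(m : {ffun 'I_d -> 'I_(M.*2.+1)}) B * \prod_(l < d)
    ((1 + `|((m l)%:Z - M%:Z + xi l)%:~R|) `^ (2 * gamma) *
      freq_decay (((m l)%:Z - M%:Z + xi l)%:~R * sigma)))).
  apply: ler_sum => m _; rewrite big_split/= [X in _ <= _ * (_ * X)]/=.
  rewrite -/(decay_weight H rho tau (fun l => freq_box m l + xi l)).
  have -> : \prod_(l < d) (1 + `|((m l)%:Z - M%:Z + xi l)%:~R|) `^ (2 * gamma) =
     freq_weight gamma (fun l => freq_box m l + xi l) * freq_weight gamma (fun l => freq_box m l + xi l) :> R.
    rewrite /freq_weight -big_split/=; apply: eq_bigr => l _.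
    have b0 : 0 < 1 + `|(freq_box m l + xi l)%:~R| :> R by rewrite ltr_pwDl.
    by rewrite -powRD ?(gt_eqF b0) ?implybT// mulr_natl mulr2n.
  set w := freq_weight gamma (fun l => _ + _); set D := decay_weight _ _ _ _.
  have w0 : 0 <= w by exact: fw0.
  have D0 : 0 <= D by exact: decay_weight_ge0.
  have h1 := normc_torus_fejer_coefB m d0 N0 _ zz; have {h1} := h1 gamma _.
  rewrite g0/= (le_trans g1) ?invf_le1// ?ler1n// => /(_ isT) h1.
  have h2 : freq_weight gamma (freq_box m) <= w * freq_weight gamma xi.
    rewrite /w /freq_weight -big_split/=; apply: ler_prod => l _; rewrite powR_ge0/=.
    rewrite -powRM ?addr_ge0// ge0_ler_powR ?nnegrE ?mulr_ge0 ?addr_ge0//.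
    have : `|(freq_box m l)%:~R| <= `|(freq_box m l + xi l)%:~R| + `|(xi l)%:~R| :> R.
      by rewrite -{1}(addrK (xi l) (freq_box m l)) intrB ler_normB.
    have : 0 <= `|(freq_box m l + xi l)%:~R| :> R by [].
    have : 0 <= `|(xi l)%:~R| :> R by [].
    by set p := `|_|; set q := `|_|; set r := `|_|; nra.
  have h3 : normc (torus_fejer_coef N.*2 z' m - torus_fejer_coef N z m) <= B * w.
    apply: (le_trans h1); rewrite /B -!mulrA ler_wpM2l// ler_wpM2l// ler_wpM2l ?powR_ge0//.
    by rewrite mulrC in h2.
  rewrite mulrAC -mulrA.
  apply: (@le_trans _ _ (B * w * (w * D))).
    by rewrite ler_wpM2r// mulr_ge0.
  by rewrite le_eqVlt; apply/orP; left; apply/eqP; ring.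
rewrite -mulr_sumr -(bigA_distr_bigA (fun l (i : 'I_(M.*2.+1)) =>
  (1 + `|(i%:Z - M%:Z + xi l)%:~R|) `^ (2 * gamma) * freq_decay ((i%:Z - M%:Z + xi l)%:~R * sigma))).
set s := Num.max 1 sigma^-1.
apply: (@le_trans _ _ (B * \prod_(l < d) (32 * s `^ (1 + 2 * gamma)))).
  rewrite ler_wpM2l//; apply: ler_prod => l _; apply/andP; split.
    by apply: sumr_ge0 => i _; rewrite mulr_ge0 ?powR_ge0 ?freq_decay_ge0.
  have := @lattice_decay_sum R sigma gamma M.*2.+1 (- M%:Z + xi l) sig0 _.
  rewrite g0 g1 => /(_ isT); apply: le_trans; apply: ler_sum => i _.
  by rewrite addrA.
rewrite prodr_const card_ord exprMn -[_ `^ _ ^+ d]powR_mulrn ?powR_ge0// -powRrM.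
have h := @scale_powR_le R H rho lambda tau (d%:R * (1 + 2 * gamma)) l0 rhoE t0 _.
rewrite (mulrC _ d%:R) /B; apply: (@le_trans _ _ (3 * d%:R * N%:R `^ (- gamma) * freq_weight gamma xi *
  (32 ^+ d * (1 + (lambda * tau) `^ (- (H * (d%:R * (1 + 2 * gamma)))))))).
  rewrite ler_wpM2l// ler_pM2l ?exprn_gt0// h// mulr_ge0//; lra.
by rewrite le_eqVlt; apply/orP; left; apply/eqP; ring.
Qed.

End torus_difference.

(** * Exponential tail bounds *)

Section tail_bounds.
Context {R : realType} {dO : measure_display} {Omega : measurableType dO}.
Variable P : probability Omega R.

Lemma measurable_superlevel (f : Omega -> R) (x : R) : measurable_fun setT f ->
  measurable [set w | x < f w].
Proof.
move=> mf; rewrite (_ : [set w | x < f w] = setT `&` f @^-1` `]x, +oo[).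
  by apply: mf => //; exact: measurable_itv.
by rewrite setTI; apply/seteqP; split => w /=; rewrite in_itv/= andbT.
Qed.

Lemma markov_pow (Z : Omega -> R) (n : nat) (x : R) : bounded_measurable Z ->
  ~~ odd n -> 0 < x ->
  (P [set w | (x < `|Z w|)%R] <= ((\int[P]_w (Z w ^+ n)) / x ^+ n)%:E)%E.
Proof.
move=> bZ evn x0; have xn0 : 0 < x ^+ n by rewrite exprn_gt0.
pose A := [set w | x < `|Z w|].
have mA : measurable A by apply: measurable_superlevel; have [] := bmf_norm bZ.
have bZn : bounded_measurable (fun w => Z w ^+ n) by exact: bmfX.
have Zn0 w : 0 <= Z w ^+ n by rewrite exprn_even_ge0.
have -> : ((\int[P]_w (Z w ^+ n)) / x ^+ n)%:E = (\int[P]_w ((x ^+ n)^-1 * Z w ^+ n)%:E)%E.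
  rewrite mulrC -RintegralZl//; last exact: bmf_integrable.
  rewrite /Rintegral fineK//; apply: integrable_fin_num => //.
  by apply: bmf_integrable => //; apply: bmfM => //; exact: bmf_cst.
rewrite -/A -[X in (P X <= _)%E](setIT A) -integral_indic//.
apply: ge0_le_integral => //.
- exact/measurable_EFinP/measurable_indic.
- by apply/measurable_EFinP; apply: measurable_funM => //; have [] := bZn.
move=> w _; rewrite lee_fin indicE; have [/[!inE]/= Aw|_] := boolP (w \in A); last first.
  by rewrite mulr_ge0// invr_ge0 ltW.
rewrite mulrC ler_pdivlMr// mul1r -[leRHS]ger0_norm// normrX.
by rewrite lerXn2r ?nnegrE// ltW.
Qed.

Lemma measure_bigsetU_le (I : Type) (s : seq I) (E : I -> set Omega) (e : R) :
  (forall i, measurable (E i)) -> (forall i, (P (E i) <= e%:E)%E) ->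
  (P (\big[setU/set0]_(i <- s) E i) <= ((size s)%:R * e)%:E)%E.
Proof.
move=> mE Ee; elim: s => [|i s IH]; first by rewrite big_nil measure0 mul0r.
rewrite big_cons; apply: le_trans (measureU2 _ _ _) _ => //.
  by apply: bigsetU_measurable => j _.
by rewrite /= -natr1 mulrDl mul1r EFinD addrC; apply: leeD.
Qed.

Context {d : nat}.
Variables (T H c0 theta : R) (X : R -> Omega -> 'rV[R]_d).
Hypothesis X_meas : jointly_measurable T X.
Hypothesis X_char : charfun_increments_bound P T X H c0 theta.
Hypothesis c0_ge0 : 0 <= c0.

Lemma bmf_torus_poly (rho lambda a K : R) g :
  torus_poly H rho lambda a K g ->
  bounded_measurable (fun p => g (torus_process T X rho p)).
Proof.
move=> [I [fr [b [W [gE _ _ _]]]]].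
by apply: (bmf_trig_torus X_meas gE); exact: measurable_id.
Qed.

Definition torus_functional (s t rho : R) (g : ('I_d -> R) -> R) (w : Omega) : R :=
  \int[interval_measure s t]_v g (torus_process T X rho (v, w)).

Lemma bmf_torus_functional (rho lambda a K s t : R) g :
  torus_poly H rho lambda a K g -> bounded_measurable (torus_functional s t rho g).
Proof. by move=> gp; exact: (bmf_Rintegral1 (bmf_torus_poly gp)). Qed.

Lemma torus_moment (a K s t h : R) (n : nat) (rho : R) g :
  (0 < n)%N -> 0 < h -> 0 < rho -> 0 < a < 1 -> 0 <= K -> 0 <= s -> t <= T -> t - s <= h ->
  torus_poly H rho (n%:R / h) a K g ->
  `|\int[P]_w (torus_functional s t rho g w ^+ n)| <=
  (c0 * n%:R `^ (H * theta) * (expR 1 * power_kernel_cst a * K * h)) ^+ n.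
Proof.
move=> n0 h0 rho0 a01 K0 s0 tT tsh gp; have [I [fr [b [W [gE W1 W0 bW]]]]] := gp.
have n0' : (0 : R) < n%:R by rewrite ltr0n.
have l0 : 0 < n%:R / h by rewrite divr_gt0.
have -> : (c0 * n%:R `^ (H * theta) * (expR 1 * power_kernel_cst a * K * h)) ^+ n =
   (c0 ^+ n * n%:R `^ (H * theta * n%:R)) * (expR 1 * power_kernel_cst a * K * h) ^+ n.
  by rewrite (powRrM _ (H * theta)) powR_mulrn ?powR_ge0// !exprMn.
apply: (interval_moment_bound (g := fun p => g (torus_process T X rho p))) => //.
- by rewrite mulr_ge0 ?exprn_ge0 ?powR_ge0.
- exact: (bmf_torus_poly gp).
move=> u u0 uS ut.
pose A tau := K * (1 + (n%:R / h * tau) `^ (- a)).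
have A0 tau : 0 <= A tau by rewrite mulr_ge0// addr_ge0// powR_ge0.
(* The characteristic function needs a partition starting at 0, the times start at [s]. Moving the
   first point to 0 lengthens the first increment, and the bound [A] decreases in [tau]. *)
pose u' i := if i == 0%N then 0 else u i.
have := trig_product_bound X_meas X_char c0_ge0 gE rho0 W1 A0 bW (u := u') n0 erefl.
have u'S j : (j < n)%N -> u' j < u' j.+1.
  case: j => [|j] jn; rewrite /u' /=; last exact: uS.
  by rewrite (le_lt_trans s0)// -u0 uS.
have u'T : u' n < T by rewrite /u' gtn_eqF// (lt_le_trans ut).
move=> /(_ u'S u'T) h1; rewrite W0 mulr1 in h1; apply: (le_trans h1).
rewrite ler_wpM2l ?mulr_ge0 ?exprn_ge0 ?powR_ge0//.
apply: ler_prod => i _; rewrite A0/=.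
case: i => -[|i] ilt; rewrite /u' /=; last by [].
have u1s : s < u 1%N by rewrite -u0 uS.
have u10 : 0 < u 1%N by rewrite (le_lt_trans s0).
have us10 : 0 < u 1%N - s by rewrite subr_gt0.
have [a0 _] := andP a01.
rewrite ler_wpM2l// lerD2l subr0 u0 !powRN lef_pV2 ?posrE ?powR_gt0 ?(mulr_gt0 l0)//.
have l0' : 0 <= n%:R / h by exact: ltW.
rewrite ge0_ler_powR ?nnegrE ?(ltW a0) ?(mulr_ge0 l0') ?(ltW u10) ?(ltW us10)//.
by rewrite ler_pM2l// gerBl.
Qed.

(** The factors e^2, 2 and 16^d on top of the moment bound are the budget of the union bound: they
    yield e^(- 2 n), the sum of the geometric series over [q], and the 16^d in the number of grid
    points. *)
Definition torus_cst (a K0 : R) : R :=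
  c0 * expR 1 * power_kernel_cst a * K0 * expR 2 * 2 * 16 ^+ d.

(** Asking only for the rate eta' gives each event the factor 2^(- q n (eta - eta')), at most 2^(- q
    (d + 1)): of this, 2^(- q d) pays for the grid and 2^(- q) makes the sum over [q] converge. *)
Lemma torus_bad_event (a K0 eta eta' s t h : R) (n : nat) (rho : R)
    (g : forall q : nat, {ffun 'I_d -> 'I_(2 ^ q * 16)} -> ('I_d -> R) -> R) :
  (0 < n)%N -> ~~ odd n -> 0 < c0 -> 0 < h -> 0 < rho -> 0 < a < 1 -> 0 < K0 ->
  0 <= s -> t <= T -> t - s <= h ->
  (d.+1)%:R <= n%:R * (eta - eta') ->
  (forall q y, torus_poly H rho (n%:R / h) a (K0 * (2 ^ q)%:R `^ (- eta)) (g q y)) ->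
  exists B : set Omega, [/\ measurable B, (P B <= (expR (- (2 * n%:R)))%:E)%E &
    forall w, ~ B w -> forall q y,
      `|torus_functional s t rho (g q y) w| <=
      torus_cst a K0 * (2 ^ q)%:R `^ (- eta') * n%:R `^ (H * theta) * h].
Proof.
move=> n0 evn c0' h0 rho0 a01 K00 s0 tT tsh neta gp.
have n0' : (0 : R) < n%:R by rewrite ltr0n.
pose x q := torus_cst a K0 * (2 ^ q)%:R `^ (- eta') * n%:R `^ (H * theta) * h.
have cst0 := power_kernel_cst_gt0 a01.
have q0 q : (0 : R) < (2 ^ q)%:R by rewrite ltr0n expn_gt0.
have x0 q : 0 < x q.
  by rewrite /x /torus_cst !mulr_gt0 ?powR_gt0 ?expR_gt0 ?exprn_gt0.
pose E q y := [set w | x q < `|torus_functional s t rho (g q y) w|].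
have mE q y : measurable (E q y).
  apply: measurable_superlevel.
  by have [] := bmf_norm (bmf_torus_functional s t (gp q y)).
pose Bq q := \big[setU/set0]_(y : {ffun 'I_d -> 'I_(2 ^ q * 16)}) E q y.
have mBq q : measurable (Bq q) by apply: bigsetU_measurable => y _; exact: mE.
exists (\bigcup_q Bq q); split.
- exact: bigcup_measurable.
- apply: (le_trans (measure_sigma_subadditive _ mBq _ (subset_refl _))) => //.
    exact: bigcup_measurable.
  have PE q y : (P (E q y) <= ((expR 2 * 2 * 16 ^+ d)^-1 ^+ n * (2 ^ q)%:R `^ (- (d.+1)%:R))%:E)%E.
    apply: le_trans (markov_pow (bmf_torus_functional s t (gp q y)) evn (x0 q)) _.
    rewrite lee_fin ler_pdivrMr ?exprn_gt0//.
    apply: le_trans (ler_norm _) _; apply: le_trans (torus_moment n0 h0 rho0 a01 _ s0 tT tsh (gp q y)) _.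
      by rewrite mulr_ge0 ?powR_ge0// ltW.
    set c := c0 * _ * _.
    have -> : c = (expR 2 * 2 * 16 ^+ d)^-1 * (2 ^ q)%:R `^ (- (eta - eta')) * x q.
      rewrite /c /x /torus_cst opprB powRD; last by rewrite (gt_eqF (q0 q)) implybT.
      have := q0 q => /(powR_gt0 (- eta')); rewrite powRN => ?.
      rewrite powRN; field.
      by rewrite !gt_eqF ?exprn_gt0 ?expR_gt0// -invr_gt0.
    rewrite exprMn ler_wpM2r ?exprn_ge0 ?(ltW (x0 q))//.
    rewrite exprMn -[_ `^ _ ^+ n]powR_mulrn ?powR_ge0// -powRrM.
    rewrite ler_wpM2l ?exprn_ge0 ?invr_ge0 ?mulr_ge0 ?expR_ge0 ?exprn_ge0//.
    rewrite ler_powR ?(ler_nat R 1) ?expn_gt0// mulNr lerN2 mulrC.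
    exact: neta.
  set kappa := (expR 2 * 2 * 16 ^+ d)^-1 in PE.
  have kappa0 : 0 <= kappa by rewrite invr_ge0 !mulr_ge0 ?expR_ge0 ?exprn_ge0.
  apply: (@le_trans _ _ (\sum_(q <oo) (16 ^+ d * kappa ^+ n * 2^-1 ^+ q)%:E)%E).
    apply: lee_nneseries => // q _; apply: le_trans (measure_bigsetU_le _ (mE q) (PE q)) _.
    rewrite lee_fin -sum1_size sum1_card card_ffun !card_ord natrX natrM exprMn.
    rewrite [X in _ * X]mulrC mulrA le_eqVlt; apply/orP; left; apply/eqP.
    rewrite [LHS](_ : _ = 16 ^+ d * kappa ^+ n * ((2 ^ q)%:R ^+ d * (2 ^ q)%:R `^ (- d.+1%:R))); last by ring.
    congr (_ * _); rewrite powRN powR_mulrn ?(ltW (q0 q))// exprS invfM mulrCA divff ?mulr1.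
      by rewrite natrX exprVn.
    by rewrite expf_neq0 ?gt_eqF.
  rewrite nneseries_geometric ?mulr_ge0 ?exprn_ge0 ?invr_ge0 ?invf_lt1 ?(ltr_nat R 1)//.
  have -> : 1 - 2^-1 = 2^-1 :> R by lra.
  (* One of the [n] factors [kappa] absorbs 2 * 16^d; each of the others is at most e^(-2). *)
  rewrite invrK lee_fin /kappa -[(n)]prednK// exprS.
  rewrite -[n.-1.+1]/(n.-1.+1).
  have -> : expR (- (2 * n.-1.+1%:R)) = (expR 2)^-1 * (expR 2)^-1 ^+ n.-1 :> R.
    by rewrite -exprS -expRN -expRM_natr mulNr.
  rewrite [leLHS](_ : _ = (expR 2)^-1 * (expR 2 * 2 * 16 ^+ d)^-1 ^+ n.-1); last first.
    by field; rewrite !gt_eqF ?exprn_gt0 ?expR_gt0.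
  rewrite ler_wpM2l ?invr_ge0 ?expR_ge0// lerXn2r ?nnegrE ?invr_ge0 ?mulr_ge0 ?exprn_ge0 ?expR_ge0//.
  rewrite lef_pV2 ?posrE ?mulr_gt0 ?exprn_gt0 ?expR_gt0// -mulrA ler_peMr ?expR_ge0//.
  by rewrite -natrX -natrM (ler_nat R 1) muln_gt0/= expn_gt0.
- move=> w Bw q y; rewrite leNgt; apply/negP => h1; apply: Bw; exists q => //.
  by rewrite /Bq -bigcup_seq; exists y => //=; rewrite mem_index_enum.
Qed.

End tail_bounds.

(** * Riesz potentials of the occupation measure *)

Section torus_geometry.
Context {R : realType}.

Lemma pi2_lt8 : pi *+ 2 < 8 :> R.
Proof. by rewrite -[_ *+ 2]mulr_natl; have := @pihalf_lt2 R; lra. Qed.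

Lemma pi2_gt0 : 0 < pi *+ 2 :> R.
Proof. by rewrite pmulrn_lgt0// pi_gt0. Qed.

Lemma torus_reduce (z : R) : exists m : int, 0 <= z - m%:~R * (pi *+ 2) < 8.
Proof.
exists (Num.floor (z / (pi *+ 2))); have p0 := pi2_gt0; have p8 := pi2_lt8.
have := ge_floor (z / (pi *+ 2)); have := lt_succ_floor (z / (pi *+ 2)).
rewrite ltr_pdivrMr// ler_pdivlMr// intrD mulrDl mul1r => h1 h2.
by apply/andP; split; lra.
Qed.

Lemma grid_point (z : R) (q : nat) : 0 <= z < 8 ->
  (Num.truncn ((2 ^ q)%:R * z) < 2 ^ q * 8)%N /\
  (Num.truncn ((2 ^ q)%:R * z))%:R / (2 ^ q)%:R <= z <
    ((Num.truncn ((2 ^ q)%:R * z))%:R + 1) / (2 ^ q)%:R.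
Proof.
move=> /andP[z0 z8]; have q0 : (0 : R) < (2 ^ q)%:R by rewrite ltr0n expn_gt0.
have /andP[h1 h2] : (Num.truncn ((2 ^ q)%:R * z))%:R <= (2 ^ q)%:R * z <
    (Num.truncn ((2 ^ q)%:R * z)).+1%:R.
  by apply: truncn_itv; rewrite mulr_ge0// ltW.
split.
  rewrite -(ltr_nat R); apply: (le_lt_trans h1).
  by rewrite natrM ltr_pM2l.
by rewrite ler_pdivrMr// ltr_pdivlMr// ![z * _]mulrC h1/= natr1.
Qed.

(** The dyadic grids are nested: halving the index gives the coarser grid point below the same [z].
    Telescoping over levels rests on this. *)
Lemma trunc_double_half (z : R) (q : nat) : 0 <= z ->
  (Num.truncn ((2 ^ q.+1)%:R * z))./2 = Num.truncn ((2 ^ q)%:R * z).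
Proof.
move=> z0; set k := Num.truncn ((2 ^ q.+1)%:R * z).
have /andP[h1 h2] : k%:R <= (2 ^ q.+1)%:R * z < k.+1%:R.
  by apply: truncn_itv; rewrite mulr_ge0.
apply/esym; apply: truncn_def.
have E : (2 ^ q.+1)%:R * z = 2 * ((2 ^ q)%:R * z) by rewrite expnS natrM mulrA.
rewrite E in h1 h2; set x := (2 ^ q)%:R * z in h1 h2 *.
have := odd_double_half k; rewrite -muln2 => kE.
have kR : k%:R = (odd k)%:R + (k./2)%:R * 2 :> R by rewrite -natrM -natrD kE.
have := @natr1 R k; have := @natr1 R k./2.
move=> h3 h4; apply/andP.
by case: (odd k) kR => /= kR; split; lra.
Qed.

Lemma torus_fejer_ge0 (d N : nat) (z y : 'I_d -> R) : (0 < N)%N -> 0 <= torus_fejer N z y.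
Proof. by move=> N0; apply: prodr_ge0 => l _; exact: fejer_ge0. Qed.

Lemma torus_fejer_ge (d N : nat) (z y : 'I_d -> R) : (0 < N)%N ->
  (forall l, exists m : int, `|y l - z l - m%:~R * (pi *+ 2)| <= N%:R^-1) ->
  (N%:R * cos 1 ^+ 2) ^+ d <= torus_fejer N z y.
Proof.
move=> N0 h; rewrite -[X in _ ^+ X](card_ord d) -prodr_const; apply: ler_prod => l _.
apply/andP; split.
  by rewrite mulr_ge0// sqr_ge0.
have [m hm] := h l; rewrite -(fejerD_int2pi _ _ (- m)) rmorphN mulNr.
exact: fejer_ge.
Qed.

End torus_geometry.

Section riesz_bound.
Context {R : realType} {d : nat}.
Implicit Types x y : 'rV[R]_d.

Lemma measurable_dotrv : measurable_fun [set: 'rV[R]_d] (fun x => dotrv x x).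
Proof.
by apply: measurable_sum => l; apply: measurable_funM; exact: measurable_coord.
Qed.

Lemma coord_le_enorm x l : `|x ord0 l| <= enorm x.
Proof.
rewrite -sqrtr_sqr ler_wsqrtr// /dotrv (bigD1 l)//= expr2 lerDl.
by apply: sumr_ge0 => j _; rewrite -expr2 sqr_ge0.
Qed.

Lemma enorm_gt0 x : x != 0 -> 0 < enorm x.
Proof.
move=> x0; rewrite lt_neqAle sqrtr_ge0 andbT eq_sym; apply: contra x0 => /eqP h.
apply/eqP/rowP => l; rewrite mxE; apply/eqP; rewrite -normr_eq0.
by rewrite eq_le normr_ge0 andbT -h coord_le_enorm.
Qed.

Lemma enorm0 : enorm (0 : 'rV[R]_d) = 0.
Proof. by rewrite /enorm /dotrv big1 ?sqrtr0// => l _; rewrite mxE mulr0. Qed.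

Lemma measurable_rVB x : measurable_fun [set: 'rV[R]_d] (fun y => x - y).
Proof.
apply: measurable_fun_rV => i; under eq_fun do rewrite !mxE.
by apply: measurable_funB => //; exact: measurable_coord.
Qed.

Lemma measurable_enorm : measurable_fun [set: 'rV[R]_d] (@enorm R d).
Proof.
apply: (measurableT_comp _ measurable_dotrv).
apply: continuous_measurable_fun; exact: sqrt_continuous.
Qed.

Lemma measurable_riesz_kernel (alpha : R) x :
  measurable_fun [set: 'rV[R]_d] (fun y => riesz_kernel alpha (x - y)).
Proof.
rewrite (_ : (fun y => _) = (fun y => riesz_kernel alpha y) \o (fun y => x - y))//.
apply: measurableT_comp (measurable_rVB x).
rewrite (_ : (fun y => _) = (fun y : 'rV[R]_d => if (enorm y == 0) then +oo%E
   else (enorm y `^ (alpha - d%:R))%:E)); last first.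
  apply/funext => y; rewrite /riesz_kernel; have [->|y0] := eqVneq y 0.
    by rewrite enorm0 eqxx.
  by rewrite gt_eqF// enorm_gt0.
apply: measurable_fun_ifT.
- by apply: measurable_fun_eqr => //; exact: measurable_enorm.
- exact: measurable_cst.
- apply/measurable_EFinP; apply: (measurableT_comp (measurable_powR _)).
  exact: measurable_enorm.
Qed.

Lemma riesz_kernel_ge0 (alpha : R) x : (0 <= riesz_kernel alpha x)%E.
Proof. by rewrite /riesz_kernel; case: ifP => // _; rewrite lee_fin powR_ge0. Qed.

Lemma riesz_kernel_dyadic (alpha r : R) x : alpha < d%:R -> 0 < r ->
  (riesz_kernel alpha x <= (r `^ (alpha - d%:R))%:E *
    (1 + \sum_(q <oo) ((2 `^ (d%:R - alpha)) ^+ q.+1 *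
      (enorm x <= r * 2^-1 ^+ q)%R%:R)%:E))%E.
Proof.
move=> ad r0; have b0 : 0 < d%:R - alpha by rewrite subr_gt0.
have rp : 0 < r `^ (alpha - d%:R) by exact: powR_gt0.
have t0 q : (0 <= ((2 `^ (d%:R - alpha)) ^+ q.+1 * (enorm x <= r * 2^-1 ^+ q)%R%:R)%:E)%E.
  by rewrite lee_fin mulr_ge0// exprn_ge0// powR_ge0.
rewrite /riesz_kernel; case: ifPn => [/eqP ->|x0].
  (* At the origin every indicator is 1 and every coefficient at least 1, so the series is infinite
     like the kernel. *)
  rewrite [X in (1 + X)%E](_ : _ = +oo%E).
    by rewrite addey// gt0_muley// lte_fin.
  apply/eqyP => A A0; have t00 q := t0 q.
  apply: (@le_trans _ _ (\sum_(0 <= q < (Num.truncn A).+1) ((2 `^ (d%:R - alpha)) ^+ q.+1 *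
      (enorm (0 : 'rV[R]_d) <= r * 2^-1 ^+ q)%R%:R)%:E)%E); last first.
    by apply: nneseries_lim_ge => q _ _; rewrite lee_fin mulr_ge0// exprn_ge0// powR_ge0.
  rewrite sumEFin lee_fin big_mkord; apply: (@le_trans _ _ (\sum_(q < (Num.truncn A).+1) 1)).
    rewrite sumr_const card_ord ltW//; by have /andP[] := truncn_itv (ltW A0).
  apply: ler_sum => q _; rewrite enorm0 mulr_ge0 ?(ltW r0) ?exprn_ge0 ?invr_ge0// mulr1.
  by rewrite exprn_ege1// -[leLHS](powRr0 2) ler_powR ?(ler_nat R 1)// ltW.
have e0 := enorm_gt0 x0; set e := enorm x in t0 e0 *.
have er0 : 0 < e / r by rewrite divr_gt0.
have -> : e `^ (alpha - d%:R) = r `^ (alpha - d%:R) * (e / r) `^ (- (d%:R - alpha)).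
  rewrite opprB -powRM ?(ltW r0) ?(ltW er0)//.
  by rewrite mulrCA divff ?mulr1 ?gt_eqF.
rewrite EFinM lee_pmul2l ?lte_fin//.
apply: (le_trans (dyadic_powRN b0 er0)).
rewrite leeD2l//; apply: lee_nneseries => // q _.
by rewrite ler_pdivrMr// (mulrC r).
Qed.

End riesz_bound.

Section occupation.
Context {R : realType} {dO : measure_display} {Omega : measurableType dO}.
Context {d : nat}.
Variables (T : R) (X : R -> Omega -> 'rV[R]_d).
Hypothesis X_meas : jointly_measurable T X.
Variable w : Omega.

(* Frozen outside [[0, T]], like [coord_process]. *)
Definition frozen_path (u : measurableTypeR R) : 'rV[R]_d :=
  \row_l coord_process T X l (u, w).

Lemma measurable_frozen_path : measurable_fun setT frozen_path.
Proof.
apply: measurable_fun_rV => l; under eq_fun do rewrite mxE.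
apply: (measurableT_comp (measurable_coord_process X_meas l)).
exact: pair2_measurable.
Qed.

Lemma frozen_pathE u : 0 <= u <= T -> frozen_path u = X u w.
Proof. by move=> uT; apply/rowP => l; rewrite mxE coord_processE. Qed.

Lemma occupation_measureE s t A : 0 <= s -> t <= T ->
  occupation_measure (X ^~ w) s t A = interval_measure s t (frozen_path @^-1` A).
Proof.
move=> s0 tT; rewrite interval_measureE /occupation_measure setIC; congr lebesgue_measure.
apply/seteqP; split => u /= [h1 h2]; split => //; move: h1 h2; rewrite /= in_itv/= => h1 h2.
- rewrite frozen_pathE//; case/andP: h2 => h2 h3.
  by rewrite (le_trans s0)//= (le_trans h3).
- move: h1; rewrite frozen_pathE//; case/andP: h2 => h2 h3.
  by rewrite (le_trans s0)//= (le_trans h3).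
Qed.

Lemma interval_measure_subset (s s' t t' : R) A : measurable A -> s <= s' -> t' <= t ->
  (interval_measure s' t' A <= interval_measure s t A)%E.
Proof.
move=> mA ss tt; rewrite !interval_measureE le_measure ?inE//; try exact: measurableI.
by apply: setIS; apply: subset_itv; rewrite bnd_simp.
Qed.

Variables (s t rho : R).
Hypotheses (s_ge0 : 0 <= s) (st : s <= t) (tT : t <= T) (rho_gt0 : 0 < rho).
Hypothesis d_gt0 : (0 < d)%N.

(** The peak height is divided out, so this dominates a constant times the indicator of a small cube
    around the grid point. The [2 ^ q * 16] points at spacing 2^(-q-1) fill [0, 8[, which contains a
    period since 2 pi < 8. *)
Definition averaged_fejer (q : nat) (j : {ffun 'I_d -> 'I_(2 ^ q * 16)}) (y : 'I_d -> R) : R :=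
  torus_fejer (2 ^ q) (fun l => (j l)%:R / (2 ^ q.+1)%:R) y / (2 ^ q)%:R ^+ d.

Variables (B0 eta : R).
Hypothesis B0_ge0 : 0 <= B0.
Hypothesis functional_le : forall q j,
  torus_functional T X s t rho (@averaged_fejer q j) w <= B0 * (2 ^ q)%:R `^ (- eta).
Hypothesis bmf_averaged : forall q j, bounded_measurable
  (fun p : measurableTypeR R * Omega => @averaged_fejer q j (torus_process T X rho p)).

Definition cos1_cst : R := (cos 1 ^+ 2) ^+ d.

Lemma cos1_cst_gt0 : 0 < cos1_cst.
Proof. by rewrite /cos1_cst !exprn_gt0 ?cos1_gt0. Qed.

Lemma measurable_frozen_enorm (x : 'rV[R]_d) :
  measurable_fun setT (fun u => enorm (x - frozen_path u)).
Proof.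
apply: (measurableT_comp measurable_enorm).
exact: (measurableT_comp (measurable_rVB x) measurable_frozen_path).
Qed.

Lemma measurable_frozen_ball (x : 'rV[R]_d) (r : R) :
  measurable [set u | (enorm (x - frozen_path u) <= r)%R].
Proof.
have := measurable_frozen_enorm x measurableT (measurable_itv `]-oo, r]).
by rewrite setTI; congr measurable.
Qed.

(** While the path is in the ball, its rescaled coordinates are within 2^(-q-1) of the rescaled
    centre, thanks to the 1/2 in the radius; the grid point is within 2^(-q-1) of that centre modulo
    2 pi. Both fall within 2^(-q) of each other, where the kernel of order 2^q keeps a fixed
    fraction of its maximum. *)
Lemma occupation_ball_le (x : 'rV[R]_d) q :
  (interval_measure s t [set u | (enorm (x - frozen_path u) <= rho / 2 * 2^-1 ^+ q)%R] <=
   (cos1_cst^-1 * B0 * (2 ^ q)%:R `^ (- eta))%:E)%E.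
Proof.
set A := [set u | _].
have mA : measurable A by exact: measurable_frozen_ball.
have q0 : (0 : R) < (2 ^ q)%:R by rewrite ltr0n expn_gt0.
pose z l := (x ord0 l - coord_process T X l (0, w)) / rho.
have /choice[m mz] l : exists m : int, 0 <= z l - m%:~R * (pi *+ 2) < 8 by exact: torus_reduce.
have jlt l : (Num.truncn ((2 ^ q.+1)%:R * (z l - (m l)%:~R * (pi *+ 2))) < 2 ^ q * 16)%N.
  by have [+ _] := grid_point q.+1 (mz l); rewrite expnS [(2 * 2 ^ q)%N]mulnC -mulnA.
pose j : {ffun 'I_d -> 'I_(2 ^ q * 16)} := [ffun l => Ordinal (jlt l)].
pose g := fun u => @averaged_fejer q j (torus_process T X rho (u, w)).
have bg : @bounded_measurable _ (measurableTypeR R) R g.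
  exact: (bmf_pair2 (bmf_averaged j) w).
have Ag u : cos1_cst * \1_A u <= g u.
  rewrite indicE; have [/[!inE] /= Au|_] := boolP (u \in A); last first.
    by rewrite mulr0 divr_ge0 ?exprn_ge0 ?torus_fejer_ge0 ?expn_gt0.
  rewrite mulr1 /g /averaged_fejer ler_pdivlMr ?exprn_gt0// mulrC -exprMn.
  apply: torus_fejer_ge; rewrite ?expn_gt0// => l; exists (m l).
  set jl := (j l)%:R / _.
  have [_ /andP[h1 h2]] := grid_point q.+1 (mz l).
  have h3 : jl <= z l - (m l)%:~R * (pi *+ 2) <= jl + (2 ^ q.+1)%:R^-1.
    rewrite /jl ffunE /= h1/=; apply/ltW; apply: (lt_le_trans h2).
    by rewrite mulrDl mul1r.
  have h4 : `|torus_process T X rho (u, w) l - z l| <= (2 ^ q.+1)%:R^-1.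
    rewrite /torus_process /z -mulrBl opprB addrA subrK.
    rewrite normrM (ger0_norm (x := rho^-1)) ?invr_ge0 ?(ltW rho_gt0)// ler_pdivrMr//.
    have := le_trans (coord_le_enorm _ l) Au; rewrite !mxE distrC => /le_trans; apply.
    rewrite expnS natrM natrX invfM exprVn; lra.
  have E : (2 ^ q)%:R^-1 = (2 ^ q.+1)%:R^-1 + (2 ^ q.+1)%:R^-1 :> R.
    by rewrite expnS natrM invfM; lra.
  rewrite E; move: h3 h4; rewrite !ler_norml => /andP[h3 h3'] /andP[h4 h4'].
  by apply/andP; split; lra.
have bA : bounded_measurable (\1_A : measurableTypeR R -> R).
  split; first exact: measurable_indic.
  by exists 1 => u; rewrite indicE; case: (_ \in _); rewrite ?normr1 ?normr0.
have c0 := cos1_cst_gt0.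
have -> : interval_measure s t A = (\int[interval_measure s t]_u \1_A u)%:E.
  rewrite /Rintegral integral_indic// setIT fineK//.
  by rewrite fin_num_measure.
rewrite lee_fin -mulrA mulrC ler_pdivlMr// mulrC.
apply: le_trans (functional_le j); rewrite -RintegralZl//; last exact: bmf_integrable.
apply: le_Rintegral => //; last exact: bmf_integrable.
by apply: bmf_integrable => //; apply: bmfM => //; exact: bmf_cst.
Qed.

Variable alpha : R.
Hypotheses (alpha_lt : alpha < d%:R) (alpha_eta : d%:R - alpha < eta).

(** Coefficients of order 2^(q (d - alpha)) meet masses of order 2^(- q eta), and eta > d - alpha.
    Passing to a subinterval only decreases the masses. *)
Lemma riesz_potential_le (s' t' : R) (x : 'rV[R]_d) : s <= s' -> t' <= t ->
  (riesz_potential alpha (occupation_measure (X ^~ w) s' t') x <=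
   ((rho / 2) `^ (alpha - d%:R) * ((t - s) + cos1_cst^-1 * B0 *
      (2 `^ (d%:R - alpha) / (1 - 2 `^ (d%:R - alpha - eta)))))%:E)%E.
Proof.
move=> ss tt.
have -> : occupation_measure (X ^~ w) s' t' = pushforward (interval_measure s' t') frozen_path.
  by apply/funext => A; rewrite occupation_measureE// (le_trans _ ss, le_trans tt).
pose lam := interval_measure s' t'.
rewrite /riesz_potential ge0_integral_pushforward//; last 3 first.
- exact: measurable_frozen_path.
- exact: measurable_riesz_kernel.
- by move=> y _; exact: riesz_kernel_ge0.
rewrite preimage_setT.
pose c : R := 2 `^ (d%:R - alpha).
have c0 : 0 <= c by exact: powR_ge0.
pose r := rho / 2; have r0 : 0 < r by rewrite divr_gt0.
pose k : R := r `^ (alpha - d%:R); have k0 : 0 <= k by exact: powR_ge0.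
pose A q := [set u | (enorm (x - frozen_path u) <= r * 2^-1 ^+ q)%R].
have mA q : measurable (A q) by exact: measurable_frozen_ball.
pose f q u : R := c ^+ q.+1 * \1_(A q) u.
have f0 q u : (0 <= (f q u)%:E)%E by rewrite lee_fin mulr_ge0// exprn_ge0.
have mf q : measurable_fun setT (fun u => (f q u)%:E).
  by apply/measurable_EFinP; apply: measurable_funM => //; exact: measurable_indic.
have mS : measurable_fun setT (fun u => (\sum_(q <oo) (f q u)%:E)%E).
  by apply: ge0_emeasurable_sum => // q _; exact: mf.
apply: (@le_trans _ _ (\int[lam]_u (k%:E * (1 + \sum_(q <oo) (f q u)%:E)))%E).
  apply: ge0_le_integral => //.
  - by move=> u _; exact: riesz_kernel_ge0.
  - exact: (measurableT_comp (measurable_riesz_kernel alpha x) measurable_frozen_path).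
  - by apply: emeasurable_funM => //; exact: emeasurable_funD.
  move=> u _ /=; apply: (le_trans (riesz_kernel_dyadic _ alpha_lt r0)).
  rewrite lee_pmul2l ?lte_fin ?powR_gt0// leeD2l//; apply: lee_nneseries => // q _.
  rewrite lee_fin /f ler_wpM2l ?exprn_ge0// indicE.
  by case: (boolP (enorm _ <= _)) => // h; rewrite mem_set.
rewrite ge0_integralZl_EFin//; last 2 first.
- by move=> u _; rewrite adde_ge0// nneseries_ge0.
- exact: emeasurable_funD.
rewrite ge0_integralD//; last by move=> u _; exact: nneseries_ge0.
rewrite integral_cst// mul1e integral_nneseries//.
rewrite EFinM lee_pmul2l ?lte_fin ?powR_gt0// EFinD; apply: leeD.
  have E := interval_measureE s' t' setT; rewrite setTI lebesgue_measure_itv/= in E.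
  rewrite [X in (X <= _)%E]E; case: ifP => _.
    by rewrite -EFinB lee_fin; lra.
  by rewrite lee_fin subr_ge0.
pose K := cos1_cst^-1 * B0.
have K0 : 0 <= K by rewrite mulr_ge0// invr_ge0 ltW// cos1_cst_gt0.
have z0 : 0 <= 2 `^ (d%:R - alpha - eta) :> R by exact: powR_ge0.
have z1 : 2 `^ (d%:R - alpha - eta) < 1 :> R.
  by rewrite /powR pnatr_eq0/= expR_lt1 pmulr_llt0 ?subr_lt0// ln_gt0// ltr1n.
apply: (@le_trans _ _ (\sum_(q <oo) (K * c * (2 `^ (d%:R - alpha - eta)) ^+ q)%:E)%E).
  apply: lee_nneseries => [q _ _|q _].
    by apply: integral_ge0 => u _; exact: f0.
  under eq_integral do rewrite EFinM.
  rewrite ge0_integralZl_EFin ?exprn_ge0//; last exact/measurable_EFinP/measurable_indic.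
  rewrite integral_indic// setIT.
  apply: (@le_trans _ _ ((c ^+ q.+1)%:E * (K * (2 ^ q)%:R `^ (- eta))%:E)%E).
    rewrite lee_wpmul2l ?lee_fin ?exprn_ge0//.
    apply: le_trans (occupation_ball_le x q).
    exact: interval_measure_subset.
  rewrite -EFinM lee_fin exprS.
  have -> : (2 ^ q)%:R `^ (- eta) = (2 `^ (- eta)) ^+ q :> R.
    by rewrite natrX -powR_mulrn// powRAC powR_mulrn// powR_ge0.
  have -> : 2 `^ (d%:R - alpha - eta) = c * 2 `^ (- eta) :> R.
    by rewrite /c -powRD// pnatr_eq0 implybT.
  rewrite exprMn.
  by rewrite le_eqVlt; apply/orP; left; apply/eqP; ring.
rewrite nneseries_geometric// ?(mulr_ge0 K0)//.
by rewrite lee_fin -/c -/K mulrA.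
Qed.

End occupation.

(** * Local times *)

Section local_time.
Context {R : realType} {dO : measure_display} {Omega : measurableType dO}.
Context {d : nat}.
Variables (T H c0 theta : R) (X : R -> Omega -> 'rV[R]_d) (L : R -> 'rV[R]_d -> Omega -> R).
Variable P : probability Omega R.
Hypothesis X_meas : jointly_measurable T X.

(** The identity holds almost surely for each time separately; restricting it to rational times lets
    a single event of probability one carry it. *)
Definition local_time_path (w : Omega) : Prop :=
  {within `[0, T] `*` [set: 'rV[R]_d], continuous (fun p : R * 'rV[R]_d => L p.1 p.2 w)} /\
  forall (r : rat), 0 <= (ratr r : R) <= T -> forall A, measurable A ->
    occupation_measure (X ^~ w) 0 (ratr r) A = (\int[lebesgue_rV]_(x in A) (L (ratr r) x w)%:E)%E.

Lemma ae_local_time_path : continuous_local_times P T X L ->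
  {ae P, forall w, local_time_path w}.
Proof.
move=> [_ Lc Lo].
have Lr : {ae P, forall w, forall r : rat, 0 <= (ratr r : R) <= T -> forall A, measurable A ->
    occupation_measure (X ^~ w) 0 (ratr r) A = (\int[lebesgue_rV]_(x in A) (L (ratr r) x w)%:E)%E}.
  have Ln (n : nat) : {ae P, forall w, forall r : rat, unpickle n = Some r ->
      0 <= (ratr r : R) <= T -> forall A, measurable A ->
      occupation_measure (X ^~ w) 0 (ratr r) A = (\int[lebesgue_rV]_(x in A) (L (ratr r) x w)%:E)%E}.
    case: (unpickle n : option rat) => [r|]; last by apply: aeW => w r.
    have [rT|rT] := boolP (0 <= (ratr r : R) <= T).
      by apply: filterS (Lo _ rT) => w h _ [<-].
    by apply: aeW => w _ [<-]; rewrite (negbTE rT).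
  by apply: filterS (ae_foralln Ln) => w h r; apply: (h (pickle r)); exact: pickleK.
by apply: filterS2 Lc Lr => w h1 h2; split.
Qed.

Variable w : Omega.
Hypothesis Lw : local_time_path w.

Lemma local_time_continuous (t : R) (x : 'rV[R]_d) (e : R) : 0 <= t <= T -> 0 < e ->
  exists2 delta : R, 0 < delta & forall u y, 0 <= u <= T -> `|u - t| < delta ->
    ball x delta y -> `|L u y w - L t x w| < e.
Proof.
move=> tT e0; have [Lc _] := Lw.
have Dtx : (`[0, T] `*` [set: 'rV[R]_d]) (t, x) by split; rewrite //= in_itv.
have /subspace_continuousP/(_ _ Dtx) := Lc.
move=> /cvgrPdist_lt/(_ _ e0); rewrite near_withinE.
move=> /nbhs_ballP[delta /= delta0 hd]; exists delta => // u y uT ut xy.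
rewrite distrC; apply: (hd (u, y)); last by split; rewrite //= in_itv.
by split => //=; rewrite /ball /= distrC.
Qed.

Lemma continuous_rV_measurable (f : 'rV[R]_d -> R) : continuous f ->
  measurable_fun [set: 'rV[R]_d] f.
Proof.
move=> cf; apply: (measurability _ (RGenOpens.measurableE R)).
move=> _ [_ [a [b ->] <-]]; rewrite setTI; apply: open_rV_measurable.
have oU : open `]a, b[%classic by exact: interval_open.
by apply: open_comp => // x _; exact: cf.
Qed.

Lemma measurable_local_time (t : R) : 0 <= t <= T ->
  measurable_fun [set: 'rV[R]_d] (fun x => L t x w).
Proof.
move=> tT; apply: continuous_rV_measurable => x U /nbhs_ballP[e /= e0 eU].
have [delta delta0 h] := local_time_continuous x tT e0.
apply/nbhs_ballP; exists delta => //= y xy; apply: eU; rewrite /ball/= distrC.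
by apply: h => //; rewrite subrr normr0.
Qed.

Lemma box_local_time (r : rat) (a b : 'rV[R]_d) (x : 'rV[R]_d) (e : R) :
  0 <= (ratr r : R) <= T -> (forall i, a ord0 i <= b ord0 i) ->
  (forall y, box_rV a b y -> `|L (ratr r) y w - L (ratr r) x w| < e) ->
  (((L (ratr r) x w - e) * \prod_i (b ord0 i - a ord0 i))%:E <=
     occupation_measure (X ^~ w) 0 (ratr r) (box_rV a b) <=
   ((L (ratr r) x w + e) * \prod_i (b ord0 i - a ord0 i))%:E)%E.
Proof.
move=> rT ab h; have [_ Lo] := Lw; have mB := @measurable_box_rV R d a b.
rewrite (Lo r rT _ mB).
have muB := lebesgue_rV_box ab.
have finB : (@lebesgue_rV R d (box_rV a b) < +oo)%E by rewrite muB ltry.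
have iL : lebesgue_rV.-integrable (box_rV a b) (EFin \o (fun y => L (ratr r) y w)).
  apply: measurable_bounded_integrable => //.
    exact: measurable_funTS (measurable_local_time rT).
  exists (`|L (ratr r) x w| + e); split; first exact: num_real.
  move=> M Mx y By /=; apply: ltW; apply: le_lt_trans Mx.
  rewrite -[X in `|X|](subrK (L (ratr r) x w)) (le_trans (ler_normD _ _))// addrC lerD2l.
  exact: ltW (h _ By).
have iC c : lebesgue_rV.-integrable (box_rV a b) (EFin \o (fun _ : 'rV[R]_d => c)).
  apply: measurable_bounded_integrable => //.
  by exists `|c|; split; [exact: num_real|move=> M Mx y _ /=; exact: ltW].
have intC c : (\int[lebesgue_rV]_(y in box_rV a b) (EFin \o (fun _ : 'rV[R]_d => c)) y =
    (c * \prod_i (b ord0 i - a ord0 i))%:E)%E.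
  by rewrite integral_cst// [X in (_ * X)%E]muB EFinM.
apply/andP; split; rewrite -intC; apply: le_integral => // y; rewrite inE => By.
  by rewrite lee_fin; have := h y By; rewrite ltr_norml => /andP[? ?]; lra.
by rewrite lee_fin; have := h y By; rewrite ltr_norml => /andP[? ?]; lra.
Qed.

(** Continuity makes the local time nearly constant on small boxes around [x], with an error [e] at
    each of the two times. Boxes are used because they are the cells of the torus grid; [delta] must
    not depend on the box. *)
Lemma occupation_box_ge (r1 r2 : rat) (x : 'rV[R]_d) (e : R) :
  0 <= ratr r1 :> R -> ratr r1 <= ratr r2 :> R -> ratr r2 <= T -> 0 < e ->
  exists2 delta : R, 0 < delta & forall a : 'rV[R]_d, forall side : R, 0 < side -> side < delta ->
    (forall i, a ord0 i <= x ord0 i <= a ord0 i + side) ->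
    (((L (ratr r2) x w - L (ratr r1) x w - 2 * e) * side ^+ d)%:E <=
      occupation_measure (X ^~ w) (ratr r1) (ratr r2) (box_rV a (a + const_mx side)))%E.
Proof.
move=> r10 r12 r2T e0.
have r1T : 0 <= (ratr r1 : R) <= T by rewrite r10 (le_trans r12).
have r2T' : 0 <= (ratr r2 : R) <= T by rewrite r2T (le_trans r10).
have [d1 d10 h1] := local_time_continuous x r1T e0.
have [d2 d20 h2] := local_time_continuous x r2T' e0.
exists (Num.min d1 d2); first by rewrite lt_min d10.
move=> a side s0; rewrite lt_min => /andP[sd1 sd2] xa; set b := a + const_mx side.
have ab i : a ord0 i <= b ord0 i by rewrite !mxE lerDl ltW.
have pB : \prod_i (b ord0 i - a ord0 i) = side ^+ d.
  under eq_bigr do rewrite !mxE addrAC subrr add0r.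
  by rewrite prodr_const card_ord.
have near y delta : side < delta -> box_rV a b y -> ball x delta y.
  move=> sd By; split => [|i j]; first exact: lt_trans sd.
  rewrite (ord1 i); have := xa j; have := By j; rewrite !mxE => /andP[? ?] /andP[? ?].
  by rewrite /ball /= ltr_norml; apply/andP; split; lra.
have b1 y : box_rV a b y -> `|L (ratr r1) y w - L (ratr r1) x w| < e.
  by move=> By; apply: h1 => //; [rewrite subrr normr0|exact: near By].
have b2 y : box_rV a b y -> `|L (ratr r2) y w - L (ratr r2) x w| < e.
  by move=> By; apply: h2 => //; [rewrite subrr normr0|exact: near By].
have /andP[_ u1] := @box_local_time r1 a b x e r1T ab b1.
have /andP[u2 _] := @box_local_time r2 a b x e r2T' ab b2.
rewrite pB in u1 u2.
have sub : (occupation_measure (X ^~ w) 0 (ratr r2) (box_rV a b) <=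
   occupation_measure (X ^~ w) 0 (ratr r1) (box_rV a b) +
   occupation_measure (X ^~ w) (ratr r1) (ratr r2) (box_rV a b))%E.
  rewrite !(@occupation_measureE _ _ _ _ T X)//; last by case/andP: r1T.
  have mB : measurable (frozen_path T X w @^-1` box_rV a b).
    rewrite -[X in measurable X]setTI; apply: measurable_frozen_path => //.
    exact: measurable_box_rV.
  rewrite !interval_measureE; apply: le_trans (measureU2 _ _ _).
  - apply: le_measure; rewrite ?inE.
    + by apply: measurableI => //; exact: measurable_itv.
    + by apply: measurableU; apply: measurableI => //; exact: measurable_itv.
    move=> u [Bu]; rewrite /= in_itv/= => /andP[u0 u2'].
    have [ur|ru] := leP u (ratr r1); [left|right]; split => //=; rewrite in_itv/=.
      by rewrite u0.
    by rewrite (ltW ru).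
  - by apply: measurableI => //; exact: measurable_itv.
  - by apply: measurableI => //; exact: measurable_itv.
have := le_trans u2 sub; set O1 := occupation_measure _ 0 _ _; set O2 := occupation_measure _ _ _ _.
rewrite -/O1 in u1 => h3.
have : (((L (ratr r2) x w - e) * side ^+ d)%:E <=
  ((L (ratr r1) x w + e) * side ^+ d)%:E + O2)%E by apply: (le_trans h3); exact: leeD2r.
rewrite -leeBlDl// -EFinB; apply: le_trans; rewrite lee_fin.
by rewrite le_eqVlt; apply/orP; left; apply/eqP; ring.
Qed.

End local_time.

Section local_time_bound.
Context {R : realType} {dO : measure_display} {Omega : measurableType dO}.
Context {d : nat}.
Variables (T : R) (X : R -> Omega -> 'rV[R]_d) (L : R -> 'rV[R]_d -> Omega -> R).
Hypothesis X_meas : jointly_measurable T X.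
Variable w : Omega.
Hypothesis Lw : local_time_path T X L w.

(** [(j l)./2] is the parent of [j l] in the coarser grid, so these differences telescope along the
    dyadic approximations of any point. *)
Definition fejer_increment (q : nat) (j : {ffun 'I_d -> 'I_(2 ^ q * 16)}) (y : 'I_d -> R) : R :=
  torus_fejer (2 ^ q).*2 (fun l => (j l)%:R / (2 ^ q.+1)%:R) y -
  torus_fejer (2 ^ q) (fun l => (j l)./2%:R / (2 ^ q)%:R) y.

Lemma bmf_torus_fejer (rho : R) N z : (0 < N)%N ->
  bounded_measurable (fun p : measurableTypeR R * Omega =>
    torus_fejer N z (torus_process T X rho p)).
Proof.
move=> N0; have E y := @torus_fejer_trig R d N N z y N0 (leqnn N).
by apply: (bmf_trig_torus X_meas E); exact: measurable_id.
Qed.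

Variables (s t rho B0 eta : R).
Hypotheses (s_ge0 : 0 <= s) (st : s <= t) (tT : t <= T) (rho_gt0 : 0 < rho).
Hypotheses (B0_ge0 : 0 <= B0) (eta_gt0 : 0 < eta).
Hypothesis functional_le : forall q j,
  `|torus_functional T X s t rho (@fejer_increment q j) w| <= B0 * (2 ^ q)%:R `^ (- eta).

Let grid (zeta : 'I_d -> R) q (l : 'I_d) : R := (Num.truncn ((2 ^ q)%:R * zeta l))%:R / (2 ^ q)%:R.

Let decay_lt1 : 2 `^ (- eta) < 1 :> R.
Proof.
by rewrite /powR pnatr_eq0/= expR_lt1 pmulr_llt0 ?oppr_lt0// ln_gt0// ltr1n.
Qed.

Lemma fejer1 x : fejer 1 x = 1 :> R.
Proof. by rewrite /fejer big_ord1 fejer_coef_eq0// mul0r mulr0 addr0. Qed.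

(** Telescoping in the order of the kernel: at order 1 the kernel is 1 and the functional is
    [t - s]; the increments are bounded by a geometric series. *)
Lemma fejer_functional_le (zeta : 'I_d -> R) q : (forall l, 0 <= zeta l < 8) ->
  torus_functional T X s t rho (torus_fejer (2 ^ q) (grid zeta q)) w <=
  (t - s) + B0 / (1 - 2 `^ (- eta)).
Proof.
move=> zeta8; set z : R := 2 `^ (- eta); have z0 : 0 <= z by exact: powR_ge0.
pose G q := torus_functional T X s t rho (torus_fejer (2 ^ q) (grid zeta q)) w.
have G0 : G 0%N = t - s.
  rewrite /G /torus_functional (@eq_Rintegral _ _ _ _ _ (fun=> 1)); last first.
    by move=> u _; rewrite /torus_fejer big1// => l _; exact: fejer1.
  by rewrite Rintegral_cst// mul1r interval_measureT.
have GS k : G k.+1 <= G k + B0 * z ^+ k.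
  have jlt l : (Num.truncn ((2 ^ k.+1)%:R * zeta l) < 2 ^ k * 16)%N.
    by have [+ _] := grid_point k.+1 (zeta8 l); rewrite expnS [(2 * 2 ^ k)%N]mulnC -mulnA.
  pose j : {ffun 'I_d -> 'I_(2 ^ k * 16)} := [ffun l => Ordinal (jlt l)].
  have q0 m : (0 < 2 ^ m)%N by rewrite expn_gt0.
  have E : torus_functional T X s t rho (@fejer_increment k j) w = G k.+1 - G k.
    rewrite /G /torus_functional -RintegralB//; last 2 first.
    - by apply: bmf_integrable => //; exact: (bmf_pair2 (bmf_torus_fejer rho _ (q0 k.+1)) w).
    - by apply: bmf_integrable => //; exact: (bmf_pair2 (bmf_torus_fejer rho _ (q0 k)) w).
    apply: eq_Rintegral => u _; rewrite /fejer_increment -mul2n -expnS; congr (_ - _).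
      by congr torus_fejer; apply/funext => l; rewrite /grid ffunE.
    congr torus_fejer; apply/funext => l; rewrite /grid ffunE /= trunc_double_half//.
    by have /andP[] := zeta8 l.
  have := functional_le j; rewrite E ler_norml => /andP[_].
  have -> : (2 ^ k)%:R `^ (- eta) = z ^+ k :> R.
    by rewrite natrX -powR_mulrn// powRAC powR_mulrn// powR_ge0.
  by lra.
have Gq : G q <= (t - s) + B0 * \sum_(k < q) z ^+ k.
  elim: q => [|k IH]; first by rewrite big_ord0 mulr0 addr0 G0.
  by apply: (le_trans (GS k)); rewrite big_ord_recr/= mulrDr addrA lerD2r.
apply: (le_trans Gq); rewrite lerD2l ler_wpM2l//.
have z1 := decay_lt1; rewrite -/z in z1.
have -> : (1 - z)^-1 = 1 * (1 - z)^-1 by rewrite mul1r.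
rewrite ler_pdivlMr ?subr_gt0//.
elim: q {Gq} => [|k IH]; first by rewrite big_ord0 mul0r ler01.
have -> : (\sum_(i < k.+1) z ^+ i) * (1 - z) = 1 - z ^+ k.+1.
  by rewrite -[RHS]opprB subrX1 -mulNr opprB mulrC.
by rewrite gerBl exprn_ge0.
Qed.

(** The mass of the cell of [x], of side rho 2^(-q), is at most a constant times the Fejer
    functional divided by 2^(q d), and dividing by the volume of the cell cancels 2^(q d). The bound
    is uniform in [q], which can be taken so large that the local time is almost constant on the
    cell. *)
Lemma local_time_increment_le (s' t' : R) (x : 'rV[R]_d) : s <= s' -> s' <= t' -> t' <= t ->
  L t' x w - L s' x w <= ((@cos1_cst R d) * rho ^+ d)^-1 * ((t - s) + B0 / (1 - 2 `^ (- eta))).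
Proof.
move=> ss s't' tt; set M := (X in _ <= X).
have c0 : 0 < @cos1_cst R d :> R by exact: cos1_cst_gt0.
have M0 : 0 <= M.
  apply: mulr_ge0.
    by rewrite invr_ge0; apply: mulr_ge0; [exact: ltW|apply: exprn_ge0; exact: ltW].
  by apply: addr_ge0; rewrite ?subr_ge0//; apply: divr_ge0 => //; rewrite subr_ge0 ltW.
have rat_bound (r1 r2 : rat) : s <= ratr r1 -> (ratr r1 : R) <= ratr r2 -> ratr r2 <= t ->
    L (ratr r2) x w - L (ratr r1) x w <= M.
  move=> sr1 r12 r2t; apply/ler_addgt0Pr => e' e'0.
  pose e := e' / 2; have e0 : 0 < e by rewrite divr_gt0.
  have r10 : 0 <= ratr r1 :> R by rewrite (le_trans s_ge0).
  have [delta delta0 hd] := occupation_box_ge X_meas Lw x r10 r12 (le_trans r2t tT) e0.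
  have [q hq] := exprn_half_lt (divr_gt0 delta0 rho_gt0).
  pose side := rho * 2^-1 ^+ q.
  have side0 : 0 < side by rewrite mulr_gt0// exprn_gt0// invr_gt0.
  have sided : side < delta by rewrite /side mulrC -ltr_pdivlMr.
  have q0 : (0 : R) < (2 ^ q)%:R by rewrite ltr0n expn_gt0.
  pose z l := (x ord0 l - coord_process T X l (0, w)) / rho.
  have /choice[m mz] l : exists m : int, 0 <= z l - m%:~R * (pi *+ 2) < 8 by exact: torus_reduce.
  pose zeta l := z l - (m l)%:~R * (pi *+ 2).
  (* Lower corner of the grid cell of [x], lifted from the torus to R^d by means of the integers
     [m]. *)
  pose a : 'rV[R]_d := \row_l (coord_process T X l (0, w) +
     rho * ((m l)%:~R * (pi *+ 2) + grid zeta q l)).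
  have sideE : side = rho / (2 ^ q)%:R by rewrite /side natrX exprVn.
  have xa l : a ord0 l <= x ord0 l <= a ord0 l + side.
    have [_ /andP[h1 h2]] := grid_point q (mz l).
    have xE : x ord0 l = coord_process T X l (0, w) + rho * ((m l)%:~R * (pi *+ 2) + zeta l).
      by rewrite /zeta /z; field; rewrite gt_eqF.
    rewrite mxE xE sideE -!addrA !lerD2l -mulrDr !ler_pM2l// -!addrA !lerD2l.
    rewrite /grid h1/= ltW//; apply: (lt_le_trans h2).
    by rewrite mulrDl mul1r.
  have := hd a side side0 sided xa; set O := occupation_measure _ _ _ _ => hO.
  pose A := frozen_path T X w @^-1` box_rV a (a + const_mx side).
  have mA : measurable A.
    rewrite -[A]setTI; apply: measurable_frozen_path => //; exact: measurable_box_rV.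
  have OA : (O <= interval_measure s t A)%E.
    rewrite /O (@occupation_measureE _ _ _ _ T X)//; last exact: le_trans tT.
    exact: interval_measure_subset.
  pose g := fun u => torus_fejer (2 ^ q) (grid zeta q) (torus_process T X rho (u, w)).
  have q0' : (0 < 2 ^ q)%N by rewrite expn_gt0.
  have bg : @bounded_measurable _ (measurableTypeR R) R g.
    exact: (bmf_pair2 (bmf_torus_fejer rho _ q0') w).
  pose k := (2 ^ q)%:R ^+ d * @cos1_cst R d.
  have k0 : 0 < k by rewrite mulr_gt0// exprn_gt0.
  have Ag u : k * \1_A u <= g u.
    rewrite indicE; have [/[!inE] /= Au|_] := boolP (u \in A); last first.
      by rewrite mulr0 torus_fejer_ge0.
    rewrite mulr1 /k -exprMn; apply: torus_fejer_ge => // l; exists (m l).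
    have := Au l; rewrite !mxE => /andP[h1 h2].
    have yE : torus_process T X rho (u, w) l - grid zeta q l - (m l)%:~R * (pi *+ 2) =
      (coord_process T X l (u, w) - (coord_process T X l (0, w) +
     rho * ((m l)%:~R * (pi *+ 2) + grid zeta q l))) / rho.
      by rewrite /torus_process /=; field; rewrite gt_eqF.
    rewrite yE ger0_norm; last by rewrite divr_ge0 ?subr_ge0// ltW.
    by rewrite ler_pdivrMr// [leRHS]mulrC -sideE lerBlDl.
  have bA : bounded_measurable (\1_A : measurableTypeR R -> R).
    split; first exact: measurable_indic.
    by exists 1 => u; rewrite indicE; case: (_ \in _); rewrite ?normr1 ?normr0.
  have muA : interval_measure s t A = (\int[interval_measure s t]_u \1_A u)%:E.
    by rewrite /Rintegral integral_indic// setIT fineK// fin_num_measure.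
  have := le_trans hO OA; rewrite muA lee_fin => h1.
  have zeta8 l : 0 <= zeta l < 8 by exact: mz.
  have h2 : k * \int[interval_measure s t]_u \1_A u <= (t - s) + B0 / (1 - 2 `^ (- eta)).
    apply: le_trans (fejer_functional_le q zeta8); rewrite -RintegralZl//; last exact: bmf_integrable.
    apply: le_Rintegral => //; last exact: bmf_integrable.
    by apply: bmf_integrable => //; apply: bmfM => //; exact: bmf_cst.
  have h3 : (L (ratr r2) x w - L (ratr r1) x w - 2 * e) * ((@cos1_cst R d) * rho ^+ d) <=
      (t - s) + B0 / (1 - 2 `^ (- eta)).
    apply: le_trans h2; apply: (@le_trans _ _ (k * ((L (ratr r2) x w - L (ratr r1) x w - 2 * e) * side ^+ d))); last first.
      by rewrite ler_pM2l.
    rewrite le_eqVlt; apply/orP; left; apply/eqP; rewrite /k sideE expr_div_n.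
    by field; rewrite expf_neq0// gt_eqF.
  have h4 : L (ratr r2) x w - L (ratr r1) x w - 2 * e <= M.
    by rewrite /M [leRHS]mulrC ler_pdivlMr// mulr_gt0// exprn_gt0.
  by rewrite /e in h4; lra.
rewrite leNgt; apply/negP => Mlt.
have {}s't' : s' < t'.
  rewrite lt_neqAle s't' andbT; apply/eqP => E; move: Mlt; rewrite E subrr => /lt_le_trans/(_ M0).
  by rewrite ltxx.
have s'T : 0 <= s' <= T by rewrite (le_trans s_ge0)//= (le_trans (ltW s't'))// (le_trans tt).
have t'T : 0 <= t' <= T by rewrite (le_trans tt)// andbT (le_trans _ (ltW s't'))//; case/andP: s'T.
(* Half of the supposed excess over [M]: rational times whose local times at [x] are within [e] of
   those at the two ends contradict [rat_bound]. The midpoint [c] keeps these times ordered. *)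
pose e := (L t' x w - L s' x w - M) / 2.
have e0 : 0 < e by rewrite divr_gt0// subr_gt0.
have [d1 d10 h1] := local_time_continuous Lw x s'T e0.
have [d2 d20 h2] := local_time_continuous Lw x t'T e0.
pose c := (s' + t') / 2.
have [|r1] := @rat_in_itvoo R s' (Num.min c (s' + d1)).
  by rewrite lt_min ltrDl d10 andbT /c; lra.
rewrite in_itv/= lt_min => /andP[s'r1 /andP[r1c r1d]].
have [|r2] := @rat_in_itvoo R (Num.max c (t' - d2)) t'.
  by rewrite gt_max gtrBl d20 andbT /c; lra.
rewrite in_itv/= gt_max => /andP[/andP[cr2 dr2] r2t'].
have r12 : ratr r1 <= ratr r2 :> R by lra.
have r1T : 0 <= (ratr r1 : R) <= T by lra.
have r2T : 0 <= (ratr r2 : R) <= T by lra.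
have rb : L (ratr r2) x w - L (ratr r1) x w <= M by apply: rat_bound => //; lra.
have : `|L (ratr r1) x w - L s' x w| < e.
  by apply: h1 => //; [rewrite ger0_norm; lra|exact: ballxx].
have : `|L (ratr r2) x w - L t' x w| < e.
  by apply: h2 => //; [rewrite ler0_norm; lra|exact: ballxx].
rewrite !ltr_norml => /andP[a1 a2] /andP[a3 a4].
by rewrite /e in a1 a2 a3 a4; lra.
Qed.

End local_time_bound.

(** * Suprema and the Borel-Cantelli argument *)

Section supremum_bound.
Context {R : realType} {dO : measure_display} {Omega : measurableType dO}.
Variable P : probability Omega R.
Context {d : nat}.
Variables (T H c0 theta alpha : R) (X : R -> Omega -> 'rV[R]_d)
  (L : R -> 'rV[R]_d -> Omega -> R).
Hypothesis X_meas : jointly_measurable T X.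
Hypothesis X_char : charfun_increments_bound P T X H c0 theta.
Hypothesis d_gt0 : (0 < d)%N.
Hypothesis H_itv : 0 < H < 1.
Hypothesis c0_gt0 : 0 < c0.
Hypothesis theta_ge0 : 0 <= theta.
Local Notation rho n h := ((n%:R / h) `^ (- H)).

(** One exceptional event serves all [x] and all subintervals, so no further union is needed when a
    window moves inside [s, t]. The local-time property stays a premise on [w], which leaves [B] a
    measurable event of controlled probability. *)
Definition sup_bad_event_bound (C : R) (n0 : nat) : Prop :=
  forall (s t h : R) (n : nat), 0 <= s -> s <= t -> t <= T -> t - s <= h -> 0 < h ->
  (n0 <= n)%N -> ~~ odd n ->
  exists B : set Omega, [/\ measurable B, (P B <= (expR (- (2 * n%:R)))%:E)%E &
    forall w, ~ B w -> (alpha = 0 -> local_time_path T X L w) ->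
    forall s' t' x, s <= s' -> s' <= t' -> t' <= t ->
    (fractional_local_time X alpha L w x s' t' <=
      (C * (n%:R `^ (H * (theta + d%:R - alpha)) * h `^ (1 - H * (d%:R - alpha))))%:E)%E].

(** Source of the exponents of the theorem: with b = d - alpha, the factor rho^(- b) = (n / h)^(H b)
    moves H b powers from [h] to [n]. *)
Lemma scale_rhoE (n : nat) (h b : R) : (0 < n)%N -> 0 < h ->
  n%:R `^ (H * theta) * h * (rho n h) `^ (- b) =
  n%:R `^ (H * (theta + b)) * h `^ (1 - H * b).
Proof.
move=> n0 h0; have n0' : (0 : R) < n%:R by rewrite ltr0n.
rewrite -powRrM mulrNN powRM ?(ltW n0') ?invr_ge0 ?(ltW h0)//.
rewrite -[h^-1]powR_inv1 ?(ltW h0)// -powRrM mulN1r mulrDr.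
rewrite (@powRD _ _ (H * theta)) ?(gt_eqF n0') ?implybT//.
rewrite (@powRD _ h 1) ?(gt_eqF h0) ?implybT// powRr1 ?(ltW h0)//.
by ring.
Qed.

Lemma natr_powR_ge1 (n : nat) (p : R) : (0 < n)%N -> 0 <= p -> 1 <= n%:R `^ p :> R.
Proof.
by move=> n0 p0; rewrite -[leLHS](powRr0 (n%:R : R)) ler_powR// (ler_nat R 1).
Qed.

Lemma exists_nat_ge (x e : R) : 0 < e -> exists n0 : nat, (0 < n0)%N /\ forall n, (n0 <= n)%N -> x <= n%:R * e.
Proof.
move=> e0; exists (Num.bound (x / e)).+1; split => // n hn.
rewrite -ler_pdivrMr//; have [x0|x0] := leP 0 (x / e).
  by rewrite (le_trans (ltW (archi_boundP x0)))// ler_nat ltnW.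
by rewrite (le_trans (ltW x0)).
Qed.

Lemma sup_bad_event_riesz : 0 < alpha < d%:R -> H * (d%:R - alpha) < 1 ->
  exists C n0, [/\ 0 < C, (0 < n0)%N & sup_bad_event_bound C n0].
Proof.
move=> /andP[al0 ald] Hb1; have /andP[H0 H1] := H_itv.
have d0 : (0 : R) < d%:R by rewrite ltr0n.
pose b := d%:R - alpha; have b0 : 0 < b by rewrite subr_gt0.
pose mn := Num.min d%:R H^-1.
have bmn : b < mn.
  by rewrite lt_min /b gtrBl al0/= -[ltRHS]mul1r ltr_pdivlMr// mulrC.
(* Strictly between b = d - alpha and the minimum of d and 1 / H: at most d so that the
   interpolation exponent eta / d is at most 1, below 1 / H so that the time singularity is
   integrable. [eta'] leaves room on both sides, for the series over [q] and for the union bound. *)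
pose eta := (b + mn) / 2; pose eta' := (b + eta) / 2.
have mnd : mn <= d%:R by rewrite ge_min lexx.
have mnH : mn <= H^-1 by rewrite ge_min lexx orbT.
have beta : b < eta by rewrite /eta; lra.
have etamn : eta < mn by rewrite /eta; lra.
have beta' : b < eta' by rewrite /eta'; lra.
have eta'eta : eta' < eta by rewrite /eta'; lra.
pose e := eta / d%:R.
have de : d%:R * e = eta by rewrite /e mulrCA divff ?mulr1// gt_eqF.
have e01 : 0 <= e <= 1.
  by rewrite /e divr_ge0 ?(ltW d0) ?ler_pdivrMr// ?mul1r; lra.
pose a := H * eta.
have a01 : 0 < a < 1.
  rewrite /a mulr_gt0//=; last by lra.
  by rewrite -ltr_pdivlMl// mulr1 (lt_le_trans etamn).
pose K0 : R := 32 ^+ d; have K00 : 0 < K0 by rewrite exprn_gt0.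
pose tc := @torus_cst R d c0 a K0.
have tc0 : 0 < tc.
  by rewrite /tc /torus_cst !mulr_gt0 ?expR_gt0 ?exprn_gt0 ?power_kernel_cst_gt0.
pose Z : R := 2 `^ b / (1 - 2 `^ (b - eta')).
have Z0 : 0 <= Z.
  rewrite divr_ge0 ?powR_ge0// subr_ge0 -[leRHS](powRr0 2) ler_powR ?(ler_nat R 1)//; lra.
have k0 : 0 < @cos1_cst R d by exact: cos1_cst_gt0.
pose A0 := alpha / (d%:R * unit_ball_volume R d).
have A00 : 0 <= A0.
  by rewrite /A0 divr_ge0 ?mulr_ge0 ?(ltW al0) ?(ltW d0)// fine_ge0.
(* [A0] is only known to be nonnegative; the added 1 makes [C] positive. *)
pose C := A0 * (2 `^ b * (1 + (@cos1_cst R d)^-1 * tc * Z)) + 1.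
have k1 : 0 <= (@cos1_cst R d)^-1 * tc * Z.
  by apply: mulr_ge0 Z0; apply: mulr_ge0; rewrite ?invr_ge0; exact: ltW.
have [n0 [n00 hn0]] := @exists_nat_ge (d.+1)%:R (eta - eta') (ltac:(by rewrite subr_gt0)).
exists C, n0; split=> //.
  rewrite /C ltr_wpDl//; apply: mulr_ge0 => //; apply: mulr_ge0; first exact: powR_ge0.
  by rewrite addr_ge0.
move=> s t h n sg0 st tT tsh h0 n0n evn.
have npos : (0 < n)%N by exact: leq_trans n0n.
have npos' : (0 : R) < n%:R by rewrite ltr0n.
have l0 : 0 < n%:R / h by rewrite divr_gt0.
have r0 : 0 < rho n h by rewrite powR_gt0.
have gp q j : torus_poly H (rho n h) (n%:R / h) a (K0 * (2 ^ q)%:R `^ (- eta)) (@averaged_fejer R d q j).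
  by rewrite /a -de; apply: torus_fejer_poly => //; rewrite expn_gt0.
have [B [mB PB hB]] := torus_bad_event X_meas X_char (ltW c0_gt0) npos evn c0_gt0 h0 r0 a01 K00
  sg0 tT tsh (hn0 n n0n) gp.
exists B; split => // w Bw _ s' t' x ss s't' tt.
rewrite /fractional_local_time gt_eqF// -/A0.
pose B0 := tc * n%:R `^ (H * theta) * h.
have B00 : 0 <= B0 by apply: mulr_ge0 (ltW h0); apply: mulr_ge0 (ltW tc0) (powR_ge0 _ _).
have fle q j : torus_functional T X s t (rho n h) (@averaged_fejer R d q j) w <= B0 * (2 ^ q)%:R `^ (- eta').
  apply: le_trans (ler_norm _) _; apply: le_trans (hB w Bw q j) _.
  by rewrite le_eqVlt; apply/orP; left; apply/eqP; rewrite /B0 /tc; ring.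
have := riesz_potential_le X_meas sg0 st tT r0 B00 fle
  (fun q j => bmf_torus_poly X_meas (gp q j)) ald beta' x ss tt.
rewrite -/b -/Z => h1.
apply: (le_trans (lee_wpmul2l _ h1)); first by rewrite lee_fin.
rewrite -EFinM lee_fin.
have N1 : 1 <= n%:R `^ (H * theta) :> R by rewrite natr_powR_ge1// mulr_ge0// ltW.
have -> : n%:R `^ (H * (theta + d%:R - alpha)) * h `^ (1 - H * b) =
    n%:R `^ (H * theta) * h * (rho n h) `^ (- b).
  by rewrite scale_rhoE// /b addrA.
have -> : (rho n h / 2) `^ (alpha - d%:R) = 2 `^ b * (rho n h) `^ (- b).
  rewrite -[alpha - d%:R]opprB -/b powRM ?(ltW r0)// mulrC; congr (_ * _).
  by rewrite -[2^-1]powR_inv1// -powRrM mulrNN mul1r.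
have rb0 : 0 <= (rho n h) `^ (- b) by exact: powR_ge0.
set Rb := (rho n h) `^ (- b) in rb0 *; set N := n%:R `^ (H * theta) in N1 *.
have step : (t - s) + (@cos1_cst R d)^-1 * B0 * Z <= N * h * (1 + (@cos1_cst R d)^-1 * tc * Z).
  have -> : (@cos1_cst R d)^-1 * B0 * Z = N * h * ((@cos1_cst R d)^-1 * tc * Z).
    by rewrite /B0 -/N; ring.
  rewrite [leRHS]mulrDr mulr1 lerD2r (le_trans tsh)// ler_peMl// ltW//.
apply: (@le_trans _ _ (A0 * (2 `^ b * Rb * (N * h * (1 + (@cos1_cst R d)^-1 * tc * Z))))).
  by rewrite ler_wpM2l// ler_wpM2l// mulr_ge0// powR_ge0.
rewrite /C mulrDl mul1r.
apply: (@le_trans _ _ (A0 * (2 `^ b * (1 + (@cos1_cst R d)^-1 * tc * Z)) * (N * h * Rb))).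
  by rewrite le_eqVlt; apply/orP; left; apply/eqP; ring.
by rewrite lerDl !mulr_ge0 ?(ltW h0)//; lra.
Qed.

Lemma sup_bad_event_local_time : alpha = 0 -> H * d%:R < 1 ->
  exists C n0, [/\ 0 < C, (0 < n0)%N & sup_bad_event_bound C n0].
Proof.
move=> al0 Hd1; have /andP[H0 H1] := H_itv.
have d0 : (0 : R) < d%:R by rewrite ltr0n.
have Hd0 : 0 < H * d%:R by rewrite mulr_gt0.
(* Then H d (1 + 2 gamma) <= (1 + H d) / 2 < 1, which makes the time singularity integrable; the
   bound 1/2 comes from the lattice sum. *)
pose gamma := Num.min 2^-1 (((H * d%:R)^-1 - 1) / 4).
have Hdi : 1 < (H * d%:R)^-1 by rewrite invf_gt1.
have g0 : 0 < gamma by rewrite lt_min invr_gt0 ltr0n/= divr_gt0// subr_gt0.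
have g1 : gamma <= 2^-1 by rewrite ge_min lexx.
have g2 : gamma <= ((H * d%:R)^-1 - 1) / 4 by rewrite ge_min lexx orbT.
pose a := H * (d%:R * (1 + 2 * gamma)).
have a01 : 0 < a < 1.
  rewrite /a mulrA mulr_gt0//=; last by lra.
  rewrite -ltr_pdivlMl// mulr1; lra.
pose K0 : R := 3 * d%:R * 32 ^+ d; have K00 : 0 < K0 by rewrite !mulr_gt0// exprn_gt0.
pose tc := @torus_cst R d c0 a K0.
have tc0 : 0 < tc.
  by rewrite /tc /torus_cst !mulr_gt0 ?expR_gt0 ?exprn_gt0 ?power_kernel_cst_gt0.
pose eta' := gamma / 2; have eta'0 : 0 < eta' by rewrite divr_gt0.
pose Z : R := (1 - 2 `^ (- eta'))^-1.
have Z0 : 0 <= Z.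
  by rewrite invr_ge0 subr_ge0 -[leRHS](powRr0 2) ler_powR ?(ler_nat R 1)// oppr_le0 ltW.
have k0 : 0 < @cos1_cst R d by exact: cos1_cst_gt0.
pose C := (@cos1_cst R d)^-1 * (1 + tc * Z).
have [n0 [n00 hn0]] := @exists_nat_ge (d.+1)%:R (gamma - eta') (ltac:(by rewrite /eta'; lra)).
have tcZ : 0 <= tc * Z by rewrite mulr_ge0// ltW.
exists C, n0; split=> //.
  by rewrite /C mulr_gt0 ?invr_gt0//; lra.
move=> s t h n sg0 st tT tsh h0 n0n evn.
have npos : (0 < n)%N by exact: leq_trans n0n.
have npos' : (0 : R) < n%:R by rewrite ltr0n.
have l0 : 0 < n%:R / h by rewrite divr_gt0.
have r0 : 0 < rho n h by rewrite powR_gt0.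
have gp q j : torus_poly H (rho n h) (n%:R / h) a (K0 * (2 ^ q)%:R `^ (- gamma)) (@fejer_increment R d q j).
  apply: torus_fejerB_poly => //; rewrite ?expn_gt0// ?(ltW g0)//.
  (* The two centres coincide in a coordinate where [j l] is even and differ by 2^(-q-1) where it is
     odd. *)
  move=> l; have q0 : (0 : R) < (2 ^ q)%:R by rewrite ltr0n expn_gt0.
  rewrite expnS natrM invfM mulrA -mulrBl normrM [X in _ * X]ger0_norm ?invr_ge0 ?(ltW q0)//.
  rewrite ler_piMl ?invr_ge0 ?(ltW q0)//.
  have := odd_double_half (j l); rewrite -muln2 => kE.
  rewrite -{1}kE natrD natrM mulrDl mulfK ?pnatr_eq0// addrK.
  by case: (odd (j l)); rewrite ?mul0r ?normr0// mul1r ger0_norm ?invr_ge0// invf_le1// (ler_nat R 1).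
have [B [mB PB hB]] := torus_bad_event X_meas X_char (ltW c0_gt0) npos evn c0_gt0 h0 r0 a01 K00
  sg0 tT tsh (hn0 n n0n) gp.
exists B; split => // w Bw Lw s' t' x ss s't' tt.
rewrite /fractional_local_time al0 eqxx.
pose B0 := tc * n%:R `^ (H * theta) * h.
have B00 : 0 <= B0 by apply: mulr_ge0 (ltW h0); apply: mulr_ge0 (ltW tc0) (powR_ge0 _ _).
have fle q j : `|torus_functional T X s t (rho n h) (@fejer_increment R d q j) w| <= B0 * (2 ^ q)%:R `^ (- eta').
  apply: le_trans (hB w Bw q j) _.
  by rewrite le_eqVlt; apply/orP; left; apply/eqP; rewrite /B0 /tc; ring.
have := local_time_increment_le X_meas (Lw al0) sg0 st tT r0 B00 eta'0 fle x ss s't' tt.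
rewrite -/Z => h1; rewrite lee_fin; apply: (le_trans h1).
have N1 : 1 <= n%:R `^ (H * theta) :> R by rewrite natr_powR_ge1// mulr_ge0// ltW.
rewrite !subr0 -scale_rhoE// (powRN _ d%:R) powR_mulrn ?(ltW r0)//.
set N := n%:R `^ (H * theta) in N1 *.
have Nh : 0 < N * h by rewrite mulr_gt0// (lt_le_trans _ N1).
have step : (t - s) + B0 * Z <= N * h * (1 + tc * Z).
  have -> : B0 * Z = N * h * (tc * Z) by rewrite /B0 -/N; ring.
  by rewrite [leRHS]mulrDr mulr1 lerD2r (le_trans tsh)// ler_peMl// ltW.
rewrite invfM -[leLHS]mulrA; apply: (@le_trans _ _ ((@cos1_cst R d)^-1 * ((rho n h ^+ d)^-1 * (N * h * (1 + tc * Z))))).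
  by rewrite ler_wpM2l ?invr_ge0 ?(ltW k0)// ler_wpM2l// invr_ge0 exprn_ge0// ltW.
by rewrite le_eqVlt; apply/orP; left; apply/eqP; rewrite /C; ring.
Qed.

End supremum_bound.

(** * Borel-Cantelli along dyadic scales *)

Lemma ae_eventually_not (R : realType) d (U : measurableType d)
    (mu : probability U R) (E : (set U)^nat) :
  (forall k, measurable (E k)) -> (\sum_(k <oo) mu (E k) < +oo)%E ->
  {ae mu, forall w, exists k0, forall k, (k0 <= k)%N -> ~ E k w}.
Proof.
move=> mE hE; exists (lim_sup_set E); split.
- by apply: bigcapT_measurable => k; apply: bigcup_measurable => j _; exact: mE.
- exact: lim_sup_set_cvg0.
move=> w /= nw k _; apply: contrapT => h; apply: nw; exists k => j kj Ej; apply: h.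
by exists j.
Qed.

Lemma nneseries_lty (R : realType) (u : nat -> R) (M : R) :
  (forall k, 0 <= u k) -> (forall n, \sum_(0 <= k < n) u k <= M) ->
  (\sum_(k <oo) (u k)%:E < +oo)%E.
Proof.
move=> u0 uM; apply: (@le_lt_trans _ _ M%:E); last by rewrite ltry.
apply: lime_le; first by apply: is_cvg_nneseries => k _ _; rewrite lee_fin.
by apply: nearW => n; rewrite sumEFin lee_fin.
Qed.

Lemma limf_esup_right_le (R : realType) (f : R -> \bar R) (c : \bar R) (delta : R) :
  0 < delta -> (forall r, 0 < r < delta -> (f r <= c)%E) ->
  (limf_esup f 0%R^'+ <= c)%E.
Proof.
move=> d0 fc; apply: ge_ereal_inf; exists (ereal_sup (f @` [set r | 0 < r < delta])).
  exists [set r | 0 < r < delta] => //; near=> r.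
  by apply/andP; split; near: r; [exact: nbhs_right_gt|exact: nbhs_right_lt].
by apply: ge_ereal_sup => _ [r rd <-]; exact: fc.
Unshelve. all: by end_near. 
Qed.

Lemma scaled_ratio_le (R : realType) (C p q K K' n h r l : R) (F : \bar R) :
  0 <= C -> 0 <= p -> 0 <= q -> 0 < r -> 0 < l -> 0 <= n <= K * l -> 0 <= h <= K' * r ->
  (F <= (C * (n `^ p * h `^ q))%:E)%E ->
  (F * ((r `^ q * l `^ p)^-1)%:E <= (C * (K `^ p * K' `^ q))%:E)%E.
Proof.
move=> C0 p0 q0 r0 l0 /andP[n0 nK] /andP[h0 hK] FC.
have rl : 0 < r `^ q * l `^ p by rewrite mulr_gt0// powR_gt0.
have K0 : 0 <= K by rewrite -(pmulr_lge0 _ l0) (le_trans n0).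
have K'0 : 0 <= K' by rewrite -(pmulr_lge0 _ r0) (le_trans h0).
apply: (@le_trans _ _ ((C * (n `^ p * h `^ q))%:E * ((r `^ q * l `^ p)^-1)%:E)%E).
  by rewrite lee_wpmul2r// lee_fin invr_ge0 ltW.
rewrite -EFinM lee_fin ler_pdivrMr// -mulrA ler_wpM2l//.
apply: (@le_trans _ _ ((K * l) `^ p * (K' * r) `^ q)).
  by rewrite ler_pM ?powR_ge0// ge0_ler_powR ?nnegrE// mulr_ge0// ltW.
rewrite !powRM ?(ltW r0) ?(ltW l0)// le_eqVlt; apply/orP; left; apply/eqP; ring.
Qed.

Lemma ln2_ge_half (R : realType) : 2^-1 <= ln 2 :> R.
Proof.
rewrite -[leRHS]opprK -lnV ?posrE// lerNr.
have := @le_ln1Dx R (- 2^-1); rewrite (_ : 1 + - 2^-1 = 2^-1); last by field.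
by apply; lra.
Qed.

Lemma ln_inv_dyadic_ge (R : realType) (r : R) (k : nat) : 0 < r -> r <= 2^-1 ^+ k ->
  k%:R / 2 <= ln r^-1.
Proof.
move=> r0 rk; apply: (@le_trans _ _ (ln (2 ^+ k))).
  by rewrite lnXn// -[leRHS]mulr_natl ler_wpM2l// ln2_ge_half.
rewrite ler_ln ?posrE ?invr_gt0 ?exprn_gt0//.
by rewrite -[leLHS]invrK lef_pV2 ?posrE ?invr_gt0 ?exprn_gt0// -exprVn.
Qed.

(** From k = 5 on, (k / 2)^2 >= k + 1; the square turns into the factor 1/2 after the second
    logarithm. *)
Lemma lnln_inv_dyadic_ge (R : realType) (r : R) (k : nat) : (5 <= k)%N ->
  0 < r -> r <= 2^-1 ^+ k -> ln k.+1%:R / 2 <= ln (ln r^-1).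
Proof.
move=> k5 r0 rk; have k5' : (5 : R) <= k%:R by rewrite (ler_nat R 5).
have k0 : (0 : R) < k%:R / 2 by rewrite divr_gt0//; lra.
have h := ln_inv_dyadic_ge r0 rk.
rewrite ler_pdivrMr// mulr_natr -lnXn ?(lt_le_trans k0 h)//.
rewrite ler_ln ?posrE ?exprn_gt0 ?(lt_le_trans k0 h)//.
apply: (@le_trans _ _ ((k%:R / 2) ^+ 2)); last by rewrite lerXn2r// ?nnegrE ?(ltW k0)// (le_trans (ltW k0)).
rewrite -natr1 expr_div_n; nra.
Qed.

Lemma sum_inv_sqr_le2 (R : realFieldType) n :
  \sum_(0 <= k < n) (k.+1%:R ^+ 2)^-1 <= 2 :> R.
Proof.
suff : \sum_(0 <= k < n) (k.+1%:R ^+ 2)^-1 <= 2 - 2 / n.+1%:R :> R.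
  by move=> /le_trans; apply; rewrite gerBl divr_ge0.
elim: n => [|n IH]; first by rewrite big_nil divr1 subrr.
rewrite big_nat_recr//= (le_trans (lerD IH (lexx _)))//.
have n0 : (0 : R) < n.+1%:R by [].
rewrite -[n.+2%:R]natr1; set x : R := n.+1%:R in n0 *.
have x1 : 1 <= x by rewrite /x (ler_nat R 1).
rewrite -subr_ge0 (_ : _ - _ = (x - 1) / (x ^+ 2 * (x + 1))); last first.
  by field; rewrite !gt_eqF//; lra.
by rewrite divr_ge0 ?mulr_ge0 ?exprn_ge0//; lra.
Qed.

Lemma dyadic_scale (R : realType) (r : R) (m : nat) : 0 < r < 2^-1 ^+ m ->
  exists k, [/\ (m <= k)%N, r <= 2^-1 ^+ k & 2^-1 ^+ k <= 2 * r].
Proof.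
move=> /andP[r0 rm].
have r1 : r <= 1 by rewrite (le_trans (ltW rm))// exprn_ile1//; lra.
have [k /andP[kr rk]] := dyadic_bracket r0 r1.
exists k; split => //; last by move: kr; rewrite exprS; lra.
by have := lt_trans kr rm; rewrite ltr_iXn2l//; lra.
Qed.

Section uniform_bounds.
Context {R : realType} {dO : measure_display} {Omega : measurableType dO}.
Variable P : probability Omega R.
Context {d : nat}.
Variables (T H theta alpha : R) (X : R -> Omega -> 'rV[R]_d)
  (L : R -> 'rV[R]_d -> Omega -> R).
Hypothesis T_gt0 : 0 < T.
Variables (C : R) (n0 : nat).
Hypothesis C_gt0 : 0 < C.
Hypothesis hC : sup_bad_event_bound P T H theta alpha X L C n0.
Hypothesis Lae : {ae P, forall w, alpha = 0 -> local_time_path T X L w}.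
Let p : R := H * (theta + d%:R - alpha).
Let q : R := 1 - H * (d%:R - alpha).

(** Stage [k] has [N k] intervals, each failing with probability at most e^(- 2 n k), where n k
    stands for [n k]; the summability hypothesis is the one of Borel-Cantelli. *)
Lemma ae_eventually_sup_bound (N n : nat -> nat) (s t : nat -> nat -> R) (h : nat -> R) :
  (forall k i, (i < N k)%N ->
    [/\ 0 <= s k i, s k i <= t k i, t k i <= T & t k i - s k i <= h k]) ->
  (forall k, [/\ 0 < h k, (n0 <= n k)%N & ~~ odd (n k)]) ->
  (\sum_(k <oo) ((N k)%:R * expR (- (2 * (n k)%:R)) : R)%:E < +oo)%E ->
  {ae P, forall w, exists k0, forall k i, (k0 <= k)%N -> (i < N k)%N ->
    forall s' t' x, s k i <= s' -> s' <= t' -> t' <= t k i ->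
    (fractional_local_time X alpha L w x s' t' <=
      (C * ((n k)%:R `^ p * h k `^ q))%:E)%E}.
Proof.
move=> hst hn hsum.
have /choice[B hB] : forall ki : nat * nat, exists B : set Omega, (ki.2 < N ki.1)%N ->
  [/\ measurable B, (P B <= (expR (- (2 * (n ki.1)%:R)))%:E)%E &
    forall w, ~ B w -> (alpha = 0 -> local_time_path T X L w) ->
    forall s' t' x, s ki.1 ki.2 <= s' -> s' <= t' -> t' <= t ki.1 ki.2 ->
    (fractional_local_time X alpha L w x s' t' <=
      (C * ((n ki.1)%:R `^ p * h ki.1 `^ q))%:E)%E].
  move=> [k i] /=; have [iN|iN] := boolP (i < N k)%N; last by exists set0.
  have [s0 st tT tsh] := hst k i iN; have [h0 nn ev] := hn k.
  by have [B hB] := hC s0 st tT tsh h0 nn ev; exists B.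
pose E k := \big[setU/set0]_(i < N k) B (k, i : nat).
have mE k : measurable (E k).
  by apply: bigsetU_measurable => i _; have [] := hB (k, i : nat) (ltn_ord i).
have PE k : (P (E k) <= ((N k)%:R * expR (- (2 * (n k)%:R)))%:E)%E.
  apply: (le_trans (Boole_inequality P (A := fun i => B (k, i)) _)) => [i iN|].
    by have [] := hB (k, i) iN.
  apply: (@le_trans _ _ (\sum_(i < N k) (expR (- (2 * (n k)%:R)))%:E)%E).
    by apply: lee_sum => i _; have [] := hB (k, i : nat) (ltn_ord i).
  by rewrite sumEFin lee_fin sumr_const card_ord -[leLHS]mulr_natl.
have Efin : (\sum_(k <oo) P (E k) < +oo)%E.
  by apply: le_lt_trans hsum; apply: lee_nneseries.
apply: filterS2 (ae_eventually_not mE Efin) Lae => w [k0 hk0] Lw.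
exists k0 => k i k0k iN s' t' x ss st tt.
have [_ _] := hB (k, i) iN; apply => // Bw.
by apply: (hk0 k k0k); rewrite /E -(bigcup_mkord (N k) (fun i => B (k, i))); exists i.
Qed.

Hypothesis p_ge0 : 0 <= p.
Hypothesis q_ge0 : 0 <= q.

Lemma limsup_fixed_time (t : R) : 0 < t < T ->
  exists c2 : R, 0 < c2 /\ {ae P, forall w, (limf_esup (fun r : R => (
        ereal_sup [set (fractional_local_time_around T X alpha L w x t r *
          ((r `^ q * ln (ln r^-1) `^ p)^-1)%R%:E)%E
          | x in [set: 'rV[R]_d]])%R) 0%R^'+ <= c2%:E)%E}.
Proof.
move=> /andP[t0 tT].
(* Even, at least [n0], and above ln (k + 1), so that the failure probability is at most (k +
   1)^(-2). *)
pose n k := (2 * (Num.truncn (ln (k.+1%:R : R)) + n0 + 1))%N.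
pose h k : R := 2 * 2^-1 ^+ k.
(* As ln (k + 1) >= 1/2, [n k] is at most (4 n0 + 6) ln (k + 1), and ln (k + 1) is at most twice the
   iterated logarithm. *)
pose K : R := 8 * n0%:R + 12.
have K0 : 0 < K by rewrite /K ltr_wpDl// mulr_ge0.
have L0 k : (0 : R) <= ln k.+1%:R by rewrite ln_ge0// (ler_nat R 1).
have nE k : (n k)%:R = 2 * ((Num.truncn (ln (k.+1%:R : R)))%:R + n0%:R + 1) :> R.
  by rewrite /n natrM !natrD.
have half0 k : (0 : R) < 2^-1 ^+ k by rewrite exprn_gt0.
exists (C * (K `^ p * 4 `^ q)); split; first by rewrite !mulr_gt0 ?powR_gt0.
have hst k i : (i < 1)%N ->
    [/\ 0 <= Num.max 0 (t - 2^-1 ^+ k), Num.max 0 (t - 2^-1 ^+ k) <= Num.min (t + 2^-1 ^+ k) T,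
      Num.min (t + 2^-1 ^+ k) T <= T &
      Num.min (t + 2^-1 ^+ k) T - Num.max 0 (t - 2^-1 ^+ k) <= h k].
  move=> _; have := half0 k; split.
  - by rewrite le_max lexx.
  - by rewrite ge_max !le_min; apply/andP; split; apply/andP; split; lra.
  - by rewrite ge_min lexx orbT.
  have : Num.min (t + 2^-1 ^+ k) T <= t + 2^-1 ^+ k by rewrite ge_min lexx.
  have : t - 2^-1 ^+ k <= Num.max 0 (t - 2^-1 ^+ k) by rewrite le_max lexx orbT.
  by rewrite /h; lra.
have hn k : [/\ 0 < h k, (n0 <= n k)%N & ~~ odd (n k)].
  by split; [rewrite /h mulr_gt0|rewrite /n; lia|rewrite /n oddM].
have hsum : (\sum_(k <oo) (1%:R * expR (- (2 * (n k)%:R)) : R)%:E < +oo)%E.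
  apply: (@nneseries_lty _ _ 2) => [k|m]; first by rewrite mulr_ge0 ?expR_ge0.
  apply: le_trans (sum_inv_sqr_le2 R m); apply: ler_sum => k _.
  rewrite mul1r expRN lef_pV2 ?posrE ?expR_gt0 ?exprn_gt0//.
  rewrite -[leLHS]lnK ?posrE ?exprn_gt0// ler_expR lnXn// -[leLHS]mulr_natl ler_wpM2l// nE.
  have /andP[_ ] := truncn_itv (L0 k); rewrite -[ltRHS]natr1 => h1.
  have : (0 : R) <= n0%:R by [].
  have : (0 : R) <= (Num.truncn (ln (k.+1%:R : R)))%:R by [].
  lra.
apply: filterS (ae_eventually_sup_bound hst hn hsum) => w [k0 hk0].
apply: (limf_esup_right_le (delta := 2^-1 ^+ maxn k0 5)) => // r rd.
have [k [km rk kr]] := dyadic_scale rd.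
have r0 : 0 < r by case/andP: rd.
move: km; rewrite geq_max => /andP[k0k k5].
have l1 := lnln_inv_dyadic_ge k5 r0 rk.
have L1 : 2^-1 <= ln k.+1%:R :> R.
  by rewrite (le_trans (ln2_ge_half R))// ler_ln ?posrE// (ler_nat R 2) ltnS (leq_trans _ k5).
apply: ge_ereal_sup => _ [x _ <-].
apply: (scaled_ratio_le (n := (n k)%:R) (h := h k)); rewrite ?(ltW C_gt0)//.
- lra.
- rewrite ler0n/= nE /K.
  have /andP[h1 _] := truncn_itv (L0 k).
  have n00 : (0 : R) <= n0%:R by [].
  nra.
- by have := half0 k; rewrite /h => hk; apply/andP; split; lra.
apply: (hk0 k 0%N k0k) => //.
- by rewrite ge_max !le_max lexx/=; apply/orP; right; lra.
- by rewrite ge_max !le_min; apply/andP; split; apply/andP; split; lra.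
- by rewrite le_min !ge_min lexx orbT andbT; apply/orP; left; lra.
Qed.

Lemma limsup_uniform_time :
  exists c3 : R, 0 < c3 /\ {ae P, forall w, (limf_esup (fun r : R => (
        ereal_sup [set
          ereal_sup [set (fractional_local_time_around T X alpha L w x t r *
            ((r `^ q * ln r^-1 `^ p)^-1)%R%:E)%E
            | x in [set: 'rV[R]_d]]
          | t in [set t : R | 0 < t < T]])%R) 0%R^'+ <= c3%:E)%E}.
Proof.
pose N k := (Num.truncn (T * 2 ^+ k)).+1.
(* The failure probability is at most e^(- 4 k) <= 4^(- k), which beats the number of intervals, at
   most (T + 1) 2^k. *)
pose n k := (2 * (k + n0))%N.
pose h k : R := 3 * 2^-1 ^+ k.
(* From one cell before i 2^(-k) to two cells after it: this contains the part in [0, T] of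
   [u - r, u + r] for every u in cell [i] and r <= 2^(-k). *)
pose s k (i : nat) : R := Num.max 0 ((i%:R - 1) * 2^-1 ^+ k).
pose t k (i : nat) : R := Num.min ((i%:R + 2) * 2^-1 ^+ k) T.
(* 2 (k + n0) <= 2 (1 + n0) k for k >= 1, and k is at most twice ln (1 / r). *)
pose K : R := 4 * (1 + n0%:R).
have n00 : (0 : R) <= n0%:R by [].
have K0 : 0 < K by rewrite /K; lra.
have nE k : (n k)%:R = 2 * (k%:R + n0%:R) :> R by rewrite /n natrM natrD.
have half0 k : (0 : R) < 2^-1 ^+ k by rewrite exprn_gt0.
have two0 k : (0 : R) < 2 ^+ k by rewrite exprn_gt0.
exists (C * (K `^ p * 6 `^ q)); split; first by rewrite !mulr_gt0 ?powR_gt0.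
have hst k i : (i < N k)%N ->
    [/\ 0 <= s k i, s k i <= t k i, t k i <= T & t k i - s k i <= h k].
  rewrite ltnS => iN; have i0 : (0 : R) <= i%:R by [].
  have iT : i%:R * 2^-1 ^+ k <= T.
    rewrite exprVn ler_pdivrMr//.
    have /andP[h1 _] := truncn_itv (mulr_ge0 (ltW T_gt0) (ltW (two0 k))).
    by apply: le_trans h1; rewrite ler_nat.
  have hk := half0 k; have ih : (0 : R) <= i%:R * 2^-1 ^+ k by rewrite mulr_ge0// ltW.
  split.
  - by rewrite le_max lexx.
  - by rewrite ge_max !le_min !mulrDl; apply/andP; split; apply/andP; split; lra.
  - by rewrite ge_min lexx orbT.
  have : t k i <= (i%:R + 2) * 2^-1 ^+ k by rewrite ge_min lexx.
  have : (i%:R - 1) * 2^-1 ^+ k <= s k i by rewrite le_max lexx orbT.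
  by rewrite /h; lra.
have hn k : [/\ 0 < h k, (n0 <= n k)%N & ~~ odd (n k)].
  by split; [rewrite /h mulr_gt0|rewrite /n; lia|rewrite /n oddM].
have e4 : expR (- 4) <= 4^-1 :> R.
  rewrite expRN lef_pV2 ?posrE ?expR_gt0//; apply: le_trans (expR_ge1Dx _); lra.
have hsum : (\sum_(k <oo) ((N k)%:R * expR (- (2 * (n k)%:R)) : R)%:E < +oo)%E.
  apply: (@le_lt_trans _ _ (\sum_(k <oo) ((T + 1) * 2^-1 ^+ k)%:E)%E); last first.
    by rewrite nneseries_geometric ?ltry ?addr_ge0 ?(ltW T_gt0)//; lra.
  apply: lee_nneseries => [k _ _|k _]; first by rewrite lee_fin mulr_ge0 ?expR_ge0.
  rewrite lee_fin; apply: (@le_trans _ _ (((T + 1) * 2 ^+ k) * 4^-1 ^+ k)).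
    apply: ler_pM; rewrite ?expR_ge0//.
      rewrite /N -[leLHS]natr1 mulrDl lerD ?mul1r//; last by rewrite exprn_ege1// (ler_nat R 1).
      by have /andP[h1 _] := truncn_itv (mulr_ge0 (ltW T_gt0) (ltW (two0 k))).
    apply: (@le_trans _ _ (expR (- 4) ^+ k)); last by rewrite lerXn2r ?nnegrE ?expR_ge0.
    by rewrite -expRM_natl ler_expR nE; have : (0 : R) <= k%:R by []; lra.
  rewrite -mulrA -exprMn (_ : 2 * 4^-1 = 2^-1 :> R)//; by field.
apply: filterS (ae_eventually_sup_bound hst hn hsum) => w [k0 hk0].
apply: (limf_esup_right_le (delta := 2^-1 ^+ maxn k0 1)) => // r rd.
have [k [km rk kr]] := dyadic_scale rd.
have r0 : 0 < r by case/andP: rd.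
move: km; rewrite geq_max => /andP[k0k k1].
have l1 := ln_inv_dyadic_ge r0 rk.
have k1' : (1 : R) <= k%:R by rewrite (ler_nat R 1).
apply: ge_ereal_sup => _ [u /= /andP[u0 uT] <-].
apply: ge_ereal_sup => _ [x _ <-].
apply: (scaled_ratio_le (n := (n k)%:R) (h := h k)); rewrite ?(ltW C_gt0)//.
- lra.
- by rewrite ler0n/= nE /K; nra.
- by have := half0 k; rewrite /h => hk; apply/andP; split; lra.
have u2 : 0 <= u * 2 ^+ k by rewrite mulr_ge0 ?ltW.
have /andP[i1 i2] := truncn_itv u2; set i := Num.truncn _ in i1 i2.
have hk := half0 k.
have ui1 : i%:R * 2^-1 ^+ k <= u.
  by rewrite exprVn ler_pdivrMr.
have ui2 : u <= (i%:R + 1) * 2^-1 ^+ k.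
  by rewrite natr1 exprVn ler_pdivlMr// ltW.
apply: (hk0 k i k0k) => //.
- by rewrite ltnS; apply: le_truncn; rewrite ler_pM2r// ltW.
- by rewrite ge_max !le_max lexx/=; apply/orP; right; lra.
- by rewrite ge_max !le_min; apply/andP; split; apply/andP; split; lra.
- by rewrite le_min !ge_min lexx orbT andbT; apply/orP; left; lra.
Qed.

End uniform_bounds.

Theorem theorem2p1 (R : realType) (dO : measure_display)
    (Omega : measurableType dO) (P : probability Omega R)
    (d : nat) (T H c0 theta c1 iota alpha : R)
    (X : R -> Omega -> 'rV[R]_d) (L : R -> 'rV[R]_d -> Omega -> R)
    (d_ge1 : (1 <= d)%N) (T_gt0 : 0 < T) (H_itv : 0 < H < 1)
    (X_meas : jointly_measurable T X)
    (c0_gt0 : 0 < c0) (theta_ge0 : 0 <= theta)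
    (X_char : charfun_increments_bound P T X H c0 theta)
    (c1_ge0 : 0 <= c1) (iota_ge0 : 0 <= iota)
    (X_moment : moment_increments_bound P T X H c1 iota)
    (alpha_small : H * d%:R < 1 -> 0 <= alpha < d%:R)
    (alpha_large : 1 <= H * d%:R -> Num.max 0 (d%:R - H^-1) < alpha < d%:R)
    (L_local : alpha = 0 -> continuous_local_times P T X L) :
  (forall t : R, 0 < t < T ->
    exists c2 : R, 0 < c2 /\
    {ae P, forall w, (limf_esup (fun r : R => (
        ereal_sup [set (fractional_local_time_around T X alpha L w x t r *
          ((r `^ (1 - H * (d%:R - alpha)) *
           ln (ln r^-1) `^ (H * (theta + d%:R - alpha)))^-1)%R%:E)%E
          | x in [set: 'rV[R]_d]])%R) 0%R^'+ <= c2%:E)%E}) /\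
  (exists c3 : R, 0 < c3 /\
    {ae P, forall w, (limf_esup (fun r : R => (
        ereal_sup [set
          ereal_sup [set (fractional_local_time_around T X alpha L w x t r *
            ((r `^ (1 - H * (d%:R - alpha)) *
             ln r^-1 `^ (H * (theta + d%:R - alpha)))^-1)%R%:E)%E
            | x in [set: 'rV[R]_d]]
          | t in [set t : R | 0 < t < T]])%R) 0%R^'+ <= c3%:E)%E}).

Proof.
have /andP[H0 H1] := H_itv.
have d0 : (0 : R) < d%:R by rewrite ltr0n.
have al_ge0 : 0 <= alpha.
  have [/alpha_small/andP[]//|/alpha_large/andP[]] := ltP (H * d%:R) 1.
  by rewrite gt_max => /andP[/ltW].
have al_lt : alpha < d%:R.
  by have [/alpha_small|/alpha_large] := ltP (H * d%:R) 1; case/andP.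
(* Both regimes of [alpha] enter the rest of the argument only through this inequality and 0 <=
   alpha < d. *)
have Hb : H * (d%:R - alpha) < 1.
  have [Hd|/alpha_large] := ltP (H * d%:R) 1.
    by apply: le_lt_trans Hd; rewrite ler_pM2l// gerBl.
  rewrite gt_max => /andP[/andP[_ h] _].
  by rewrite -ltr_pdivlMl// mulr1; lra.
have [C [n0 [C_gt0 _ hC]]] : exists C n0,
    [/\ 0 < C, (0 < n0)%N & sup_bad_event_bound P T H theta alpha X L C n0].
  have [al0|al0] := eqVneq alpha 0.
    apply: (sup_bad_event_local_time (c0 := c0)) => //.
    by move: Hb; rewrite al0 subr0.
  by apply: (sup_bad_event_riesz (c0 := c0)) => //; rewrite lt_neqAle eq_sym al0 al_ge0.
have Lae : {ae P, forall w, alpha = 0 -> local_time_path T X L w}.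
  have [al0|al0] := eqVneq alpha 0.
    by apply: filterS (ae_local_time_path (L_local al0)).
  by apply: aeW => w; move: al0 => /eqP.
have p0 : 0 <= H * (theta + d%:R - alpha) by rewrite mulr_ge0 ?(ltW H0)//; lra.
have q0 : 0 <= 1 - H * (d%:R - alpha) by lra.
split=> [t tT|].
  exact: (limsup_fixed_time T_gt0 C_gt0 hC Lae p0 q0 tT).
exact: (limsup_uniform_time T_gt0 C_gt0 hC Lae p0 q0).
Qed.
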